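(* Let $\hat{P}_n=\mathbb{P}_n$ (the empirical bootstrap). Suppose that $\mathcal{F}$ is a $P_0$-Donsker class with $P_0^*(\eta_n\in\mathcal{F})\to1$, that $M\in(0,\infty)$ is such that $\|\eta_0\|_\infty<M$ and $\|\eta_n\|_\infty<M$ with probability tending to one, and that $\|\eta_n-\eta_0\|_{L_2(\lambda)}=o_{P_0^*}(n^{-1/4})$. Suppose also that $P_W^*(\eta_n^*\in\mathcal{F})\to1$ in $P_0^*$-outer probability, $P_W^*(\|\eta_n^*\|_\infty\ge M)=o_{P_0^*}(1)$, and $\|\eta_n^*-\eta_n\|_{L_2(\lambda)}=o_{P_W^*}(n^{-1/4})$. Then $$\psi_{n,1}^*=\psi_{n,1}+(\mathbb{P}_n^*-\mathbb{P}_n)\phi_0+o_{P_W^*}(n^{-1/2}).$$ If in addition $\int\eta_n^2-\mathbb{P}_n\eta_n=o_{P_0^*}(n^{-1/2})$ and $\int\eta_n^{*2}-\mathbb{P}_n^*\eta_n^*=o_{P_W^*}(n^{-1/2})$, then $$\psi_{n,2}^*=\psi_{n,2}+(\mathbb{P}_n^*-\mathbb{P}_n)\phi_0+o_{P_W^*}(n^{-1/2})\quad\text{and}\quad\psi_{n,3}^*=\psi_{n,3}+(\mathbb{P}_n^*-\mathbb{P}_n)\phi_0+o_{P_W^*}(n^{-1/2}).$$ Moreover, if $\eta_n$ and $\eta_n^*$ are kernel density estimators (based on the original and bootstrap data, respectively) with the same kernel and bandwidth $h$ such that $n^{-1/(2d)}\prec h$, then $\|\eta_n^*-\eta_n\|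_{L_2(\lambda)}=o_{P_W^*}(n^{-1/4})$.
   Context: $X_1,\dots,X_n\in\mathcal{X}\subseteq\mathbb{R}^d$ are IID from $P_0\in\mathcal{M}$, the set of probability measures on $\mathcal{X}$ dominated by Lebesgue measure $\lambda$. $\eta_P:=dP/d\lambda$, $\eta_0:=\eta_{P_0}$, $\psi(P):=\int\eta_P(x)^2dx$ (average density value), $\psi_0=\psi(P_0)$, $\phi_P:=2\eta_P-2\psi(P)$, $\phi_0:=\phi_{P_0}$. $\mathbb{P}_n$ is the empirical distribution; $Pf:=\int f\,dP$; $\int f$ denotes integration with respect to $\lambda$. $\eta_n$ is a density estimator of $\eta_0$ based on the data. $T_1(\eta,P)=2P\eta-\int\eta^2$ (one-step), $T_2(\eta,P)=\int\eta^2$ (plug-in), $T_3(\eta,P)=P\eta$ (empirical mean plug-in); $\psi_{n,j}:=T_j(\eta_n,\mathbb{P}_n)$. Bootstrap: given the data, $X_1^*,\dots,X_n^*$ are IID from $\hat{P}_n$, generated as $X_i^*=\gamma_n(X_1,\dots,X_n,W_{ni})$ with $W_{n1},\dots,W_{nn}$ IID with law $Q_n$ independent of the data. $\mathbb{P}_n^*$ is the empirical distribution of $X_1^*,\dots,X_n^*$; $\eta_n^*$ is an estimator of the density $\eta_0$ based on bootstrap and original data; $\psi_{n,j}^*:=T_j(\eta_n^*,\mathbb{P}_n^* )$. A kernel density estimator with kernel $K:\mathbb{R}^d\to\mathbb{R}$ and deterministic bandwidth $h=h_n>0$ based on $x_1,\dots,x_n$ is $x\mapsto\frac1n\sum_i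 h^{-d}K((x-x_i)/h)$; kernels satisfy $K(-x)=K(x)$, $\int K=1$, $\int K^2<\infty$. For deterministic sequences, $r_n\prec s_n$ means $r_n/s_n=o(1)$. $P_0^*$ is outer probability; $P_W^*$ is conditional outer probability given the data (over $W_{n1},\dots,W_{nn}$); $Y_n=o_{P_W^*}(r_n)$ means $P_W^*(|Y_n|/r_n\ge\varepsilon)\to0$ in $P_0^*$-outer probability for every $\varepsilon>0$. $\mathcal{F}$ is $P_0$-Donsker if $n^{1/2}(\mathbb{P}_n-P_0)$ converges weakly in $\ell^\infty(\mathcal{F})$ to a tight Borel measurable limit.
   Formalization: The assumptions P_0^*(η_n∈F)→1 and ''‖η_n‖_∞<M with probability tending to one'' are read as: the complementary events have outer probability tending to 0. With plain outer probability the claim fails for non-measurable events; for measurable events nothing changes. *)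

(* Defs.v *)
From HB Require Import structures.
From mathcomp Require Import all_boot all_order all_algebra.
From mathcomp Require Import all_classical all_reals all_analysis.
Set Implicit Arguments.
Unset Strict Implicit.
Unset Printing Implicit Defensive.
Import Order.TTheory GRing.Theory Num.Theory.
Import numFieldNormedType.Exports.

Local Open Scope classical_set_scope.
Local Open Scope ring_scope.

Section power_measure.
Context dT (T : measurableType dT) (R : realType).
Local Open Scope ereal_scope.

Definition tcons n (p : T * n.-tuple T) : n.+1.-tuple T := [tuple of p.1 :: p.2].

Lemma measurable_tcons n : measurable_fun [set: T * n.-tuple T] (@tcons n).
Proof. exact: measurable_cons measurable_fst measurable_snd. Qed.

HB.instance Definition _ n :=
  isMeasurableFun.Build _ _ _ _ (@tcons n) (@measurable_tcons n).

Definition tuncons n (t : n.+1.-tuple T) : T * n.-tuple T :=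
  (thead t, [tuple of behead t]).

Lemma tconsK n : cancel (@tcons n) (@tuncons n).
Proof.
by case=> x t; rewrite /tuncons theadE; congr pair; apply/val_inj.
Qed.

Lemma tunconsK n : cancel (@tuncons n) (@tcons n).
Proof. by move=> t; rewrite /tcons/= [RHS]tuple_eta. Qed.

Lemma measurable_tuncons n : measurable_fun [set: n.+1.-tuple T] (@tuncons n).
Proof.
by apply/measurable_fun_pairP; split; [exact: measurable_tnth|exact: measurable_behead].
Qed.

Variable mu : {sigma_finite_measure set T -> \bar R}.

Section step.
Variables (n : nat) (nu : {sigma_finite_measure set (n.-tuple T) -> \bar R}).

Definition power_measureS : set (n.+1.-tuple T) -> \bar R :=
  pushforward (mu \x nu) (@tcons n).

Let power_measureS0 : power_measureS set0 = 0.
Proof. exact: measure0. Qed.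

Let power_measureS_ge0 A : 0 <= power_measureS A.
Proof. exact: measure_ge0. Qed.

Let power_measureS_sigma_additive : semi_sigma_additive power_measureS.
Proof.
exact: (@measure_semi_sigma_additive _ _ _
  (pushforward (mu \x nu)%E (@tcons n) : {measure set _ -> \bar R})).
Qed.

HB.instance Definition _ := isMeasure.Build _ _ _ power_measureS
  power_measureS0 power_measureS_ge0 power_measureS_sigma_additive.

Let sigma_finiteS : sigma_finite setT power_measureS.
Proof.
have /sigma_finiteP[F [FT ndF mF]] := sigma_finiteT mu.
have /sigma_finiteP[G [GT ndG mG]] := sigma_finiteT nu.
exists (fun k => @tuncons n @^-1` (F k `*` G k)).
  rewrite -preimage_bigcup -[LHS](preimage_setT (@tuncons n)); congr preimage.
  apply/esym; rewrite -subTset => -[x t] _.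
  have [i _ Fix] : (\bigcup_i F i) x by rewrite -FT.
  have [j _ Gjt] : (\bigcup_i G i) t by rewrite -GT.
  exists (maxn i j) => //; split.
    by move: x Fix; exact/subsetPset/ndF/leq_maxl.
  by move: t Gjt; exact/subsetPset/ndG/leq_maxr.
move=> k; have [mFk Fkoo] := mF k; have [mGk Gkoo] := mG k; split.
  by rewrite -[X in measurable X]setTI; apply: measurable_tuncons => //; exact: measurableX.
rewrite /power_measureS /pushforward -comp_preimage.
have -> : (@tuncons n \o @tcons n) = id by apply/funext => p; exact: tconsK.
by rewrite preimage_id product_measure1E// lte_mul_pinfty// ge0_fin_numE.
Qed.

HB.instance Definition _ :=
  @Measure_isSigmaFinite.Build _ _ _ power_measureS sigma_finiteS.

End step.

(* The n-fold product measure mu (x) ... (x) mu on n-tuples. *)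
Fixpoint power_measure n : {sigma_finite_measure set (n.-tuple T) -> \bar R} :=
  if n is k.+1 then power_measureS (power_measure k) else \d_[tuple].

Lemma power_measureE n (A : 'I_n -> set T) : (forall i, measurable (A i)) ->
  power_measure n [set t | forall i, A i (tnth t i)] = \prod_(i < n) mu (A i).
Proof.
elim: n A => [|n ih] A mA.
  by rewrite big_ord0 /= diracE mem_set//= => -[].
rewrite big_ord_recl -ih//= /power_measureS /pushforward.
have mB : measurable [set t : n.-tuple T | forall i, A (lift ord0 i) (tnth t i)].
  rewrite (_ : mkset _ = \big[setI/setT]_(i < n)
      ((fun t : n.-tuple T => tnth t i) @^-1` A (lift ord0 i))).
    by apply: bigsetI_measurable => i _; rewrite -[X in measurable X]setTI;
      exact: measurable_tnth.
  rewrite -bigcap_seq; apply/seteqP; split => t /= tA i; first by move=> _; exact: tA.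
  by apply: tA; rewrite /= mem_index_enum.
rewrite -product_measure1E//; congr (_ _).
apply/seteqP; split => -[x t]/= xtA.
  split; first by have := xtA ord0.
  by move=> i; have := xtA (lift ord0 i); rewrite tnthS.
case: xtA => xA tA i; have [->//|] := eqVneq i ord0.
by case: (unliftP ord0 i) => [j ->|->]; rewrite ?eqxx// tnthS => _; exact: tA.
Qed.

End power_measure.

Lemma power_measureT dT (T : measurableType dT) (R : realType)
  (P : probability T R) n : power_measure P n setT = 1%E.
Proof.
transitivity (power_measure P n [set t | forall i : 'I_n, setT (tnth t i)]).
  by congr (_ _); apply/seteqP.
by rewrite (@power_measureE _ _ _ P n (fun=> setT))// big1// => i _; exact: (@probability_setT _ _ _ P).
Qed.

(* R^d, with its product (hence Borel) sigma-algebra. *)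
Notation Rd R d := (d.-tuple (measurableTypeR R)).

Definition leb (R : realType) (d : nat) : {sigma_finite_measure set (Rd R d) -> \bar R} :=
  power_measure (@lebesgue_measure R) d.

(* Lebesgue measure on X; all integrals and norms "w.r.t. lambda" use it. *)
Definition lebX (R : realType) (d : nat) (X : set (Rd R d)) (mX : measurable X) :
  {measure set (Rd R d) -> \bar R} := mrestr (leb R d) mX.

Section model.
Context (R : realType) (d : nat) (X : set (Rd R d)) (mX : measurable X).
Implicit Types (P : probability (Rd R d) R) (f : Rd R d -> R).

Definition model : set (probability (Rd R d) R) :=
  [set P | P X = 1%E /\ P `<< leb R d].

Definition density P (x : Rd R d) : R :=
  fine (Radon_Nikodym (charge_of_finite_measure P) (leb R d) x).

Definition psi P : R := \int[lebX mX]_x density P x ^+ 2.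

Definition phi P (x : Rd R d) : R := 2 * density P x - 2 * psi P.

Definition L2norm f : \bar R := 'N[lebX mX]_2%:E[EFin \o f]%E.

Definition Linfnorm f : \bar R := 'N[lebX mX]_+oo[EFin \o f]%E.

Definition T1 f (P : {measure set (Rd R d) -> \bar R}) : R :=
  2 * (\int[P]_x f x) - \int[lebX mX]_x f x ^+ 2.

Definition T2 f (P : {measure set (Rd R d) -> \bar R}) : R :=
  \int[lebX mX]_x f x ^+ 2.

Definition T3 f (P : {measure set (Rd R d) -> \bar R}) : R := \int[P]_x f x.

Definition sample_in n (x : n.-tuple (Rd R d)) := forall i, X (tnth x i).

(* The default value [point] of [nth] is never reached: i ranges over [0, n). *)
Definition emp n (x : n.-tuple (Rd R d)) : {measure set (Rd R d) -> \bar R} :=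
  mscale (n%:R^-1)%:nng (msum (fun i => \d_(nth point x i)) n).

End model.

Section donsker.
Context (R : realType) (d : nat) (X : set (Rd R d)).
Context (P0 : probability (Rd R d) R) (F : set (Rd R d -> R)).

(* ell^infty(F) sits in the space of all functions F -> R with the topology of
   uniform convergence, which restricts to that of the sup norm. *)
Definition ell_infty : set {uniform F -> R} :=
  [set z | exists C : R, forall f : F, `|(z : F -> R) f| <= C].

Definition emp_process n (x : n.-tuple (Rd R d)) : {uniform F -> R} :=
  fun f : F => Num.sqrt n%:R *
    (\int[emp x]_y set_val f y - \int[P0]_y set_val f y).

Definition outer_expectation dT (T : measurableType dT)
    (P : {measure set T -> \bar R}) (f : T -> \bar R) : \bar R :=
  ereal_inf [set (\int[P]_x g x)%E | g in
    [set g | P.-integrable [set: T] g /\ forall x, (f x <= g x)%E]].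

Definition Donsker : Prop :=
  (forall f, F f -> P0.-integrable [set: Rd R d] (EFin \o f)) /\
  (forall n (x : n.-tuple (Rd R d)), sample_in X x -> ell_infty (emp_process x)) /\
  exists (dO : measure_display) (O : measurableType dO) (PO : probability O R)
         (G : O -> {uniform F -> R}),
    [/\ (forall w, ell_infty (G w)),
        (forall U : set {uniform F -> R}, open U -> measurable (G @^-1` U)),
        (forall eps : R, 0 < eps -> exists K : set {uniform F -> R},
          [/\ compact K, K `<=` ell_infty & ((1 - eps)%:E <= PO (G @^-1` K))%E]) &
        (forall h : {uniform F -> R} -> R,
          {within ell_infty, continuous h} ->
          (exists C : R, forall z, ell_infty z -> `|h z| <= C) ->
          outer_expectation (power_measure P0 n)
            (fun x => (h (emp_process x))%:E) @[n --> \oo] -->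
          (\int[PO]_w (h (G w))%:E)%E)].

End donsker.

Section stochastic_order.
Context (R : realType) (d : nat) (P0 : probability (Rd R d) R).
Context (dW : nat -> measure_display) (W : forall n, measurableType (dW n)).
Context (Q : forall n, probability (W n) R).

(* [mu_ext mu A] is the infimum of mu over measurable covers of A. *)
Definition P0outer n (A : set (n.-tuple (Rd R d))) : \bar R :=
  mu_ext (power_measure P0 n) A.

Definition PWouter n (B : set (n.-tuple (W n))) : \bar R :=
  mu_ext (power_measure (Q n) n) B.

Definition cvg_P0outer (Z : forall n, n.-tuple (Rd R d) -> \bar R) (l : R) :=
  forall delta : R, 0 < delta ->
    P0outer [set x | delta%:E <= `|Z n x - l%:E|]%E @[n --> \oo] --> 0%E.

Definition oP0 (Y : forall n, n.-tuple (Rd R d) -> \bar R) (r : nat -> R) :=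
  cvg_P0outer (fun n x => Y n x * ((r n)^-1)%:E)%E 0.

Definition oPW (Y : forall n, n.-tuple (Rd R d) -> n.-tuple (W n) -> \bar R)
    (r : nat -> R) :=
  forall eps : R, 0 < eps ->
    cvg_P0outer (fun n x =>
      PWouter [set w | eps%:E <= `|Y n x w| * ((r n)^-1)%:E]%E) 0.

End stochastic_order.

Section bootstrap.
Context (R : realType) (d : nat).
Context (dW : nat -> measure_display) (W : forall n, measurableType (dW n)).

Definition boot (gamma : forall n, n.-tuple (Rd R d) -> W n -> Rd R d) n
    (x : n.-tuple (Rd R d)) (w : n.-tuple (W n)) : n.-tuple (Rd R d) :=
  [tuple gamma n x (tnth w i) | i < n].

(* Given the data x, the law \hat P_n of each bootstrap draw is the empirical
   distribution of x. *)
Definition empirical_bootstrap (X : set (Rd R d)) (Q : forall n, probability (W n) R)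
    (gamma : forall n, n.-tuple (Rd R d) -> W n -> Rd R d) :=
  forall n (x : n.-tuple (Rd R d)), (0 < n)%N -> sample_in X x ->
    measurable_fun [set: W n] (gamma n x) /\
    forall A, measurable A -> pushforward (Q n) (gamma n x) A = emp x A.

End bootstrap.

Section kernel.
Context (R : realType) (d : nat).

Definition is_kernel (K : Rd R d -> R) : Prop :=
  [/\ forall x : Rd R d, K [tuple - (tnth x j : R) | j < d] = K x,
      (leb R d).-integrable [set: Rd R d] (EFin \o K),
      \int[leb R d]_x K x = 1 &
      (leb R d).-integrable [set: Rd R d] (fun x => (K x ^+ 2)%:E)].

Definition kde (K : Rd R d -> R) (h : R) n (x : n.-tuple (Rd R d)) (y : Rd R d) : R :=
  n%:R^-1 * \sum_(i < n)
    h ^- d * K [tuple ((tnth y j : R) - tnth (tnth x i) j) / h | j < d].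

End kernel.

Definition prec (R : realType) (r s : nat -> R) : Prop :=
  r n / s n @[n --> \oo] --> (0 : R).

(* Main.v *)
(** Write r(n) for sqrt n.  The one-step remainder equals
      2 (P* - P)(eta* - eta0) + 2 (P - P0)(eta* - eta)
        - int (eta* - eta)^2 - 2 int (eta - eta0)(eta* - eta),
    where P and P* are the empirical measures of the data and of the bootstrap
    sample.  The two integrals are o(1 / r(n)) by the L2 rates.  The second term
    is handled by asymptotic equicontinuity of the empirical process over F and
    eta0: the tight Donsker limit concentrates on finitely many balls of positive
    probability, and Chebyshev's inequality, passed to the limit, forces the center
    of such a ball to be almost constant on L2-close pairs.

    The first term needs the same equicontinuity for the bootstrap.  Given the
    data, the bootstrap sample is the data read through a uniformly random index
    function, and the sum of f over it is the sum over j of the sums of f over the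
    points drawn more than j times.  For fixed indices each of these is a centered
    sum over at most n independent points.  Small j are covered by equicontinuity
    at all sample sizes up to n; for large j the number of points is at most
    n / 16^j outside an event of small probability, and a tail bound, geometric in
    the threshold and obtained by doubling the sample size, makes them negligible.

    The other two remainders differ from the first by multiples of the assumed
    o(1 / r(n)) terms.  For kernel estimators the conditional variance of eta* - eta
    integrates to at most int K^2 / (n h^d). *)

Require Import Defs.
From HB Require Import structures.
From mathcomp Require Import all_boot all_order all_algebra.
From mathcomp Require Import all_classical all_reals all_analysis.
From mathcomp Require Import measurable_realfun ess_sup_inf ring lra.
Set Implicit Arguments.
Unset Strict Implicit.
Unset Printing Implicit Defensive.
Import Order.TTheory GRing.Theory Num.Theory.
Import numFieldNormedType.Exports.

Local Open Scope classical_set_scope.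
Local Open Scope ring_scope.

(** * Outer measure and products *)

(** Suprema over [F] need not be measurable, so probabilities are outer ones: only subadditive, and
    without a Fubini theorem. The bootstrap argument therefore works with events rather than
    expectations of suprema, and multiplies an outer probability only by that of an independent
    measurable event, obtained from a measurable cover. The conditional bootstrap probability is
    never integrated over the data: being a finite average over n^n index functions, it is handled
    by Markov's inequality for a finite sum of events, after which the indices are fixed and only
    the data are random. The constants 64, 16 and 3/2 belong together. An exponential moment with
    base 64 makes the expected size of level j of order n / 64^j. The cutoff n / 16^j leaves a
    probability of order 4^-j in Markov's inequality and bounds the square root of the size by r(n)
    / 4^j. With the threshold (3/2)^j of the tail bound, level j contributes a multiple of (3/8)^j
    r(n). All these series are dominated by the geometric series of ratio 2/3. The ratio 3/2 is
    taken above sqrt 2, the factor lost by doubling the sample size. *)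

Definition box T n (A : 'I_n -> set T) : set (n.-tuple T) :=
  [set t | forall i, A i (tnth t i)].

Section tuple_measure.
Context dT (T : measurableType dT) (R : realType).
Local Open Scope ereal_scope.

Lemma measurable_box n (A : 'I_n -> set T) :
  (forall i, measurable (A i)) -> measurable (box A).
Proof.
move=> mA; rewrite (_ : box A = \big[setI/setT]_(i < n)
    ((fun t : n.-tuple T => tnth t i) @^-1` A i)).
  by apply: bigsetI_measurable => i _; rewrite -[X in measurable X]setTI;
    exact: measurable_tnth.
rewrite -bigcap_seq; apply/seteqP; split => t /= tA i; first by move=> _; exact: tA.
by apply: tA; rewrite /= mem_index_enum.
Qed.

(** Boxes form a pi-system generating the product sigma-algebra, and the cubes over a sigma-finite
    exhaustion of [mu] are boxes of finite measure. This identifies the laws of subsamples, of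
    concatenations and of the bootstrap sample, and scaled Lebesgue measure. *)
Lemma box_unique (mu : {sigma_finite_measure set T -> \bar R}) n
    (nu : {measure set (n.-tuple T) -> \bar R}) :
  (forall A, (forall i, measurable (A i)) -> nu (box A) = \prod_(i < n) mu (A i)) ->
  forall U, measurable U -> nu U = power_measure mu n U.
Proof.
move=> nuE U mU.
have /sigma_finiteP[F [FT ndF mF]] := sigma_finiteT mu.
pose G : set (set (n.-tuple T)) :=
  [set B | exists2 A : 'I_n -> set T, (forall i, measurable (A i)) & B = box A].
apply/esym; apply: (measure_unique G (fun k => box (fun _ : 'I_n => F k))) => //.
- apply/seteqP; split => B.
    move=> mB; apply: (smallest_sub _ _ mB); first exact: smallest_sigma_algebra.
    move=> C; rewrite -bigcup_seq => -[i /= _ [A mA <-]].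
    apply: sub_sigma_algebra; exists (fun j => if j == i then A else setT).
      by move=> j; case: ifP.
    rewrite setTI; apply/seteqP; split => [t At j /=|t /(_ i)]; last by rewrite eqxx.
    by case: eqP => // ->.
  apply: smallest_sub; first exact: sigma_algebra_measurable.
  by move=> _ [A mA ->]; exact: measurable_box.
- move=> _ _ [A mA ->] [B mB ->]; exists (fun i => A i `&` B i).
    by move=> i; exact: measurableI.
  apply/seteqP; split => [t [At Bt] i|t ABt]; first by split.
  by split => i; case: (ABt i).
- by move=> k; exists (fun=> F k) => // i; case: (mF k).
- rewrite -subTset => t _.
  have Ft i : exists k, F k (tnth t i).
    have : (\bigcup_k F k) (tnth t i) by rewrite -FT.
    by case=> k _ ?; exists k.
  have [k Fk] := choice Ft.
  exists (\max_(i < n) k i)%N => // i /=.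
  by apply: subsetPset (Fk i); apply: ndF; exact: leq_bigmax.
- by move=> _ [A mA ->]; rewrite nuE// -power_measureE.
- move=> k; rewrite [X in X < _]power_measureE//; last by move=> ?; case: (mF k).
  rewrite -ge0_fin_numE; last by apply: prode_ge0 => j _; exact: measure_ge0.
  apply: (big_ind (fun x => x \is a fin_num)) => //= [x y|i _].
    exact: fin_numM.
  by case: (mF k) => mFk; rewrite ge0_fin_numE.
Qed.

End tuple_measure.

Section outer_measure.
Context d (T : measurableType d) (R : realType).
Local Open Scope ereal_scope.

Lemma mu_ext_approx (mu : {measure set T -> \bar R}) A c :
  mu_ext mu A < c -> exists U, [/\ measurable U, A `<=` U & mu U < c].
Proof.
move=> /ereal_inf_lt[_ [F [mF AF] <-] Fc].
exists (\bigcup_k F k); split => //; first exact: bigcup_measurable.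
apply: le_lt_trans Fc; apply: measure_sigma_subadditive => //.
exact: bigcup_measurable.
Qed.

Lemma mu_ext_le_measure (mu : {measure set T -> \bar R}) A U :
  measurable U -> A `<=` U -> mu_ext mu A <= mu U.
Proof. by move=> mU AU; rewrite -measurable_mu_extE//; exact: le_mu_ext. Qed.

Lemma le_mu_extP (mu : {measure set T -> \bar R}) A c :
  (forall U, measurable U -> A `<=` U -> c <= mu U) -> c <= mu_ext mu A.
Proof.
move=> h; rewrite leNgt; apply/negP => /mu_ext_approx[U [mU AU]].
by rewrite ltNge h.
Qed.

Lemma mu_ext_bigcup_ord (mu : {measure set T -> \bar R}) n (A : 'I_n -> set T) :
  mu_ext mu [set x | exists i, A i x] <= \sum_(i < n) mu_ext mu (A i).
Proof.
elim: n A => [|n ih] A.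
  rewrite big_ord0 (_ : mkset _ = set0) ?mu_ext0//.
  by apply/seteqP; split => x // -[[]].
rewrite big_ord_recl.
apply: (@le_trans _ _ (mu_ext mu (A ord0 `|` [set x | exists i, A (lift ord0 i) x]))).
  apply: le_mu_ext => x [i]; have [->|] := eqVneq i ord0; first by left.
  by case: (unliftP ord0 i) => [j ->|->]; rewrite ?eqxx// => _ ?; right; exists j.
by apply: (le_trans (outer_measureU2 _ _ _)); apply: leeD2l; exact: ih.
Qed.

End outer_measure.

(** Measurable covers pull back to measurable covers. Only an inequality results, since the preimage
    may have smaller covers that are not preimages. *)
Lemma mu_ext_preimage d d' (T : measurableType d) (T' : measurableType d')
    (R : realType) (phi : T -> T')
    (mu : {measure set T -> \bar R}) (nu : {measure set T' -> \bar R}) A :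
  measurable_fun setT phi ->
  (forall U, measurable U -> mu (phi @^-1` U) = nu U) ->
  (mu_ext mu (phi @^-1` A) <= mu_ext nu A)%E.
Proof.
move=> mphi munu; apply: le_mu_extP => U mU AU; rewrite -munu//.
apply: mu_ext_le_measure; last by move=> x /= /AU.
by rewrite -[X in measurable X]setTI; exact: mphi.
Qed.

Section outer_product.
Context d1 d2 (T1 : measurableType d1) (T2 : measurableType d2) (R : realType).
Variables (m1 : {sigma_finite_measure set T1 -> \bar R})
  (m2 : {sigma_finite_measure set T2 -> \bar R}).
Local Open Scope ereal_scope.

(** The half of Fubini that survives for outer measures: each section of [U] over a point of [A]
    contains [B], so its measure is at least the outer measure of [B], and these measures depend
    measurably on the point because [U] is measurable. *)
Lemma mu_ext_product1 (A : set T1) (B : set T2) (U : set (T1 * T2)) :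
  measurable A -> measurable U -> A `*` B `<=` U ->
  m1 A * mu_ext m2 B <= (m1 \x m2) (U `&` (A `*` setT)).
Proof.
move=> mA mU ABU.
have mUA : measurable (U `&` A `*` setT) by apply: measurableI => //; exact: measurableX.
rewrite /product_measure1 muleC -integral_cst//.
apply: (@le_trans _ _ (\int[m1]_(x in A) (m2 \o xsection (U `&` A `*` setT)) x)).
  apply: ge0_le_integral => //.
  - by move=> ? _; exact: mu_ext_ge0.
  - by apply: measurable_funTS; exact: measurable_fun_xsection.
  move=> x Ax; apply: mu_ext_le_measure; first exact: measurable_xsection.
  by move=> y By; rewrite /xsection/= inE; split => //; exact: ABU.
by apply: ge0_subset_integral => //; exact: measurable_fun_xsection.
Qed.

Lemma mu_ext_product2 (A : set T1) (B : set T2) (U : set (T1 * T2)) :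
  measurable B -> measurable U -> A `*` B `<=` U ->
  mu_ext m1 A * m2 B <= (m1 \x m2) (U `&` (setT `*` B)).
Proof.
move=> mB mU ABU.
have mUB : measurable (U `&` setT `*` B) by apply: measurableI => //; exact: measurableX.
(* The product measure is now computed by integrating over the second coordinate, where the set [B]
   is measurable. *)
rewrite (product_measure_unique (m' := m1 \x^ m2))//=; last by move=> *; exact: product_measure2E.
rewrite /product_measure2 -integral_cst//.
apply: (@le_trans _ _ (\int[m2]_(x in B) (m1 \o ysection (U `&` setT `*` B)) x)).
  apply: ge0_le_integral => //.
  - by move=> ? _; exact: mu_ext_ge0.
  - by apply: measurable_funTS; exact: measurable_fun_ysection.
  move=> x Bx; apply: mu_ext_le_measure; first exact: measurable_ysection.
  by move=> y Ay; rewrite /ysection/= inE; split => //; exact: ABU.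
by apply: ge0_subset_integral => //; exact: measurable_fun_ysection.
Qed.

End outer_product.

Definition subt T m n (f : 'I_m -> 'I_n) (x : n.-tuple T) : m.-tuple T :=
  [tuple tnth x (f k) | k < m].

Definition catt T m n (p : m.-tuple T * n.-tuple T) : (m + n).-tuple T :=
  [tuple of p.1 ++ p.2].

Lemma tnth_subt T m n (f : 'I_m -> 'I_n) (x : n.-tuple T) k :
  tnth (subt f x) k = tnth x (f k).
Proof. by rewrite tnth_mktuple. Qed.

Section power_probability.
Context dT (T : measurableType dT) (R : realType) (P : probability T R).

Lemma measurable_subt m n (f : 'I_m -> 'I_n) :
  measurable_fun [set: n.-tuple T] (@subt T m n f).
Proof.
apply/measurable_fun_tnthP => i.
rewrite (_ : _ \o _ = fun x : n.-tuple T => tnth x (f i)); first exact: measurable_tnth.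
by apply/funext => x /=; rewrite tnth_subt.
Qed.

HB.instance Definition _ m n f :=
  isMeasurableFun.Build _ _ _ _ (@subt T m n f) (@measurable_subt m n f).

Lemma tnth_cattl m n (p : m.-tuple T * n.-tuple T) i :
  tnth (catt p) (lshift n i) = tnth p.1 i.
Proof. by rewrite tnth_lshift. Qed.

Lemma tnth_cattr m n (p : m.-tuple T * n.-tuple T) i :
  tnth (catt p) (rshift m i) = tnth p.2 i.
Proof. by rewrite tnth_rshift. Qed.

Lemma measurable_catt m n :
  measurable_fun [set: m.-tuple T * n.-tuple T] (@catt T m n).
Proof.
apply/measurable_fun_tnthP => i; case: (split_ordP i) => j -> {i}.
  rewrite (_ : _ \o _ = (fun x : m.-tuple T => tnth x j) \o fst).
    by apply: measurableT_comp => //; exact: measurable_tnth.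
  by apply/funext => x /=; rewrite tnth_cattl.
rewrite (_ : _ \o _ = (fun x : n.-tuple T => tnth x j) \o snd).
  by apply: measurableT_comp => //; exact: measurable_tnth.
by apply/funext => x /=; rewrite tnth_cattr.
Qed.

HB.instance Definition _ m n :=
  isMeasurableFun.Build _ _ _ _ (@catt T m n) (@measurable_catt m n).

Local Open Scope ereal_scope.

(** Pulled back, a box constrains only the coordinates in the range of [f], each exactly once
    because [f] is injective; the others contribute a factor 1. *)
Lemma power_measure_subt m n (f : 'I_m -> 'I_n) U : injective f -> measurable U ->
  power_measure P n (@subt T m n f @^-1` U) = power_measure P m U.
Proof.
move=> fI mU.
rewrite -(@box_unique _ _ _ _ _ (pushforward (power_measure P n) (@subt T m n f)))//.
move=> A mA.
pose B i := if [pick k | f k == i] is Some k then A k else setT.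
have Bf k : B (f k) = A k.
  rewrite /B; case: pickP => [j /eqP /fI ->//|/(_ k)]; by rewrite eqxx.
transitivity (power_measure P n (box B)).
  congr (power_measure P n _); apply/seteqP; split => x /= xA i.
    rewrite /B; case: pickP => [k /eqP <-|//].
    by have := xA k; rewrite tnth_subt.
  by rewrite tnth_subt -Bf; exact: xA.
rewrite power_measureE; last by move=> i; rewrite /B; case: pickP.
rewrite (bigID (mem [set f k | k : 'I_m]%SET))/= [X in _ * X]big1 ?mule1; last first.
  move=> i; rewrite /B; case: pickP => [k /eqP <- /imsetP[]|_ _]; last first.
    exact: (@probability_setT _ _ _ P).
  by exists k.
rewrite big_imset/=; last by move=> ? ? _ _; exact: fI.
by apply: eq_bigr => k _; rewrite Bf.
Qed.

Lemma power_measure_catt m n U : measurable U ->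
  (power_measure P m \x power_measure P n) (@catt T m n @^-1` U) =
  power_measure P (m + n) U.
Proof.
move=> mU.
rewrite -(@box_unique _ _ _ _ _ (pushforward (power_measure P m \x power_measure P n)
  (@catt T m n)))//.
move=> A mA.
transitivity ((power_measure P m \x power_measure P n)
  (box (fun i => A (lshift n i)) `*` box (fun i => A (rshift m i)))); last first.
  rewrite product_measure1E; [|exact: measurable_box..].
  by rewrite big_split_ord/= !power_measureE.
congr ((_ \x _) _); apply/seteqP; split => p /=.
  by move=> pA; split => i; [have := pA (lshift n i)|have := pA (rshift m i)];
    rewrite ?tnth_cattl ?tnth_cattr.
move=> [p1 p2] i; case: (split_ordP i) => j -> {i}.
  by rewrite tnth_cattl; exact: p1.
by rewrite tnth_cattr; exact: p2.
Qed.

End power_probability.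

(* [fine] loses nothing: the outer measure is at most 1. *)
Definition po d (T : measurableType d) (R : realType) (P : probability T R) n
  (A : set (n.-tuple T)) : R := fine (mu_ext (power_measure P n) A).

Section po_theory.
Context d (T : measurableType d) (R : realType) (P : probability T R).
Implicit Types n : nat.

Lemma poE n (A : set (n.-tuple T)) : mu_ext (power_measure P n) A = (po P A)%:E.
Proof.
rewrite /po fineK// ge0_fin_numE ?mu_ext_ge0//.
by apply: le_lt_trans (ltry 1); rewrite -(power_measureT P n); exact: mu_ext_le_measure.
Qed.

Lemma po_ge0 n (A : set (n.-tuple T)) : 0 <= po P A.
Proof. by rewrite -lee_fin -poE; exact: mu_ext_ge0. Qed.

Lemma po_le1 n (A : set (n.-tuple T)) : po P A <= 1.
Proof. by rewrite -lee_fin -poE -(power_measureT P n); exact: mu_ext_le_measure. Qed.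

Lemma le_po n (A B : set (n.-tuple T)) : A `<=` B -> po P A <= po P B.
Proof. by move=> AB; rewrite -lee_fin -!poE; exact: le_mu_ext. Qed.

Lemma po0 n : po P (set0 : set (n.-tuple T)) = 0.
Proof. by apply: EFin_inj; rewrite -poE mu_ext0. Qed.

Lemma poU n (A B : set (n.-tuple T)) : po P (A `|` B) <= po P A + po P B.
Proof. by rewrite -lee_fin EFinD -!poE; exact: outer_measureU2. Qed.

Lemma po_bigcup_ord n k (A : 'I_k -> set (n.-tuple T)) :
  po P [set x | exists i, A i x] <= \sum_(i < k) po P (A i).
Proof.
rewrite -lee_fin -sumEFin -poE; apply: le_trans (mu_ext_bigcup_ord _ _) _.
by apply: lee_sum => i _; rewrite poE.
Qed.

Lemma measurable_po n (A : set (n.-tuple T)) : measurable A ->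
  power_measure P n A = (po P A)%:E.
Proof. by move=> mA; rewrite -poE measurable_mu_extE. Qed.

Lemma po_approx n (A : set (n.-tuple T)) (e : R) : 0 < e ->
  exists U, [/\ measurable U, A `<=` U & po P U < po P A + e].
Proof.
move=> e0; have : (mu_ext (power_measure P n) A < (po P A + e)%:E)%E.
  by rewrite poE lte_fin ltrDl.
move=> /mu_ext_approx[U [mU AU]]; rewrite [X in (X < _)%E](measurable_po mU) lte_fin => h.
by exists U.
Qed.

Lemma po_setC n (A : set (n.-tuple T)) : measurable A -> po P (~` A) = 1 - po P A.
Proof.
move=> mA; have : power_measure P n setT = (power_measure P n A + power_measure P n (~` A))%E.
  by rewrite -(setUCr A); apply: measureU => //; [exact: measurableC|exact: setICr].
rewrite power_measureT (measurable_po mA) (measurable_po (measurableC mA)) -EFinD.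
by move=> [->]; ring.
Qed.

Lemma po_subt m n (f : 'I_m -> 'I_n) (A : set (m.-tuple T)) : injective f ->
  po P (@subt T m n f @^-1` A) <= po P A.
Proof.
move=> fI; rewrite -lee_fin -!poE; apply: mu_ext_preimage => //.
by move=> U mU; exact: power_measure_subt.
Qed.

Lemma po_cat2 m n (A : set (m.-tuple T)) (C : set (n.-tuple T))
    (U : set ((m + n).-tuple T)) :
  measurable C -> measurable U -> (forall a b, A a -> C b -> U (catt (a, b))) ->
  po P A * po P C <= po P (U `&` (@subt T n (m + n) (@rshift m n)) @^-1` C).
Proof.
move=> mC mU ACU.
have mC' : measurable ((@subt T n (m + n) (@rshift m n)) @^-1` C).
  by rewrite -[X in measurable X]setTI; exact: measurable_subt.
have mU' : measurable (@catt T m n @^-1` U).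
  by rewrite -[X in measurable X]setTI; exact: measurable_catt.
rewrite -lee_fin EFinM -(measurable_po mC) -(measurable_po (measurableI _ _ mU mC')).
rewrite -poE -power_measure_catt; last exact: measurableI.
apply: le_trans (mu_ext_product2 _ _ mC mU' _) _; first by move=> [a b] [/= ? ?]; exact: ACU.
rewrite le_eqVlt; apply/orP; left; apply/eqP; congr ((_ \x _)%E _).
have sub b : subt (@rshift m n) (catt b) = b.2 :> n.-tuple T.
  by apply: eq_from_tnth => i; rewrite tnth_subt tnth_cattr.
by apply/seteqP; split => -[a b]/= []; rewrite sub/=; [move=> ? []|].
Qed.

(** The conclusion retains the event [C] on the first block: this is what makes the two
    contributions in [po_double] disjoint. *)
Lemma po_cat1 m n (A : set (n.-tuple T)) (C : set (m.-tuple T))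
    (U : set ((m + n).-tuple T)) :
  measurable C -> measurable U -> (forall a b, C a -> A b -> U (catt (a, b))) ->
  po P C * po P A <= po P (U `&` (@subt T m (m + n) (@lshift m n)) @^-1` C).
Proof.
move=> mC mU ACU.
have mC' : measurable ((@subt T m (m + n) (@lshift m n)) @^-1` C).
  by rewrite -[X in measurable X]setTI; exact: measurable_subt.
have mU' : measurable (@catt T m n @^-1` U).
  by rewrite -[X in measurable X]setTI; exact: measurable_catt.
rewrite -lee_fin EFinM -(measurable_po mC) -(measurable_po (measurableI _ _ mU mC')).
rewrite -poE -power_measure_catt; last exact: measurableI.
apply: le_trans (mu_ext_product1 _ _ mC mU' _) _; first by move=> [a b] [/= ? ?]; exact: ACU.
rewrite le_eqVlt; apply/orP; left; apply/eqP; congr ((_ \x _)%E _).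
have sub b : subt (@lshift m n) (catt b) = b.1 :> m.-tuple T.
  by apply: eq_from_tnth => i; rewrite tnth_subt tnth_cattl.
by apply/seteqP; split => -[a b]/= []; rewrite sub/=; [move=> ? []|].
Qed.

(** Replace [B] by a measurable cover [C] of nearly the same probability. The complement of [C] is
    measurable, lies in that of [B], and is independent of the first block. *)
Lemma po_cat m n (A : set (m.-tuple T)) (B : set (n.-tuple T))
    (E : set ((m + n).-tuple T)) :
  (forall a b, A a -> ~ B b -> E (catt (a, b))) ->
  po P A * (1 - po P B) <= po P E.
Proof.
move=> ABE; apply/ler_addgt0Pr => e e0.
have e2 : 0 < e / 2 by rewrite divr_gt0.
have [C [mC BC PC]] := po_approx B e2.
have [U [mU EU PU]] := po_approx E e2.
have : po P A * (1 - po P C) <= po P U.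
  rewrite -po_setC//; apply: le_trans (po_cat2 (measurableC mC) mU _) (le_po _).
    by move=> a b Aa nCb; apply: EU; apply: ABE => // /BC.
  by move=> ? [].
by have := po_ge0 A; have := po_le1 A; nra.
Qed.

(** The two ways of landing in [E] are separated by whether the first half lies in a measurable
    cover [C] of [B]. It does not when the second half is in [A], and it does when the first half is
    in [A], as [A] is contained in [B]. Disjointness yields the factor 2, although [A] itself need
    not be measurable. *)
Lemma po_double m (A B : set (m.-tuple T)) (E : set ((m + m).-tuple T)) :
  A `<=` B ->
  (forall a b, A a -> ~ B b -> E (catt (a, b)) /\ E (catt (b, a))) ->
  2 * po P A * (1 - po P B) <= po P E.
Proof.
move=> AB ABE; apply/ler_addgt0Pr => e e0.
have e4 : 0 < e / 4 by rewrite divr_gt0.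
have [C [mC BC PC]] := po_approx B e4.
have [U [mU EU PU]] := po_approx E e4.
have mC1 : measurable ((@subt T m (m + m) (@lshift m m)) @^-1` (~` C)).
  by rewrite -[X in measurable X]setTI; apply: measurable_subt => //; exact: measurableC.
have mC2 : measurable ((@subt T m (m + m) (@lshift m m)) @^-1` C).
  by rewrite -[X in measurable X]setTI; exact: measurable_subt.
have h1 : (1 - po P C) * po P A <=
    po P (U `&` (@subt T m (m + m) (@lshift m m)) @^-1` (~` C)).
  rewrite -po_setC//; apply: po_cat1 => //; first exact: measurableC.
  by move=> a b nCa Ab; apply: EU; apply: (ABE _ _ Ab _).2 => /BC.
have h2 : (1 - po P C) * po P A <=
    po P (U `&` (@subt T m (m + m) (@lshift m m)) @^-1` C).
  rewrite mulrC -po_setC//.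
  apply: le_trans (@po_cat2 m m A (~` C)
    (U `&` (@subt T m (m + m) (@lshift m m)) @^-1` C) _ _ _) (le_po _).
  - exact: measurableC.
  - exact: measurableI.
  - move=> a b Aa nCb; split; first by apply: EU; apply: (ABE _ _ Aa _).1 => /BC.
    rewrite /= (_ : subt _ _ = a); first exact/BC/AB.
    by apply: eq_from_tnth => i; rewrite tnth_subt tnth_cattl.
  - by move=> ? [].
have : po P (U `&` (@subt T m (m + m) (@lshift m m)) @^-1` (~` C)) +
    po P (U `&` (@subt T m (m + m) (@lshift m m)) @^-1` C) <= po P U.
  rewrite -lee_fin EFinD -!measurable_po//; [|exact: measurableI..].
  rewrite -measureU//; [|exact: measurableI..|]; last first.
    by rewrite -subset0 => x [[_ /= nC] [_ /= /nC]].
  apply: le_measure; rewrite ?inE//; last by move=> x [] [].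
  by apply: measurableU; exact: measurableI.
by have := po_ge0 A; have := po_le1 A; nra.
Qed.

Lemma po_null n (X : set T) : measurable X -> P X = 1%E ->
  po P [set x : n.-tuple T | ~ forall i, X (tnth x i)] = 0.
Proof.
move=> mX PX.
have mB : measurable (box (fun _ : 'I_n => X)) by apply: measurable_box.
rewrite -[mkset _]/(~` (box (fun _ : 'I_n => X))) po_setC//.
apply/eqP; rewrite subr_eq0 eq_sym; apply/eqP/EFin_inj.
by rewrite -measurable_po// power_measureE// big1.
Qed.

Lemma po_cvg0P (A : forall n, set (n.-tuple T)) :
  (mu_ext (power_measure P n) (A n) @[n --> \oo] --> 0%E) <->
  (forall e, 0 < e -> \forall n \near \oo, po P (A n) < e).
Proof.
rewrite (_ : (fun n => mu_ext _ _) = EFin \o (fun n => po P (A n))); last first.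
  by apply/funext => n /=; rewrite poE.
split=> [/fine_cvgP[_ /cvgrPdist_lt h] e /h|h].
  apply: filterS => n /=; rewrite sub0r normrN ger0_norm//; exact: po_ge0.
apply/fine_cvgP; split; first by apply: nearW => n.
apply/cvgrPdist_lt => e /h; apply: filterS => n /=.
by rewrite sub0r normrN ger0_norm//; exact: po_ge0.
Qed.

(** The sum of the indicators of the [A i] need not be measurable, but it is dominated by that of
    finitely many measurable covers, to which Markov's inequality applies. Each cover may exceed its
    set by c / N. *)
Lemma po_markov_avg n (I : finType) (A : I -> set (n.-tuple T)) (e : R) :
  0 < e -> (0 < #|I|)%N ->
  po P [set x | e * #|I|%:R <= \sum_(i : I) (`[< A i x >] : nat)%:R] <=
  (\sum_(i : I) po P (A i)) / (e * #|I|%:R).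
Proof.
move=> e0 I0; set N := (#|I|%:R : R); have N0 : 0 < N by rewrite ltr0n.
rewrite ler_pdivlMr ?mulr_gt0//; apply/ler_addgt0Pr => c c0.
have [U UA] := choice (fun i => po_approx (A i) (divr_gt0 c0 N0)).
have mU i : measurable (U i) by case: (UA i).
pose g x : \bar R := (\sum_(i : I) (\1_(U i) x)%:E)%E.
have mg : measurable_fun setT g.
  by apply: emeasurable_sum => i; apply/measurable_EFinP; exact: measurable_indic.
have eN : 0 < e * N by rewrite mulr_gt0.
have := le_integral_abse (power_measure P n) measurableT mg eN.
rewrite (eq_integral g); last first.
  by move=> x _; rewrite gee0_abs// sume_ge0// => i _; rewrite lee_fin.
rewrite ge0_integral_sum//; last first.
  by move=> i; apply/measurable_EFinP; exact: measurable_indic.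
rewrite (eq_bigr (fun i => (po P (U i))%:E)); last first.
  by move=> i _; rewrite integral_indic// setIT -measurable_po.
rewrite sumEFin setTI => h.
rewrite -lee_fin; apply: (@le_trans _ _ (\sum_i po P (U i))%:E).
  apply: le_trans h; rewrite muleC EFinM -poE lee_pmul2r ?lte_fin//.
  apply: mu_ext_le_measure.
    rewrite -[X in measurable X]setTI.
    by apply: emeasurable_fun_c_infty => //; exact: measurableT_comp.
  move=> x /= h; rewrite /g sumEFin lee_fin ger0_norm; last by apply: sumr_ge0.
  apply: le_trans h _; apply: ler_sum => i _; rewrite indicE.
  case: asboolP => // Aix; rewrite mem_set//.
  by case: (UA i) => _ AU _; exact: AU.
rewrite lee_fin; apply: (@le_trans _ _ (\sum_i (po P (A i) + c / N))).
  by apply: ler_sum => i _; case: (UA i) => _ _ /ltW.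
rewrite big_split/= lerD2l sumr_const -[X in _ *+ X]/#|I| -mulr_natr -/N.
by rewrite divfK// gt_eqF.
Qed.

End po_theory.

(** * Multiplicities of a resampling *)

Section geometric.
Context (R : realType).

(** An exact telescoping identity: multiplied by 1 - r, the partial sum misses r^J by r^(max n J),
    which also covers n < J. *)
Lemma geometric_tail_le (r : R) J n : 0 <= r < 1 ->
  \sum_(j < n | (J <= j)%N) r ^+ j <= r ^+ J / (1 - r).
Proof.
move=> /andP[r0 r1]; have r1' : 0 < 1 - r by rewrite subr_gt0.
rewrite ler_pdivlMr//.
suff : (\sum_(j < n | (J <= j)%N) r ^+ j) * (1 - r) + r ^+ maxn n J = r ^+ J.
  by move=> <-; rewrite lerDl exprn_ge0.
elim: n => [|n ih]; first by rewrite big_ord0 mul0r add0r max0n.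
rewrite big_mkcond big_ord_recr/= -big_mkcond/=.
case: leqP => Jn; move: ih.
  rewrite (maxn_idPl Jn) (maxn_idPl (leqW Jn)) => <-; rewrite exprS; ring.
by rewrite (maxn_idPr (ltnW Jn)) (maxn_idPr Jn) addr0.
Qed.

Lemma expr_eventually_le (r e : R) : 0 <= r < 1 -> 0 < e -> exists J, r ^+ J <= e.
Proof.
move=> /andP[r0 r1] e0.
have := @cvg_expr _ r; rewrite ger0_norm// => /(_ r1)/cvgrPdist_le/(_ _ e0)[J _ h].
exists J; have := h J (leqnn J); rewrite /= sub0r normrN ger0_norm//.
exact: exprn_ge0.
Qed.

End geometric.

Section multiplicity.
Context (R : realType) (n : nat).
Implicit Types (i : {ffun 'I_n -> 'I_n}).

Definition mult i (k : 'I_n) := #|[set l | i l == k]%SET|.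

Definition level i j : {set 'I_n} := [set k | (j < mult i k)%N]%SET.

Lemma mult_le i k : (mult i k <= n)%N.
Proof. by rewrite -[X in (_ <= X)%N]card_ord max_card. Qed.

(** A point drawn m times lies in exactly the levels 0, ..., m - 1. *)
Lemma sum_resample (V : nmodType) i (y : 'I_n -> V) :
  \sum_l y (i l) = \sum_(j < n) \sum_(k in level i j) y k.
Proof.
rewrite (partition_big i predT)//=.
under [RHS]eq_bigr do rewrite big_mkcond.
rewrite exchange_big/=; apply: eq_bigr => k _.
rewrite (eq_bigr (fun=> y k)); last by move=> l /eqP ->.
rewrite sumr_const -big_mkcond/=.
rewrite (eq_bigl (fun j : 'I_n => (j < mult i k)%N)); last by move=> j; rewrite inE.
rewrite sumr_const; congr (_ *+ _).
transitivity (mult i k).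
  by rewrite /mult -sum1dep_card -sum1_card; apply: eq_bigl => l.
rewrite -sum1_card -(big_ord_widen n (fun=> 1%N) (mult_le i k)).
by rewrite sum_nat_const card_ord muln1.
Qed.

(* Exponential Markov: 64 ^ (mult i k) has mean (1 + 63 / n) ^ n. *)
Lemma card_level_sum_le j :
  \sum_i (#|level i j|%:R : R) <= n%:R * n%:R ^+ n * expR 63 / 64 ^+ j.
Proof.
have [n0|n0] := posnP n.
  rewrite big1 => [|i _]; first by rewrite {1}n0 !mul0r.
  by apply/eqP; rewrite pnatr_eq0 -leqn0 -[X in (_ <= X)%N]n0 -[X in (_ <= X)%N]card_ord max_card.
have n0R : 0 < n%:R :> R by rewrite ltr0n.
have h k : \sum_(i : {ffun 'I_n -> 'I_n} | k \in level i j) (64 ^+ j : R) <=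
    n%:R ^+ n * expR 63.
  apply: (@le_trans _ _ (\sum_(i : {ffun 'I_n -> 'I_n}) \prod_l (64 ^+ (i l == k) : R))).
    rewrite big_mkcond; apply: ler_sum => i _.
    rewrite prodrXr; case: ifP => [|_]; last by rewrite exprn_ge0.
    rewrite inE => jk; apply: ler_weXn2l; first by rewrite ler1n.
    apply: leq_trans (ltnW jk) _; rewrite /mult -sum1dep_card big_mkcond.
    by apply: leq_sum => l _; case: eqP.
  rewrite -(bigA_distr_bigA (fun l m => 64 ^+ (m == k) : R))/=.
  rewrite prodr_const card_ord.
  rewrite (bigD1 k)//= eqxx expr1 (eq_bigr (fun=> 1)); last first.
    by move=> m /negPf ->.
  rewrite sumr_const cardC1 card_ord.
  rewrite (_ : 64 + n.-1%:R = n%:R * (1 + 63 / n%:R)); last first.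
    by rewrite mulrDr mulr1 mulrCA mulfV ?gt_eqF// mulr1 -{2}(prednK n0) -natr1; ring.
  rewrite exprMn ler_pM2l ?exprn_gt0//.
  apply: (@le_trans _ _ (expR (63 / n%:R) ^+ n)).
    rewrite lerXn2r// ?nnegrE ?expR_ge0 ?expR_ge1Dx// addr_ge0// divr_ge0//.
  by rewrite -expRM_natl mulrC divfK ?gt_eqF.
rewrite (eq_bigr (fun i => \sum_(k | k \in level i j) 1)); last first.
  by move=> i _; rewrite sumr_const.
rewrite (exchange_big_dep predT)//=.
rewrite ler_pdivlMr ?exprn_gt0// mulr_suml.
apply: (@le_trans _ _ (\sum_(k < n) n%:R ^+ n * expR 63)).
  apply: ler_sum => k _; apply: le_trans (h k); rewrite mulr_suml.
  by under eq_bigr do rewrite mul1r.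
by rewrite sumr_const card_ord -[X in X <= _]mulr_natl mulrA.
Qed.

(** Expand the square. Written as a product over the coordinates of the index function, an
    off-diagonal term factorises and contains the factor [\sum_k v k], which is 0. Each of the n
    diagonal terms leaves n - 1 coordinates free. *)
Lemma sum_centered_resample_sq (v : 'I_n -> R) : \sum_k v k = 0 ->
  \sum_(i : {ffun 'I_n -> 'I_n}) (\sum_l v (i l)) ^+ 2 = (n%:R ^+ n.-1 * \sum_k v k ^+ 2) *+ n.
Proof.
move=> v0.
transitivity (\sum_(l < n) \sum_(m < n) \sum_(i : {ffun 'I_n -> 'I_n}) v (i l) * v (i m)).
  under eq_bigr do rewrite expr2 big_distrlr/=.
  by rewrite exchange_big/=; apply: eq_bigr => l _; rewrite exchange_big.
rewrite (eq_bigr (fun=> n%:R ^+ n.-1 * \sum_k v k ^+ 2)); last first.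
  move=> l _; rewrite (bigD1 l)//= [X in _ + X]big1 ?addr0; last first.
    move=> m ml.
    rewrite (eq_bigr (fun i : {ffun 'I_n -> 'I_n} => \prod_(a < n)
      (if a == l then v (i a) else if a == m then v (i a) else 1))); last first.
      move=> i _; rewrite (bigD1 l)//= eqxx (bigD1 m)//= (negPf ml) eqxx big1 ?mulr1//.
      by move=> a /andP[/negPf -> /negPf ->].
    rewrite -(bigA_distr_bigA (fun a b => if a == l then v b else if a == m then v b else 1))/=.
    by rewrite (bigD1 l)//= eqxx v0 mul0r.
  rewrite (eq_bigr (fun i : {ffun 'I_n -> 'I_n} => \prod_(a < n)
      (if a == l then v (i a) ^+ 2 else 1))); last first.
    move=> i _; rewrite (bigD1 l)//= eqxx big1 ?mulr1//.
    by move=> a /negPf ->.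
  rewrite -(bigA_distr_bigA (fun a b => if a == l then v b ^+ 2 else 1))/=.
  rewrite (bigD1 l)//= eqxx [X in _ * X](eq_bigr (fun=> n%:R)); last first.
    by move=> a /negPf ->; rewrite sumr_const card_ord.
  by rewrite prodr_const cardC1 card_ord mulrC.
by rewrite sumr_const card_ord.
Qed.

End multiplicity.

(** * Tail bound and equicontinuity, for the sample and for the bootstrap *)

Section empirical_class.
Context d (T : measurableType d) (R : realType) (P : probability T R).
Variables (mu : (T -> R) -> R) (rho : (T -> R) -> (T -> R) -> \bar R).
Implicit Types (F : set (T -> R)) (f g : T -> R).

(** Left unnormalised so that it is additive under concatenation of samples. The functional [mu] and
    the gauge [rho] are arbitrary here and become [mean] and [L2dist2] later. *)
Definition csum m (x : m.-tuple T) f : R := \sum_(k < m) (f (tnth x k) - mu f).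

Definition bigdev F m (t : R) : set (m.-tuple T) :=
  [set x | exists2 f, F f & t < `|csum x f|].

Definition bigosc F (eta : R) m (t : R) : set (m.-tuple T) :=
  [set x | exists f g, [/\ F f, F g, (rho f g < eta%:E)%E & t < `|csum x f - csum x g|]].

Definition asymp_tight F := forall e, 0 < e ->
  exists t N, forall n, (N <= n)%N -> po P (bigdev F (m:=n) (t * Num.sqrt n%:R)) <= e.

Definition asymp_equicont F := forall delta e, 0 < delta -> 0 < e ->
  exists eta N, 0 < eta /\
    forall n, (N <= n)%N -> po P (bigosc F eta (m:=n) (delta * Num.sqrt n%:R)) <= e.

Lemma csum_catt m n (a : m.-tuple T) (b : n.-tuple T) f :
  csum (catt (a, b)) f = csum a f + csum b f.
Proof.
rewrite /csum big_split_ord/=; congr (_ + _); apply: eq_bigr => i _.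
  by rewrite tnth_cattl.
by rewrite tnth_cattr.
Qed.

Lemma le_bigdev F m (s t : R) : s <= t -> bigdev F (m:=m) t `<=` bigdev F s.
Proof. by move=> st x [f Ff tf]; exists f => //; exact: le_lt_trans tf. Qed.

Lemma bigosc_bigdev F eta m (t : R) : bigosc F eta (m:=m) (2 * t) `<=` bigdev F t.
Proof.
move=> x [f [g [Ff Fg _ h]]].
have [tf|ft] := ltP t `|csum x f|; first by exists f.
by exists g => //; have := ler_normB (csum x f) (csum x g); lra.
Qed.

Lemma le_bigosc F eta m (s t : R) : s <= t ->
  bigosc F eta (m:=m) t `<=` bigosc F eta s.
Proof.
by move=> st x [f [g [Ff Fg r tf]]]; exists f, g; split=> //; exact: le_lt_trans tf.
Qed.

Section tail.
Variable F : set (T -> R).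
Hypothesis tightF : asymp_tight F.

(** Tightness is given only for large samples. A small sample is extended by N independent points:
    if its sum is large while that of the new points is moderate, the sum over the extended sample
    is large, and this sample has at least N points. *)
Lemma uniformly_tight : exists2 t, 0 < t &
  forall m, po P (bigdev F (m:=m) (t * Num.sqrt m%:R)) <= 4^-1.
Proof.
have [|t [N tN]] := tightF (e := 8^-1); first by rewrite invr_gt0.
pose s := Num.max t 1; have s0 : 0 < s by rewrite lt_max ltr01 orbT.
have {}tN n : (N <= n)%N -> po P (bigdev F (m:=n) (s * Num.sqrt n%:R)) <= 8^-1.
  move=> /tN; apply: le_trans; apply: le_po; apply: le_bigdev.
  by rewrite ler_wpM2r// ?sqrtr_ge0// le_max lexx.
have sN : s <= s * (1 + 2 * Num.sqrt (2 * N)%:R).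
  by apply: ler_peMr; [exact: ltW|rewrite lerDl mulr_ge0// sqrtr_ge0].
(* For 1 <= m < N the square roots of m + N and of N are both at most that of 2 N, while that of m
   is at least 1. The summand 1 serves the sizes m >= N. *)
exists (s * (1 + 2 * Num.sqrt (2 * N)%:R)); first exact: lt_le_trans sN.
move=> m; have [Nm|mN] := leqP N m.
  apply: le_trans (le_po _ _) (le_trans (tN _ Nm) _); last by lra.
  by apply: le_bigdev; rewrite ler_wpM2r ?sqrtr_ge0.
have [->|m0] := posnP m.
  rewrite (_ : bigdev _ _ = set0) ?po0 ?invr_ge0//; apply/seteqP; split => // x [f _].
  by rewrite sqrtr0 mulr0 /csum big_ord0 normr0 ltxx.
set a := s * Num.sqrt (m + N)%:R; set b := s * Num.sqrt N%:R.
have h : po P (bigdev F (m:=m) (a + b)) * (1 - po P (bigdev F (m:=N) b)) <=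
    po P (bigdev F (m:=m + N) a).
  apply: po_cat => x y [f Ff abf] nb; exists f => //; rewrite csum_catt.
  have fb : `|csum y f| <= b by rewrite leNgt; apply/negP => ?; apply: nb; exists f.
  have := lerB_normD (csum x f) (csum y f); lra.
have h1 := tN _ (leqnn N); have h2 := tN _ (leq_addl m N).
have : po P (bigdev F (m:=m) (a + b)) <= 4^-1.
  have := po_ge0 P (bigdev F (m:=m) (a + b)); rewrite -/a -/b in h1 h2; nra.
apply: le_trans; apply: le_po; apply: le_bigdev.
rewrite /a /b -mulrDr -mulrA ler_pM2l//.
have m1 : 1 <= Num.sqrt m%:R :> R by rewrite -[leLHS]sqrtr1 ler_wsqrtr// ler1n.
have h3 : Num.sqrt (m + N)%:R <= Num.sqrt (2 * N)%:R :> R.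
  by rewrite ler_wsqrtr// ler_nat mul2n -addnn leq_add2r ltnW.
have h4 : Num.sqrt N%:R <= Num.sqrt (2 * N)%:R :> R.
  by rewrite ler_wsqrtr// ler_nat leq_pmull.
have := sqrtr_ge0 (N%:R : R); nra.
Qed.

(* Doubling the sample size: if one of two independent halves deviates by much
   more than the typical size while the other does not, so does the whole, and
   this can happen in two ways.  Hence the tail at sqrt 2 times the threshold
   loses a factor 2 * (3 / 4). *)
Lemma tail_bound : exists2 t, 0 < t & forall k m,
  po P (bigdev F (m:=m) (t * (3 / 2) ^+ k * Num.sqrt m%:R)) <= (2 / 3) ^+ k.
Proof.
have [t t0 ht] := uniformly_tight.
(* Passing from size m + m to size m needs 12 sqrt 2 + 1 <= 12 (3/2) = 18, where sqrt 2 <= 17/12 and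
   the 1 is the allowance for the quiet half. *)
exists (12 * t); first by rewrite mulr_gt0.
elim=> [|k ih] m; first by rewrite expr0 po_le1.
set a := 12 * t * (3 / 2) ^+ k * Num.sqrt (m + m)%:R.
set b := t * Num.sqrt m%:R.
have a0 : 0 <= a by rewrite !mulr_ge0 ?sqrtr_ge0 ?exprn_ge0// ltW.
have b0 : 0 <= b by rewrite !mulr_ge0 ?sqrtr_ge0// ltW.
have h : 2 * po P (bigdev F (m:=m) (a + b)) * (1 - po P (bigdev F (m:=m) b)) <=
    po P (bigdev F (m:=m + m) a).
  apply: po_double; first by apply: le_bigdev; rewrite lerDr.
  move=> x y [f Ff abf] nb.
  have fb : `|csum y f| <= b by rewrite leNgt; apply/negP => ?; apply: nb; exists f.
  by split; exists f => //; rewrite csum_catt;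
    have := lerB_normD (csum x f) (csum y f); rewrite 1?[csum y f + _]addrC; lra.
have h1 := ht m; have h2 := ih (m + m)%N; rewrite -/a -/b in h1 h2.
have h3 : po P (bigdev F (m:=m) (a + b)) <= (2 / 3) ^+ k.+1.
  rewrite exprS; have := po_ge0 P (bigdev F (m:=m) (a + b)); nra.
apply: le_trans h3; apply: le_po; apply: le_bigdev.
rewrite /a /b.
have -> : Num.sqrt (m + m)%:R = Num.sqrt 2 * Num.sqrt m%:R :> R.
  by rewrite -sqrtrM// -natrM mul2n addnn.
have s2 : Num.sqrt 2 <= 17 / 12 :> R.
  by rewrite -(@ler_pXn2r _ 2)// ?nnegrE ?sqrtr_ge0// ?sqr_sqrtr//; lra.
have k1 : 1 <= (3 / 2) ^+ k :> R by apply: exprn_ege1; lra.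
rewrite mulrA -mulrDl; apply: ler_wpM2r; first exact: sqrtr_ge0.
rewrite exprS.
have : 12 * t * (3 / 2) ^+ k * Num.sqrt 2 <= 12 * t * (3 / 2) ^+ k * (17 / 12).
  by apply: ler_wpM2l => //; rewrite !mulr_ge0 ?exprn_ge0// ltW.
nra.
Qed.

Hypothesis equiF : asymp_equicont F.

(** For m >= N this is equicontinuity at size m with a larger threshold. For m < N the oscillation
    is at most twice a deviation, which the tail bound keeps below the constant [c] outside a small
    event; [delta * Num.sqrt n%:R] exceeds [c] once n is large. *)
Lemma bigosc_le_size delta e : 0 < delta -> 0 < e -> exists eta N, 0 < eta /\
  forall n m, (N <= n)%N -> (m <= n)%N ->
    po P (bigosc F eta (m:=m) (delta * Num.sqrt n%:R)) <= e.
Proof.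
move=> delta0 e0; have [eta [N [eta0 hN]]] := equiF delta0 e0.
have [t t0 ht] := tail_bound.
have [k hk] := @expr_eventually_le R (2 / 3) e ltac:(lra) e0.
pose c := 2 * (t * (3 / 2) ^+ k * Num.sqrt N%:R).
have [M hM] : exists M : nat, (c / delta) ^+ 2 <= M%:R.
  by exists (Num.truncn ((c / delta) ^+ 2)).+1; rewrite ltW// truncnS_gt.
have c0 : 0 <= c by rewrite !mulr_ge0 ?sqrtr_ge0 ?exprn_ge0// ltW.
exists eta, M; split => // n m Mn mn.
have [Nm|mN] := leqP N m.
  apply: le_trans (hN _ Nm); apply: le_po; apply: le_bigosc.
  by rewrite ler_pM2l// ler_wsqrtr// ler_nat.
apply: le_trans hk; apply: le_trans (ht k m); apply: le_po.
apply: subset_trans (@bigosc_bigdev _ eta _ _); apply: le_bigosc.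
apply: (@le_trans _ _ c).
  rewrite /c ler_pM2l// ler_wpM2l//; first by rewrite mulr_ge0 ?exprn_ge0// ltW.
  by rewrite ler_wsqrtr// ler_nat ltnW.
rewrite mulrC -ler_pdivrMr// -[leLHS]ger0_norm; last by rewrite divr_ge0// ltW.
by rewrite -sqrtr_sqr ler_wsqrtr// (le_trans hM)// ler_nat.
Qed.

End tail.
End empirical_class.

Lemma sum_ord_lt_const (R : realType) (c : R) J n : 0 <= c ->
  \sum_(j < n | (j < J)%N) c <= J%:R * c.
Proof.
move=> c0; suff -> : \sum_(j < n | (j < J)%N) c = (minn n J)%:R * c.
  by rewrite ler_wpM2r// ler_nat geq_minr.
elim: n => [|n ih]; first by rewrite big_ord0 min0n mul0r.
rewrite big_mkcond big_ord_recr/= -big_mkcond/= ih.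
case: ltnP => Jn; last by rewrite (minn_idPr (leqW Jn)) addr0.
by rewrite (minn_idPl Jn) -natr1 mulrDl mul1r.
Qed.

Section bootstrap_class.
Context d (T : measurableType d) (R : realType) (P : probability T R).
Variables (mu : (T -> R) -> R) (rho : (T -> R) -> (T -> R) -> \bar R).
Implicit Types (F : set (T -> R)) (f g : T -> R).

(** This is n times the difference of the bootstrap and the empirical measure at [f]. *)
Definition resample_diff n (x : n.-tuple T) (i : {ffun 'I_n -> 'I_n}) f : R :=
  \sum_l f (tnth x (i l)) - \sum_k f (tnth x k).

Definition bootosc F (eta : R) n (i : {ffun 'I_n -> 'I_n}) (t : R) : set (n.-tuple T) :=
  [set x | exists f g, [/\ F f, F g, (rho f g < eta%:E)%E &
    t < `|resample_diff x i f - resample_diff x i g|]].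

(** As [enum_val] is injective, for fixed [i] this is again an independent sample, of size
    [#|level i j|]. *)
Definition level_proj n (i : {ffun 'I_n -> 'I_n}) j (x : n.-tuple T) :=
  subt (fun k : 'I_#|level i j| => enum_val k) x.

(** Both sums have n terms, so the centering at [mu f] cancels between them. *)
Lemma resample_diff_csum n (x : n.-tuple T) i f :
  resample_diff x i f = \sum_(j < n) csum mu (level_proj i j x) f - csum mu x f.
Proof.
transitivity (\sum_l (f (tnth x (i l)) - mu f) - csum mu x f).
  by rewrite /resample_diff /csum !sumrB; ring.
rewrite (sum_resample i (fun k => f (tnth x k) - mu f)); congr (_ - _).
apply: eq_bigr => j _; rewrite big_enum_val /csum; apply: eq_bigr => k _.
by rewrite tnth_subt.
Qed.

(* The levels j < J are controlled by equicontinuity, the remaining ones,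
   whose sizes decrease geometrically, by the tail bound. *)
Lemma po_bootosc_le F eta n (i : {ffun 'I_n -> 'I_n}) J t delta0 e0 :
  (0 < n)%N -> 0 <= t -> 0 <= e0 ->
  (forall m, (m <= n)%N ->
    po P (bigosc mu rho F eta (m:=m) (delta0 * Num.sqrt n%:R)) <= e0) ->
  (forall k m, po P (bigdev mu F (m:=m) (t * (3 / 2) ^+ k * Num.sqrt m%:R)) <= (2 / 3) ^+ k) ->
  (forall j, (J <= j < n)%N -> 16 ^+ j * #|level i j|%:R <= n%:R :> R) ->
  po P (bootosc F eta i ((J.+1%:R * delta0 + 6 * t * (2 / 3) ^+ J) * Num.sqrt n%:R)) <=
    J.+1%:R * e0 + 3 * (2 / 3) ^+ J.
Proof.
move=> n0 t0 e00 hosc hdev hlev; set s := Num.sqrt n%:R.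
have s0 : 0 < s by rewrite sqrtr_gt0 ltr0n.
pose A (j : 'I_n) : set (n.-tuple T) := if (j < J)%N
  then level_proj i j @^-1` bigosc mu rho F eta (delta0 * s)
  else level_proj i j @^-1` bigdev mu F (t * (3 / 2) ^+ j * Num.sqrt #|level i j|%:R).
have poA j : po P (A j) <= if (j < J)%N then e0 else (2 / 3) ^+ j.
  rewrite /A; case: ifP => _; apply: (le_trans (po_subt _ _ enum_val_inj)).
    by apply: hosc; rewrite -[X in (_ <= X)%N]card_ord max_card.
  exact: hdev.
have geo : \sum_(j < n | (J <= j)%N) (2 / 3) ^+ j <= 3 * (2 / 3) ^+ J :> R.
  apply: le_trans (@geometric_tail_le R (2 / 3) J n ltac:(lra)) _.
  by rewrite le_eqVlt; apply/orP; left; apply/eqP; field.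
(* The original sample is subtracted and adds one oscillation event to those of the [J] low levels,
   hence [J.+1] in the threshold and in the bound. The 6 is 2 for the two functions times 3 from the
   geometric series. *)
apply: (@le_trans _ _ (po P (bigosc mu rho F eta (delta0 * s) `|` [set x | exists j, A j x]))).
  apply: le_po => x [f [g [Ff Fg fg hx]]].
  apply: contrapT => /not_orP[nosc nA].
  have h0 : `|csum mu x f - csum mu x g| <= delta0 * s.
    by rewrite leNgt; apply/negP => ?; apply: nosc; exists f, g.
  have hj (j : 'I_n) : `|csum mu (level_proj i j x) f - csum mu (level_proj i j x) g| <=
      if (j < J)%N then delta0 * s else 2 * t * (2 / 3) ^+ j * s.
    have nAj : ~ A j x by move=> ?; apply: nA; exists j.
    move: nAj; rewrite /A; case: ltnP => jJ nAj.
      by rewrite leNgt; apply/negP => ?; apply: nAj; exists f, g.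
    have h f' : F f' -> `|csum mu (level_proj i j x) f'| <= t * (2 / 3) ^+ j * s.
      move=> Ff'.
      have : `|csum mu (level_proj i j x) f'| <= t * (3 / 2) ^+ j * Num.sqrt #|level i j|%:R.
        by rewrite leNgt; apply/negP => ?; apply: nAj; exists f'.
      move=> /le_trans; apply; rewrite -!mulrA ler_wpM2l//.
      have l16 : 4 ^+ j * Num.sqrt #|level i j|%:R <= s.
        rewrite -[4 ^+ j]ger0_norm ?exprn_ge0// -sqrtr_sqr -sqrtrM ?sqr_ge0// ler_wsqrtr//.
        by rewrite -exprM mulnC exprM (_ : 4 ^+ 2 = 16) ?hlev ?jJ ?ltn_ord//; ring.
      have -> : 3 / 2 = 3 / 8 * 4 :> R by field.
      rewrite exprMn -mulrA; apply: ler_pM => //.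
      by rewrite lerXn2r// ?nnegrE; lra.
    have := h f Ff; have := h g Fg; have := ler_normB (csum mu (level_proj i j x) f) (csum mu (level_proj i j x) g).
    lra.
  have : `|resample_diff x i f - resample_diff x i g| <=
      \sum_(j < n) (if (j < J)%N then delta0 * s else 2 * t * (2 / 3) ^+ j * s) + delta0 * s.
    have -> : resample_diff x i f - resample_diff x i g =
        \sum_(j < n) (csum mu (level_proj i j x) f - csum mu (level_proj i j x) g) -
        (csum mu x f - csum mu x g) by rewrite !resample_diff_csum sumrB; ring.
    apply: le_trans (ler_normB _ _) _; apply: lerD => //.
    by apply: le_trans (ler_norm_sum _ _ _) _; apply: ler_sum => j _.
  rewrite (bigID (fun j : 'I_n => (j < J)%N))/=.
  rewrite (eq_bigr (fun=> delta0 * s)) => [|j ->//].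
  rewrite [X in _ <= _ + X + _](eq_bigr (fun j : 'I_n => (2 / 3) ^+ j * (2 * t * s))); last first.
    by move=> j /negPf ->; ring.
  rewrite -[X in _ <= _ + X + _]mulr_suml.
  rewrite [X in _ <= _ + X * _ + _](eq_bigl (fun j : 'I_n => (J <= j)%N)) => [|j]; last by rewrite -leqNgt.
  have d0 : 0 <= delta0 * s by apply: le_trans h0.
  have := @sum_ord_lt_const R _ J n d0.
  have ts : 0 <= 2 * t * s by rewrite !mulr_ge0// ltW.
  have := ler_wpM2r ts geo.
  move: hx; rewrite -natr1 -/s; lra.
apply: le_trans (poU _ _ _) _.
have -> : J.+1%:R * e0 = e0 + J%:R * e0 by rewrite -natr1; ring.
rewrite -addrA; apply: lerD; first exact: hosc.
apply: le_trans (po_bigcup_ord _ _) _.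
apply: (@le_trans _ _ (\sum_(j < n) if (j < J)%N then e0 else (2 / 3) ^+ j)).
  by apply: ler_sum => j _.
rewrite (bigID (fun j : 'I_n => (j < J)%N))/=; apply: lerD.
  by rewrite (eq_bigr (fun=> e0)) => [|j ->//]; exact: sum_ord_lt_const.
rewrite (eq_bigr (fun j : 'I_n => (2 / 3) ^+ j)) => [|j /negPf ->//].
by rewrite (eq_bigl (fun j : 'I_n => (J <= j)%N)) => [|j]; rewrite -?leqNgt.
Qed.

(** Union bound over the levels j >= J, with Markov's inequality in the index function at each: the
    indicator of an oversized level is at most 16^j / n times its size, and 16/64 is below 2/3. *)
Lemma large_level_count_le n J : (0 < n)%N ->
  \sum_(i : {ffun 'I_n -> 'I_n})
    (~~ [forall j : 'I_n, (J <= j)%N ==> (16 ^+ j * #|level i j|%:R <= n%:R :> R)] : nat)%:R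
  <= 3 * expR 63 * (2 / 3) ^+ J * n%:R ^+ n :> R.
Proof.
move=> n0; have nR : 0 < n%:R :> R by rewrite ltr0n.
apply: (@le_trans _ _ (\sum_(i : {ffun 'I_n -> 'I_n}) \sum_(j < n | (J <= j)%N)
    16 ^+ j / n%:R * #|level i j|%:R)).
  apply: ler_sum => i _; case: forallP => /= [_|].
    by apply: sumr_ge0 => j _; rewrite mulr_ge0// divr_ge0// exprn_ge0.
  move=> /forallP; rewrite negb_forall => /existsP[j]; rewrite negb_imply => /andP[Jj].
  rewrite -ltNge => h; rewrite (bigD1 j)//=.
  apply: (@le_trans _ _ (16 ^+ j / n%:R * #|level i j|%:R)).
    by rewrite mulrAC ler_pdivlMr// mul1r ltW.
  by rewrite lerDl; apply: sumr_ge0 => l _; rewrite mulr_ge0// divr_ge0// exprn_ge0.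
rewrite exchange_big/=.
apply: (@le_trans _ _ (\sum_(j < n | (J <= j)%N) (2 / 3) ^+ j * (expR 63 * n%:R ^+ n))).
  apply: ler_sum => j _; rewrite -mulr_sumr.
  apply: (@le_trans _ _ (16 ^+ j / n%:R * (n%:R * n%:R ^+ n * expR 63 / 64 ^+ j))).
    by rewrite ler_wpM2l ?divr_ge0 ?exprn_ge0//; exact: card_level_sum_le.
  rewrite (_ : _ / _ * _ = (16 / 64) ^+ j * (expR 63 * n%:R ^+ n)); last first.
    rewrite expr_div_n; field.
    by rewrite (gt_eqF nR) andbT; apply: expf_neq0; rewrite pnatr_eq0.
  apply: ler_wpM2r; first by rewrite mulr_ge0 ?expR_ge0// exprn_ge0.
  by rewrite lerXn2r// ?nnegrE; lra.
rewrite -mulr_suml; apply: le_trans (ler_wpM2r _ (@geometric_tail_le R (2 / 3) J n ltac:(lra))) _.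
  by rewrite mulr_ge0 ?expR_ge0// exprn_ge0.
by rewrite le_eqVlt; apply/orP; left; apply/eqP; field.
Qed.

(** The index function is fixed before the data are drawn, and the outer probabilities over the data
    are then averaged over the n^n index functions. Those with an oversized high level are charged
    the trivial bound 1. *)
Lemma bootstrap_equicont F : asymp_tight P mu F -> asymp_equicont P mu rho F ->
  forall delta e, 0 < delta -> 0 < e -> exists eta N, 0 < eta /\
  forall n, (N <= n)%N ->
    \sum_(i : {ffun 'I_n -> 'I_n}) po P (bootosc F eta i (delta * Num.sqrt n%:R))
      <= e * n%:R ^+ n.
Proof.
move=> tF eF delta e d0 e0.
have [t t0 ht] := tail_bound tF.
have E0 : 0 < expR 63 :> R by exact: expR_gt0.
(* The two bounds give 6 t (2/3)^J <= delta / 2 for the threshold and 3 (2/3)^J (1 + e^63) <= e / 2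
   for the probability; there the 1 pays for the tails of the high levels and e^63 for the bad index
   functions. *)
have [J hJ] := @expr_eventually_le R (2 / 3)
  (Num.min (delta / (12 * t)) (e / (6 * (1 + expR 63)))) ltac:(lra)
  ltac:(by rewrite lt_min !divr_gt0// mulr_gt0// addr_gt0).
move: hJ; rewrite le_min ler_pdivlMr ?mulr_gt0// ler_pdivlMr ?mulr_gt0 ?addr_gt0// => /andP[hJ1 hJ2].
have J0 : 0 < J.+1%:R :> R by rewrite ltr0n.
have [eta [N [eta0 hN]]] := bigosc_le_size tF eF
  (delta := delta / (2 * J.+1%:R)) (e := e / (2 * J.+1%:R))
  ltac:(by rewrite divr_gt0// mulr_gt0) ltac:(by rewrite divr_gt0// mulr_gt0).
exists eta, (maxn N 1); split => // n; rewrite geq_max => /andP[Nn n0].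
pose good (i : {ffun 'I_n -> 'I_n}) := [forall j : 'I_n, (J <= j)%N ==> (16 ^+ j * #|level i j|%:R <= n%:R :> R)].
apply: (@le_trans _ _ (\sum_(i : {ffun 'I_n -> 'I_n}) (e / 2 + 3 * (2 / 3) ^+ J + (~~ good i : nat)%:R))).
  apply: ler_sum => i _; case: (boolP (good i)) => [/forallP gi|_]; last first.
    apply: (@le_trans _ _ 1); first exact: po_le1.
    have : 0 <= (2 / 3) ^+ J :> R by apply: exprn_ge0; lra.
    rewrite /= ; lra.
  have q0 : 0 <= e / (2 * J.+1%:R) by apply: ltW; rewrite divr_gt0// mulr_gt0.
  rewrite /= addr0.
  have hosc m : (m <= n)%N -> po P (bigosc mu rho F eta (m:=m)
    (delta / (2 * J.+1%:R) * Num.sqrt n%:R)) <= e / (2 * J.+1%:R) by exact: hN.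
  have hlev j : (J <= j < n)%N -> 16 ^+ j * #|level i j|%:R <= n%:R :> R.
    by move=> /andP[Jj jn]; have := gi (Ordinal jn); rewrite /= Jj.
  have := po_bootosc_le n0 (ltW t0) q0 hosc ht hlev.
  have -> : J.+1%:R * (e / (2 * J.+1%:R)) = e / 2 by field; rewrite gt_eqF.
  have -> : J.+1%:R * (delta / (2 * J.+1%:R)) = delta / 2 by field; rewrite gt_eqF.
  apply: le_trans; apply: le_po => x [f [g [Ff Fg fg hx]]]; exists f, g; split => //.
  apply: le_lt_trans hx; apply: ler_wpM2r; [exact: sqrtr_ge0|lra].
rewrite big_split/=; apply: le_trans (lerD (lexx _) (large_level_count_le J n0)) _.
rewrite sumr_const card_ffun card_ord -[X in X + _]mulr_natr natrX -mulrDl.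
by rewrite ler_wpM2r ?exprn_ge0//; lra.
Qed.

End bootstrap_class.

(** * Second moments and empirical integrals *)

Section change_of_measure.
Context d1 d2 (X : measurableType d1) (Y : measurableType d2) (R : realType).
Variables (phi : X -> Y) (mphi : measurable_fun setT phi).
Variables (m : {measure set X -> \bar R}) (nu : {measure set Y -> \bar R}).
Hypothesis mnu : forall A, measurable A -> m (phi @^-1` A) = nu A.
Local Open Scope ereal_scope.

Lemma ge0_integral_map (f : Y -> \bar R) :
  measurable_fun setT f -> (forall y, 0 <= f y) ->
  \int[m]_x f (phi x) = \int[nu]_y f y.
Proof.
move=> mf f0.
have h := @ge0_integral_pushforward _ _ X Y R phi mphi m setT f measurableT mf
  (fun y _ => f0 y).
rewrite preimage_setT in h; rewrite -[LHS]h.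
by apply: eq_measure_integral => A mA _; exact: mnu.
Qed.

Lemma integrable_map (f : Y -> \bar R) : nu.-integrable setT f ->
  m.-integrable setT (f \o phi).
Proof.
move=> /integrableP[mf ioo]; apply/integrableP; split; first exact: measurableT_comp.
rewrite (ge0_integral_map (f := fun y => `|f y|))//; exact: measurableT_comp.
Qed.

Lemma integral_map (f : Y -> \bar R) : nu.-integrable setT f ->
  \int[m]_x f (phi x) = \int[nu]_y f y.
Proof.
move=> fi; have mf := measurable_int _ fi.
have h := @integral_pushforward _ _ X Y R phi mphi m setT f mf.
rewrite preimage_setT in h; rewrite -[LHS]h//; last exact: integrable_map.
by apply: eq_measure_integral => A mA _; exact: mnu.
Qed.

End change_of_measure.

Section moments.
Context d (T : measurableType d) (R : realType) (P : probability T R).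
Local Open Scope ereal_scope.

Lemma power_measure_tnth2 n (k l : 'I_n) (A B : set T) : k != l ->
  measurable A -> measurable B ->
  power_measure P n [set t | A (tnth t k) /\ B (tnth t l)] = P A * P B.
Proof.
move=> kl mA mB.
pose C i := if i == k then A else if i == l then B else setT.
transitivity (power_measure P n (box C)).
  congr (power_measure P n _); apply/seteqP; split => t /=.
    by move=> [At Bt] i; rewrite /C; case: eqP => [->//|_]; case: eqP => [->|].
  move=> h; split; first by have := h k; rewrite /C eqxx.
  by have := h l; rewrite /C eq_sym (negPf kl) eqxx.
rewrite power_measureE; last by move=> i; rewrite /C; case: eqP => // _; case: eqP.
rewrite (bigD1 k)//= (bigD1 l) 1?eq_sym//= {1 2}/C eqxx eq_sym (negPf kl) eqxx.
rewrite big1 ?mule1// => i /andP[/negPf ik /negPf il].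
by rewrite /C ik il; exact: (@probability_setT _ _ _ P).
Qed.

Lemma power_measure_tnth n (k : 'I_n) (A : set T) : measurable A ->
  power_measure P n [set t | A (tnth t k)] = P A.
Proof.
move=> mA; pose C i := if i == k then A else setT.
transitivity (power_measure P n (box C)).
  congr (power_measure P n _); apply/seteqP; split => t /=.
    by move=> At i; rewrite /C; case: eqP => [->//|_].
  by move=> h; have := h k; rewrite /C eqxx.
rewrite power_measureE; last by move=> i; rewrite /C; case: eqP => // _; case: eqP.
rewrite (bigD1 k)//= {1}/C eqxx big1 ?mule1// => i /negPf ik.
by rewrite /C ik; exact: (@probability_setT _ _ _ P).
Qed.

Lemma integrable_tnth n (k : 'I_n) (f : T -> \bar R) : P.-integrable setT f ->
  (power_measure P n).-integrable setT (fun x => f (tnth x k)).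
Proof.
move=> fi; apply: (integrable_map (@measurable_tnth _ T n k) _ fi) => A mA; exact: power_measure_tnth.
Qed.

Section centered.
Variable v : T -> R.
Hypotheses (vi : P.-integrable setT (EFin \o v)) (v0 : \int[P]_a (v a)%:E = 0)
  (v2 : P.-integrable setT (fun a => (v a ^+ 2)%:E)).

Let mv : measurable_fun setT v.
Proof. exact/measurable_EFinP/(measurable_int _ vi). Qed.

Let integrable_prod :
  (P \x P).-integrable setT (fun z : T * T => (v z.1 * v z.2)%:E).
Proof.
apply/integrable12ltyP.
  by apply/measurable_EFinP; apply: measurable_funM; exact: measurableT_comp.
pose c := \int[P]_a `|v a|%:E.
have c0 : 0 <= c by apply: integral_ge0.
have cfin : c \is a fin_num by rewrite ge0_fin_numE//; move/integrableP : vi => [_].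
have mav : measurable_fun setT (fun a => `|v a|%:E).
  by apply/measurable_EFinP; exact: measurableT_comp.
rewrite (eq_integral (fun a => `|v a|%:E * c)).
  by rewrite ge0_integralZr// -/c -(fineK cfin) -EFinM ltry.
move=> a _; rewrite /c -ge0_integralZl//.
by apply: eq_integral => b _; rewrite /= normrM.
Qed.

Let integral_prod : \int[P \x P]_z (v z.1 * v z.2)%:E = 0.
Proof.
rewrite -integral12_prod_meas1//; apply: integral0_eq => a _.
rewrite /fubini_F/=; under eq_integral do rewrite EFinM.
by rewrite integralZl// v0 mule0.
Qed.

Let mpair n (k l : 'I_n) :
  measurable_fun setT (fun x : n.-tuple T => (tnth x k, tnth x l)).
Proof. by apply/measurable_fun_pairP; split; exact: measurable_tnth. Qed.

Let pair_product n (k l : 'I_n) : k != l -> forall A, measurable A ->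
  power_measure P n ((fun x : n.-tuple T => (tnth x k, tnth x l)) @^-1` A) = (P \x P) A.
Proof.
move=> kl A mA.
have := @product_measure_unique _ _ T T R P P
  (pushforward (power_measure P n) (fun x : n.-tuple T => (tnth x k, tnth x l))).
move=> -> //; last by move=> B C mB mC; exact: power_measure_tnth2.
exact: mpair.
Qed.

Let integrable_cross n (k l : 'I_n) :
  (power_measure P n).-integrable setT (fun x => (v (tnth x k) * v (tnth x l))%:E).
Proof.
have [->|kl] := eqVneq k l; first exact: (integrable_tnth l v2).
exact: (integrable_map (@mpair n k l) (pair_product kl) integrable_prod).
Qed.

Let sqE n (x : n.-tuple T) : ((\sum_k v (tnth x k)) ^+ 2)%:E =
  \sum_k \sum_l (v (tnth x k) * v (tnth x l))%:E.
Proof.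
rewrite expr2 big_distrlr/= -sumEFin.
by apply: eq_bigr => k _; rewrite sumEFin.
Qed.

Lemma integrable_sum_sq n : (power_measure P n).-integrable setT
  (fun x => ((\sum_k v (tnth x k)) ^+ 2)%:E).
Proof.
under eq_fun do rewrite sqE.
by apply: integrable_sum => // k _; exact: integrable_sum.
Qed.

Lemma integral_sum_sq n :
  \int[power_measure P n]_x ((\sum_k v (tnth x k)) ^+ 2)%:E =
  n%:R%:E * \int[P]_a (v a ^+ 2)%:E.
Proof.
under eq_integral do rewrite sqE.
rewrite integral_sum//; last by move=> k; exact: integrable_sum.
rewrite (eq_bigr (fun=> \int[P]_a (v a ^+ 2)%:E)) => [|k _].
  rewrite -(fineK (integrable_fin_num measurableT v2)) sumEFin sumr_const card_ord.
  by rewrite -EFinM mulr_natl.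
rewrite integral_sum//.
rewrite (bigD1 k)//= big1 ?adde0 => [|l lk].
  apply: (integral_map (@measurable_tnth _ T n k) _ v2) => A mA.
  exact: power_measure_tnth.
transitivity (\int[P \x P]_z (v z.1 * v z.2)%:E) => //.
apply: (integral_map (@mpair n k l) _ integrable_prod).
by apply: pair_product; rewrite eq_sym.
Qed.

End centered.

Definition mean (f : T -> R) : R := (\int[P]_a f a)%R.

(** The squared L2(P) distance, with values in the extended reals because members of a Donsker class
    are only assumed integrable. *)
Definition L2dist2 (f g : T -> R) : \bar R := \int[P]_a ((f a - g a) ^+ 2)%:E.

(** Only the difference is square integrable. The two centered sums differ by the centered sum of
    [f - g], whose variance per point is at most the second moment of [f - g]. *)
Lemma csum_sq_moment n (f g : T -> R) :
  P.-integrable setT (EFin \o f) -> P.-integrable setT (EFin \o g) ->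
  L2dist2 f g < +oo ->
  (power_measure P n).-integrable setT (fun x => ((csum mean x f - csum mean x g) ^+ 2)%:E) /\
  \int[power_measure P n]_x ((csum mean x f - csum mean x g) ^+ 2)%:E <= n%:R%:E * L2dist2 f g.
Proof.
move=> fi gi fg.
have mf : measurable_fun setT f by exact/measurable_EFinP/(measurable_int _ fi).
have mg : measurable_fun setT g by exact/measurable_EFinP/(measurable_int _ gi).
pose y a := (f a - g a)%R; pose c := (mean f - mean g)%R; pose v a := (y a - c)%R.
have yi : P.-integrable setT (EFin \o y).
  by rewrite (_ : EFin \o y = (EFin \o f) \- (EFin \o g))//; exact: integrableB.
have y2 : P.-integrable setT (fun a => (y a ^+ 2)%:E).
  apply/integrableP; split.
    by apply/measurable_EFinP/measurable_funX/measurable_funB.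
  rewrite (eq_integral (fun a => (y a ^+ 2)%:E))// => a _.
  by rewrite gee0_abs// lee_fin sqr_ge0.
have ci : P.-integrable setT (fun=> c%:E) by exact: finite_measure_integrable_cst.
have P1 : P setT = 1 by exact: (@probability_setT _ _ _ P).
have yc : \int[P]_a (y a)%:E = c%:E.
  rewrite /c /mean EFinB /Rintegral !fineK; [|exact: integrable_fin_num..].
  by rewrite -integralB_EFin.
have vi : P.-integrable setT (EFin \o v).
  by rewrite (_ : EFin \o v = (EFin \o y) \- (cst c%:E))//; exact: integrableB.
have v0 : \int[P]_a (v a)%:E = 0.
  under eq_integral do rewrite EFinB.
  rewrite integralB//= yc integral_cst// [X in _ * X]P1 mule1 subee//.
have yv a : (v a ^+ 2)%:E = (y a ^+ 2)%:E - ((2 * c) * y a)%:E + (c ^+ 2)%:E.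
  by rewrite -EFinB -EFinD; congr EFin; rewrite /v; ring.
have cyi : P.-integrable setT (fun a => ((2 * c) * y a)%:E).
  by under eq_fun do rewrite EFinM; exact: integrableZl.
have c2i : P.-integrable setT (fun=> (c ^+ 2)%:E).
  by exact: finite_measure_integrable_cst.
have v2 : P.-integrable setT (fun a => (v a ^+ 2)%:E).
  under eq_fun do rewrite yv.
  by apply: integrableD => //; exact: integrableB.
have v2y2 : \int[P]_a (v a ^+ 2)%:E <= \int[P]_a (y a ^+ 2)%:E.
  under eq_integral do rewrite yv.
  rewrite integralD//; last exact: integrableB.
  rewrite integralB// integral_cst// [X in _ * X]P1 mule1.
  under [X in _ - X + _]eq_integral do rewrite EFinM.
  rewrite integralZl// yc -(fineK (integrable_fin_num measurableT y2)).
  by rewrite -EFinM -EFinB -EFinD lee_fin; have := sqr_ge0 c; lra.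
have cE (x : n.-tuple T) : (csum mean x f - csum mean x g = \sum_(k < n) v (tnth x k))%R.
  by rewrite /csum -sumrB; apply: eq_bigr => k _; rewrite /v /y /c; ring.
under eq_fun do rewrite cE.
split; first exact: integrable_sum_sq.
by rewrite integral_sum_sq// lee_wpmul2l// lee_fin.
Qed.

End moments.

Section empirical_measure.
Context (R : realType) (d : nat).
Local Open Scope ereal_scope.

Lemma ge0_integral_emp n (x : n.-tuple (Rd R d)) (f : Rd R d -> \bar R) :
  measurable_fun setT f -> (forall a, 0 <= f a) ->
  \int[emp x]_a f a = (n%:R^-1)%:E * \sum_(k < n) f (tnth x k).
Proof.
move=> mf f0; rewrite /emp ge0_integral_mscale//; congr (_ * _).
rewrite ge0_integral_measure_sum//; apply: eq_bigr => k _.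
by rewrite integral_dirac// diracT mul1e (tnth_nth point).
Qed.

Lemma Rintegral_emp n (x : n.-tuple (Rd R d)) (f : Rd R d -> R) :
  measurable_fun setT f ->
  (\int[emp x]_a f a = n%:R^-1 * \sum_(k < n) f (tnth x k))%R.
Proof.
move=> mf; rewrite /Rintegral integralE.
rewrite !ge0_integral_emp//; last 2 first.
  by apply/measurable_funeneg/measurable_EFinP.
  by apply/measurable_funepos/measurable_EFinP.
rewrite (eq_bigr (fun k => (Num.max (f (tnth x k)) 0)%:E)); last first.
  by move=> k _; rewrite funeposE EFin_max.
rewrite [X in _ - _ * X](eq_bigr (fun k => (Num.max (- f (tnth x k)) 0)%:E)); last first.
  by move=> k _; rewrite funenegE EFin_max EFinN.
rewrite !sumEFin -!EFinM -EFinB /= -mulrBr -sumrB; congr (_ * _)%R.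
apply: eq_bigr => k _; set y := f _.
have [y0|y0] : (0 <= y \/ y <= 0)%R by apply/orP; exact: le_total.
  by rewrite max_l// max_r ?oppr_le0// subr0.
by rewrite max_r// max_l ?oppr_ge0//; ring.
Qed.

Lemma emp_processE n (x : n.-tuple (Rd R d)) (P : probability (Rd R d) R)
    (F : set (Rd R d -> R)) (f : F) : (0 < n)%N -> measurable_fun setT (set_val f) ->
  @emp_process R d P F n x f = (csum (mean P) x (set_val f) / Num.sqrt n%:R)%R.
Proof.
move=> n0 mf; rewrite /emp_process Rintegral_emp//.
have -> : csum (mean P) x (set_val f) =
    (\sum_(k < n) set_val f (tnth x k) - n%:R * mean P (set_val f))%R.
  by rewrite /csum sumrB sumr_const card_ord mulr_natl.
rewrite -/(mean P _); set s := Num.sqrt _; set a := bigop _ _ _; set m := mean _ _.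
have s0 : s != 0%R by rewrite gt_eqF// sqrtr_gt0 ltr0n.
have -> : n%:R = (s ^+ 2)%R by rewrite sqr_sqrtr.
by field.
Qed.

End empirical_measure.

(** * From the Donsker property to equicontinuity *)

Section uniform_lipschitz.
Context (R : realType) (U : choiceType) .
Local Notation UR := {uniform U -> R}.

(* Stated for functionals on {uniform U -> R}, whose points may be unbounded. *)
Definition lip (C : R) (h : UR -> R) := forall (w w' : UR) (e : R), 0 <= e ->
  (forall f, `|(w : U -> R) f - (w' : U -> R) f| <= e) -> h w <= h w' + C * e.

Lemma lip_continuous C h : 0 < C -> lip C h -> continuous h.
Proof.
move=> C0 lh w A /nbhs_ballP[e /= e0 eA]; apply/uniform_nbhs.
have e'0 : 0 < e / (2 * C) by rewrite divr_gt0// mulr_gt0.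
exists [set z : R * R | ball z.1 (e / (2 * C)) z.2]; split.
  exact: (entourage_ball R (PosNum e'0)).
move=> w' /= ww'; apply: eA; rewrite /ball/=.
have H f : `|(w : U -> R) f - (w' : U -> R) f| <= e / (2 * C).
  by rewrite ltW//; exact: (ww' f).
have h1 := lh _ _ _ (ltW e'0) H.
have h2 : h w' <= h w + C * (e / (2 * C)).
  by apply: lh; [exact: ltW|move=> f; rewrite distrC].
have CE : C * (e / (2 * C)) = e / 2 by field; rewrite gt_eqF.
by rewrite CE in h1 h2; rewrite ltr_norml; lra.
Qed.

Lemma lip_eval f : lip 1 (fun w : UR => (w : U -> R) f).
Proof. by move=> w w' e e0 /(_ f); rewrite ler_norml; lra. Qed.

Lemma lip_min C h1 h2 : lip C h1 -> lip C h2 -> lip C (fun w => Num.min (h1 w) (h2 w)).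
Proof.
move=> l1 l2 w w' e e0 ww'; have := l1 _ _ _ e0 ww'; have := l2 _ _ _ e0 ww'.
by rewrite /Order.min; case: ifPn; case: ifPn; rewrite -?leNgt; lra.
Qed.

(* The truncation at 1 makes the supremum finite without boundedness assumptions. *)
Definition dist1 (z w : UR) : R :=
  sup ([set 0] `|` [set Num.min 1 `|(w : U -> R) f - (z : U -> R) f| | f in setT]).

Lemma dist1_has_sup z w :
  has_sup ([set 0] `|` [set Num.min 1 `|(w : U -> R) f - (z : U -> R) f| | f in setT]).
Proof.
split; first by exists 0; left.
by exists 1 => _ [->//|[f _ <-]]; rewrite ge_min lexx.
Qed.

Lemma dist1_le z w e : 0 <= e ->
  (forall f, Num.min 1 `|(w : U -> R) f - (z : U -> R) f| <= e) -> dist1 z w <= e.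
Proof.
move=> e0 h; apply: ge_sup; first by exists 0; left.
by move=> _ [->//|[f _ <-]].
Qed.

Lemma le_dist1 z w f : Num.min 1 `|(w : U -> R) f - (z : U -> R) f| <= dist1 z w.
Proof.
apply: ub_le_sup; first by case: (dist1_has_sup z w).
by right; exists f.
Qed.

Lemma dist1_ge0 z w : 0 <= dist1 z w.
Proof. by apply: ub_le_sup; [case: (dist1_has_sup z w)|left]. Qed.

Lemma dist1_lt z w e f : e <= 1 -> dist1 z w < e ->
  `|(w : U -> R) f - (z : U -> R) f| < e.
Proof.
move=> e1 h; have := le_lt_trans (le_dist1 z w f) h.
by rewrite gt_min => /orP[]//; rewrite ltNge e1.
Qed.

Lemma dist1xx z : dist1 z z = 0.
Proof.
apply/eqP; rewrite eq_le dist1_ge0 andbT; apply: dist1_le => // f.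
by rewrite subrr normr0 ge_min lexx orbT.
Qed.

Lemma lip_dist1 z : lip 1 (dist1 z).
Proof.
move=> w w' e e0 ww'; rewrite mul1r; apply: dist1_le.
  by rewrite addr_ge0// dist1_ge0.
move=> f; have := le_dist1 z w' f; have := ww' f.
have := ler_distD ((w' : U -> R) f) ((w : U -> R) f) ((z : U -> R) f).
by rewrite /Order.min; case: ifPn; case: ifPn; rewrite -?leNgt; lra.
Qed.

(** A ramp, equal to 0 where h <= a and to 1 where h >= 2 a. It replaces indicators, because weak
    convergence tests continuous functionals only. *)
Definition cutoff (a : R) (h : UR -> R) (w : UR) : R :=
  Num.min 1 (Num.max 0 (h w / a - 1)).

Lemma cutoff_continuous C a h : 0 < C -> 0 < a -> lip C h -> continuous (cutoff a h).
Proof.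
move=> C0 a0 lh; apply: (@lip_continuous (C / a)); first exact: divr_gt0.
move=> w w' e e0 /(lh _ _ _ e0) {}lh.
have : h w / a - 1 <= h w' / a - 1 + C / a * e.
  by rewrite [C / a * e]mulrAC addrAC lerD2r -mulrDl ler_pM2r ?invr_gt0.
have : 0 <= C / a * e by rewrite mulr_ge0// divr_ge0// ltW.
rewrite /cutoff /Order.min /Order.max.
by do 4 (case: ifPn; rewrite -?leNgt); lra.
Qed.

Lemma cutoff_ge0 a h w : 0 <= cutoff a h w.
Proof. by rewrite le_min ler01 le_max lexx. Qed.

Lemma cutoff_le1 a h w : cutoff a h w <= 1.
Proof. by rewrite ge_min lexx. Qed.

Lemma cutoff_eq1 a h w : 0 < a -> 2 * a <= h w -> cutoff a h w = 1.
Proof.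
move=> a0 hw; rewrite /cutoff min_l//; rewrite le_max; apply/orP; right.
by rewrite lerBrDr ler_pdivlMr//; lra.
Qed.

Lemma cutoff_eq0 a h w : 0 < a -> h w <= a -> cutoff a h w = 0.
Proof.
move=> a0 hw; have : h w / a - 1 <= 0 by rewrite subr_le0 ler_pdivrMr// mul1r.
by move=> h0; rewrite /cutoff max_l// min_r.
Qed.

(** The value 1 at the empty list is an upper bound of [dist1], so a value below some a <= 1
    exhibits an actual center. *)
Definition distl (zs : seq UR) (w : UR) : R := \big[Num.min/1]_(z <- zs) dist1 z w.

Lemma distl_cons z zs w : distl (z :: zs) w = Num.min (dist1 z w) (distl zs w).
Proof. by rewrite /distl big_cons. Qed.

Lemma lip_distl zs : lip 1 (distl zs).
Proof.
elim: zs => [|z zs ih].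
  by move=> w w' e e0 ww'; rewrite /distl !big_nil; lra.
by move=> w w' e e0 ww'; rewrite !distl_cons; exact: (lip_min (@lip_dist1 z) ih).
Qed.

Lemma distl_lt zs w a : a <= 1 -> distl zs w < a -> exists2 z, z \in zs & dist1 z w < a.
Proof.
move=> a1; elim: zs => [|z zs ih]; first by rewrite /distl big_nil ltNge a1.
rewrite distl_cons gt_min => /orP[zw|/ih[z' z'zs z'w]].
  by exists z; rewrite ?mem_head.
by exists z' => //; rewrite inE z'zs orbT.
Qed.

Lemma distl_le zs w z : z \in zs -> distl zs w <= dist1 z w.
Proof.
elim: zs => // z' zs ih; rewrite inE distl_cons => /predU1P[->|/ih h].
  by rewrite ge_min lexx.
by rewrite ge_min h orbT.
Qed.

Lemma lip_preimage_nbhs C h w e : 0 < C -> lip C h -> 0 < e ->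
  nbhs w [set w' | `|h w - h w'| < e].
Proof.
move=> C0 lh e0.
exact: (@lip_continuous C h C0 lh w _ (nbhsx_ballx (h w) e e0)).
Qed.

(** Makes the compact sets of the tightness condition closed, hence their preimages under the limit
    measurable. *)
Lemma uniform_fct_hausdorff : hausdorff_space UR.
Proof.
move=> p q pq; apply/funext => f; apply/eqP; rewrite -subr_eq0 -normr_eq0.
apply/eqP/le_anti; rewrite normr_ge0 andbT; apply/ler_addgt0Pr => e e0; rewrite add0r.
have e2 : 0 < e / 2 by rewrite divr_gt0.
have [w []] := pq _ _ (lip_preimage_nbhs p ltr01 (lip_eval f) e2)
  (lip_preimage_nbhs q ltr01 (lip_eval f) e2).
move=> /= h1 h2; have := ler_distD ((w : U -> R) f) ((p : U -> R) f) ((q : U -> R) f).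
by rewrite [X in _ <= _ + X]distrC; lra.
Qed.

Lemma measurable_continuous_comp dO (O : measurableType dO) (G : O -> UR) (h : UR -> R) :
  (forall V : set UR, open V -> measurable (G @^-1` V)) -> continuous h ->
  measurable_fun setT (h \o G).
Proof.
move=> mG ch; apply: (measurability _ (RGenOInfty.measurableE R)) => _ [_ [x ->] <-].
by rewrite setTI comp_preimage; apply: mG; apply: open_comp => // w _.
Qed.

End uniform_lipschitz.

Section outer_expectation.
Context d (T : measurableType d) (R : realType) (P : {measure set T -> \bar R}).
Local Open Scope ereal_scope.

Lemma mu_ext_le_outer_expectation (f : T -> \bar R) (A : set T) :
  (forall x, 0 <= f x) -> (forall x, A x -> 1 <= f x) ->
  mu_ext P A <= outer_expectation P f.
Proof.
move=> f0 f1; apply: le_ereal_inf_tmp => _ [g [gi fg] <-].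
have mg := measurable_int _ gi.
have := le_integral_abse P measurableT mg (@ltr01 R); rewrite mul1e setTI => h.
rewrite (eq_integral (fun x => `|g x|)); last first.
  by move=> x _; rewrite gee0_abs// (le_trans (f0 x)).
apply: le_trans h; apply: mu_ext_le_measure.
  rewrite -[X in measurable X]setTI.
  by apply: emeasurable_fun_c_infty => //; exact: measurableT_comp.
by move=> x /f1 h /=; apply: le_trans h (le_trans (fg x) (lee_abs _)).
Qed.

Lemma outer_expectation_le (f g : T -> \bar R) :
  P.-integrable setT g -> (forall x, f x <= g x) ->
  outer_expectation P f <= \int[P]_x g x.
Proof. by move=> gi fg; apply: ereal_inf_lbound; exists g. Qed.

End outer_expectation.

Section donsker_approx.
Context (R : realType) (d : nat) (X : set (Rd R d)).
Context (P0 : probability (Rd R d) R) (F : set (Rd R d -> R)).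
Hypothesis hF : Donsker X P0 F.

Let Fint f : F f -> P0.-integrable setT (EFin \o f).
Proof. by case: hF => h _; exact: h. Qed.

Let Fmeas f : F f -> measurable_fun setT f.
Proof. by move=> /Fint /measurable_int /measurable_EFinP. Qed.

Local Notation UR := {uniform F -> R}.

Let hfg (f g : F) (a : R) : UR -> R :=
  cutoff a (fun w : UR => `|(w : F -> R) f - (w : F -> R) g|).

Let mF (f : F) : measurable_fun setT (set_val f).
Proof. by apply: Fmeas; exact: set_valP. Qed.

Let lip_hfg (f g : F) : lip 2 (fun w : UR => `|(w : F -> R) f - (w : F -> R) g|).
Proof.
move=> w w' e e0 ww'; have := ww' f; have := ww' g; rewrite !ler_norml => h1 h2.
have := ler_norm ((w' : F -> R) f - (w' : F -> R) g).
have := lerNnormlW (lexx `|(w' : F -> R) f - (w' : F -> R) g|).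
lra.
Qed.

(** The ramp is at most the square of its argument divided by a^2. For two fixed functions this
    majorant is integrable, so its integral, a variance, bounds the outer expectation. *)
Lemma outer_expectation_cutoff_le n (f g : F) (a : R) : 0 < a -> (0 < n)%N ->
  (L2dist2 P0 (set_val f) (set_val g) < +oo)%E ->
  (outer_expectation (power_measure P0 n) (fun x => (hfg f g a (emp_process P0 x))%:E)
   <= (a ^- 2)%:E * L2dist2 P0 (set_val f) (set_val g))%E.
Proof.
move=> a0 n0 fg.
have [fi gi] := (Fint (set_valP f), Fint (set_valP g)).
have [sqi sqle] := csum_sq_moment n fi gi fg.
pose G (x : n.-tuple (Rd R d)) := ((a ^- 2 / n%:R)%:E *
  ((csum (mean P0) x (set_val f) - csum (mean P0) x (set_val g)) ^+ 2)%:E)%E.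
have Gi : (power_measure P0 n).-integrable setT G by exact: integrableZl.
have hG x : ((hfg f g a (emp_process P0 x))%:E <= G x)%E.
  rewrite /G -EFinM lee_fin.
  set D := csum _ _ _ - _.
  have DE : (emp_process P0 x : F -> R) f - (emp_process P0 x : F -> R) g = D / Num.sqrt n%:R.
    by rewrite /D mulrBl (emp_processE _ _ n0 (mF f)) (emp_processE _ _ n0 (mF g)).
  have -> : a ^- 2 / n%:R * D ^+ 2 = (`|D / Num.sqrt n%:R| / a) ^+ 2.
    rewrite !expr_div_n real_normK ?num_real// expr_div_n sqr_sqrtr//.
    by rewrite mulrC mulrA mulrAC.
  rewrite /hfg; set w : UR := emp_process P0 x.
  have [h|h] := leP `|(w : F -> R) f - (w : F -> R) g| a.
    by rewrite cutoff_eq0// sqr_ge0.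
  apply: le_trans (cutoff_le1 _ _ _) _; rewrite -DE -/w.
  by apply: exprn_ege1; rewrite ler_pdivlMr// mul1r ltW.
apply: le_trans (outer_expectation_le Gi hG) _.
rewrite /G integralZl//; apply: (@le_trans _ _ ((a ^- 2 / n%:R)%:E * (n%:R%:E *
    L2dist2 P0 (set_val f) (set_val g)))%E).
  by rewrite lee_wpmul2l// lee_fin divr_ge0 ?invr_ge0 ?exprn_ge0// ltW.
rewrite muleA -EFinM divfK//; by rewrite pnatr_eq0 -lt0n.
Qed.

Section limit.
Context dO (O : measurableType dO) (PO : probability O R) (G : O -> UR).
Hypothesis mG : forall V : set UR, open V -> measurable (G @^-1` V).
Hypothesis cvgG : forall h : UR -> R,
  {within @ell_infty R d F, continuous h} ->
  (exists C : R, forall z, ell_infty z -> `|h z| <= C) ->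
  outer_expectation (power_measure P0 n)
    (fun x => (h (emp_process P0 x))%:E) @[n --> \oo] -->
  (\int[PO]_w (h (G w))%:E)%E.

Let cvg_cutoff C a h : 0 < C -> 0 < a -> lip C h ->
  outer_expectation (power_measure P0 n)
    (fun x => (cutoff a h (emp_process P0 x))%:E) @[n --> \oo] -->
  (\int[PO]_w (cutoff a h (G w))%:E)%E.
Proof.
move=> C0 a0 lh; apply: cvgG.
  by apply: continuous_subspaceT => w; exact: (cutoff_continuous C0 a0 lh).
by exists 1 => z _; rewrite ger0_norm ?cutoff_le1 ?cutoff_ge0.
Qed.

Let measurable_cutoff C a h : 0 < C -> 0 < a -> lip C h ->
  measurable_fun setT (fun w => (cutoff a h (G w))%:E).
Proof.
move=> C0 a0 lh; apply/measurable_EFinP.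
exact: (measurable_continuous_comp mG (cutoff_continuous C0 a0 lh)).
Qed.

Let open_lt C (h : UR -> R) c : 0 < C -> lip C h -> open [set w | h w < c].
Proof.
move=> C0 lh; apply: (@open_comp _ _ h [set r | r < c]); last exact: open_lt.
by move=> w _; exact: (lip_continuous C0 lh).
Qed.

(* Balls of positive probability see two f, g that are close in L2 as close:
   otherwise Chebyshev would fail in the limit. *)
Lemma center_equicont (z : UR) (f g : F) (a : R) : 0 < a -> a <= 1 ->
  (L2dist2 P0 (set_val f) (set_val g) <
     (a ^+ 2)%:E * PO (G @^-1` [set w | (dist1 z w < a)%R]))%E ->
  `|(z : F -> R) f - (z : F -> R) g| <= 4 * a.
Proof.
move=> a0 a1 hV; rewrite leNgt; apply/negP => zfg.
pose V := G @^-1` [set w | (dist1 z w < a)%R].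
have mV : measurable V by apply: mG; exact: (open_lt _ ltr01 (@lip_dist1 _ _ z)).
have L2fin : (L2dist2 P0 (set_val f) (set_val g) < +oo)%E.
  by apply: lt_le_trans hV _; exact: leey.
(* If [z] separates f and g by more than 4 a, every point within a of [z] separates them by more
   than 2 a, where the ramp equals 1. *)
have PV : (PO V <= \int[PO]_w (hfg f g a (G w))%:E)%E.
  rewrite -[V]setIT -integral_indic//; apply: ge0_le_integral => //.
  - exact/measurable_EFinP/measurable_indic.
  - exact: (measurable_cutoff _ a0 (lip_hfg f g)).
  - move=> w _; rewrite lee_fin indicE; case: (boolP (w \in V)) => [|_] /=; last exact: cutoff_ge0.
    rewrite inE /V/= => Vw; rewrite /hfg cutoff_eq1//.
    have := dist1_lt f a1 Vw; have := dist1_lt g a1 Vw.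
    move: zfg; set zf := (z : F -> R) f; set zg := (z : F -> R) g.
    set wf := (G w : F -> R) f; set wg := (G w : F -> R) g => zfg h1 h2.
    have := ler_distD wf zf zg; have := ler_distD wg wf zg.
    by rewrite [`|zf - wf|]distrC; lra.
(* The second moment bound holds at every sample size n >= 1, with a right-hand side free of n, and
   so survives the limit. *)
have : (\int[PO]_w (hfg f g a (G w))%:E <=
    (a ^- 2)%:E * L2dist2 P0 (set_val f) (set_val g))%E.
  rewrite leNgt; apply/negP => h.
  have := cvg_cutoff (ltr0Sn _ 1) a0 (lip_hfg f g) (open_ereal_gt' h).
  move=> [N _ hN]; have /= := hN N.+1 (leqnSn N).
  by rewrite ltNge outer_expectation_cutoff_le.
move=> /(le_trans PV) h.
have : ((a ^+ 2)%:E * PO V <= L2dist2 P0 (set_val f) (set_val g))%E.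
  apply: (@le_trans _ _ ((a ^+ 2)%:E * ((a ^- 2)%:E * L2dist2 P0 (set_val f) (set_val g)))%E).
    by apply: lee_wpmul2l h; rewrite lee_fin exprn_ge0// ltW.
  by rewrite muleA -EFinM mulfV ?mul1e// expf_neq0// gt_eqF.
by rewrite leNgt hV.
Qed.

(** The ramp of [distl zs] is 1 on the event to be bounded and 0 where the limit is within a of a
    center. The two radii a and 2 a are the price of a continuous test functional. *)
Lemma eventually_close (zs : seq UR) (a e : R) : 0 < a -> 
  ((1 - e)%:E <= PO (G @^-1` [set w | (distl zs w < a)%R]))%E ->
  forall e', e < e' -> \forall n \near \oo,
    po P0 [set x : n.-tuple (Rd R d) | ~ (distl zs (emp_process P0 x) < 2 * a)] < e'.
Proof.
move=> a0 hV e' ee'.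
pose V := G @^-1` [set w | (distl zs w < a)%R].
have mV : measurable V by apply: mG; exact: (open_lt _ ltr01 (@lip_distl _ _ zs)).
have : (\int[PO]_w (cutoff a (distl zs) (G w))%:E < e'%:E)%E.
  apply: (@le_lt_trans _ _ (PO (~` V))).
    rewrite -[~` V]setIT -integral_indic//; last exact: measurableC.
    apply: ge0_le_integral => //.
    - by move=> w _; rewrite lee_fin; exact: cutoff_ge0.
    - exact: (measurable_cutoff ltr01 a0 (@lip_distl _ _ zs)).
    - by apply/measurable_EFinP/measurable_indic; exact: measurableC.
    - move=> w _; rewrite lee_fin indicE; case: (boolP (w \in ~` V)) => [_|] /=; first exact: cutoff_le1.
      rewrite notin_setE /V /= => /contrapT Vw.
      by rewrite cutoff_eq0// ltW.
  rewrite probability_setC//; move: hV; rewrite -/V.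
  rewrite -(fineK (fin_num_measure PO _ mV)) lee_fin => hV.
  by rewrite -EFinB lte_fin; lra.
move=> h; have := cvg_cutoff ltr01 a0 (@lip_distl _ _ zs) (open_ereal_lt' h).
move=> [N _ hN]; exists N => // n /hN /= hn; rewrite -lte_fin -poE; apply: le_lt_trans hn.
apply: mu_ext_le_outer_expectation => x; first by rewrite lee_fin cutoff_ge0.
by move=> /= /negP; rewrite -leNgt => h2; rewrite cutoff_eq1.
Qed.

(** Finitely many balls of mass 0 can be discarded without losing mass, and the smallest mass of the
    remaining ones is a common [p > 0]. [center_equicont] needs such a lower bound. *)
Lemma positive_centers (zs : seq UR) (a e : R) : 0 < a -> a <= 1 ->
  ((1 - e)%:E <= PO (G @^-1` [set w | (distl zs w < a)%R]))%E ->
  exists (zs' : seq UR) (p : R), [/\ 0 < p, {subset zs' <= zs},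
    (forall z, z \in zs' -> (p%:E <= PO (G @^-1` [set w | (dist1 z w < a)%R]))%E) &
    ((1 - e)%:E <= PO (G @^-1` [set w | (distl zs' w < a)%R]))%E].
Proof.
move=> a0 a1 h; pose q z := fine (PO (G @^-1` [set w | (dist1 z w < a)%R])).
have mV z : measurable (G @^-1` [set w | (dist1 z w < a)%R]).
  by apply: mG; exact: (open_lt _ ltr01 (@lip_dist1 _ _ z)).
have mVl l : measurable (G @^-1` [set w | (distl l w < a)%R]).
  by apply: mG; exact: (open_lt _ ltr01 (@lip_distl _ _ l)).
have qE z : PO (G @^-1` [set w | (dist1 z w < a)%R]) = (q z)%:E.
  by rewrite /q fineK// fin_num_measure.
exists [seq z <- zs | 0 < q z], (\big[Num.min/1]_(z <- zs | 0 < q z) q z).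
have subl : {subset [seq z <- zs | 0 < q z] <= zs}.
  by move=> z; rewrite mem_filter => /andP[].
split => //.
- by elim/big_ind : _ => // x y x0 y0; rewrite lt_min x0.
- move=> z; rewrite mem_filter => /andP[qz zzs]; rewrite qE lee_fin.
  elim: zs zzs {h subl} => // z' l ih; rewrite inE big_cons => /predU1P[<-|/ih zl].
    by rewrite qz ge_min lexx.
  by case: ifP => // _; rewrite ge_min zl orbT.
apply: le_trans h _.
have bad0 l : {in l, forall z, q z <= 0} -> PO (G @^-1` [set w | (distl l w < a)%R]) = 0%E.
  elim: l => [_|z l ih hl].
    rewrite (_ : _ @^-1` _ = set0) ?measure0//; apply/seteqP; split => // w.
    by rewrite /= /distl big_nil ltNge a1.
  apply/eqP; rewrite eq_le measure_ge0 andbT.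
  apply: (@le_trans _ _ (PO (G @^-1` [set w | (dist1 z w < a)%R] `|`
      G @^-1` [set w | (distl l w < a)%R]))).
    apply: le_measure; rewrite ?inE//; first exact: measurableU.
    by move=> w; rewrite /= distl_cons gt_min => /orP[]; [left|right].
  apply: (le_trans (measureU2 _ _ _)) => //.
  rewrite [X in (X + _)%E](qE z) [X in (_ + X)%E]ih ?adde0 ?lee_fin ?hl ?mem_head// => z' z'l.
  by rewrite hl// inE z'l orbT.
apply: (@le_trans _ _ (PO (G @^-1` [set w | (distl [seq z <- zs | 0 < q z] w < a)%R] `|`
    G @^-1` [set w | (distl [seq z <- zs | ~~ (0 < q z)] w < a)%R]))).
  apply: le_measure; rewrite ?inE//; first exact: measurableU.
  move=> w /= /(distl_lt a1)[z zzs zw].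
  have [qz|qz] := ltP 0 (q z).
    by left; apply: le_lt_trans zw; apply: distl_le; rewrite mem_filter qz.
  by right; apply: le_lt_trans zw; apply: distl_le; rewrite mem_filter -leNgt qz.
apply: (le_trans (measureU2 _ _ _)) => //.
rewrite [X in (_ + X)%E]bad0 ?adde0// => z.
by rewrite mem_filter -leNgt => /andP[].
Qed.

End limit.

Lemma donsker_approx (a e : R) : 0 < a -> 2 * a <= 1 -> 0 < e ->
  exists (zs : seq UR) (p : R), [/\ 0 < p,
    forall z, z \in zs -> @ell_infty R d F z,
    forall z (f g : F), z \in zs -> (L2dist2 P0 (set_val f) (set_val g) < p%:E)%E ->
      `|(z : F -> R) f - (z : F -> R) g| <= 4 * a &
    \forall n \near \oo, po P0 [set x : n.-tuple (Rd R d) |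
      ~ exists2 z, z \in zs & forall f : F,
        `|(emp_process P0 x : F -> R) f - (z : F -> R) f| < 2 * a] < e].
Proof.
move=> a0 a1 e0; have [_ [_ [dO [Om [PO [G [Gl mG tG cG]]]]]]] := hF.
have a1' : a <= 1 by lra.
have e2 : 0 < e / 2 by rewrite divr_gt0.
have [K [cK Kl PK]] := tG _ e2.
have op z : open [set w : UR | dist1 z w < a].
  apply: (@open_comp _ _ (dist1 z) [set r | r < a]); last exact: open_lt.
  by move=> w _; exact: (lip_continuous ltr01 (@lip_dist1 _ _ z)).
have [D [DK KD]] : exists l : seq UR, {in l, forall z, K z} /\ K `<=` [set w | distl l w < a].
  (* Total boundedness is read off the near-covering form of compactness, for the filter of finite
     lists ordered by inclusion. Only entries in [K] count as centers, which keeps them bounded. *)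
  pose Fl : set_system (seq UR) := fun S : set (seq UR) =>
    exists s : seq UR, forall l : seq UR, {subset s <= l} -> S l.
  have FFl : Filter Fl.
    split; first by exists [::].
      move=> A B [s1 h1] [s2 h2]; exists (s1 ++ s2) => l sl.
      by split; [apply: h1|apply: h2] => z zs; apply: sl; rewrite mem_cat zs ?orbT.
    by move=> A B AB [s h]; exists s => l /h/AB.
  have := (@compact_near_coveringP _ K).1 cK _ Fl
    (fun l w => distl [seq z <- l | `[< K z >]] w < a) FFl.
  case=> [z Kz|s hs].
    exists ([set w | dist1 z w < a], [set l : seq UR | z \in l]) => /=.
      split; last by exists [:: z] => l; apply; rewrite mem_head.
      by apply: open_nbhs_nbhs; split; [exact: op|rewrite /= dist1xx].
    move=> [w l] /= [zw zl]; apply: le_lt_trans zw; apply: distl_le.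
    by rewrite mem_filter zl andbT; exact/asboolP.
  exists [seq z <- s | `[< K z >]]; split; last exact: hs.
  by move=> z; rewrite mem_filter => /andP[/asboolP].
have mVl l : measurable (G @^-1` [set w : UR | (distl l w < a)%R]).
  apply: mG; apply: (@open_comp _ _ (distl l) [set r | r < a]); last exact: open_lt.
  by move=> w _; exact: (lip_continuous ltr01 (@lip_distl _ _ l)).
have PD : ((1 - e / 2)%:E <= PO (G @^-1` [set w | (distl D w < a)%R]))%E.
  apply: le_trans PK _; apply: le_measure; rewrite ?inE//.
    have clK : closed K by apply: compact_closed cK; exact: uniform_fct_hausdorff.
    by rewrite -[K]setCK preimage_setC; apply: measurableC; exact: (mG _ (closed_openC clK)).
  by move=> w /= /KD.
have [zs [p [p0 zsD pzs Pzs]]] := positive_centers mG a0 a1' PD.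
(* The radius comes from Chebyshev's inequality at level a, set against a ball of mass at least
   p. *)
exists zs, (a ^+ 2 * p); split.
- by rewrite mulr_gt0// exprn_gt0.
- by move=> z /zsD zD; apply: Kl; exact: DK.
- move=> z f g zzs fg; apply: (center_equicont mG cG a0 a1').
  apply: lt_le_trans fg _; rewrite EFinM lee_wpmul2l ?lee_fin ?exprn_ge0 ?(ltW a0)//.
  exact: pzs.
- have := eventually_close mG cG a0 Pzs (e' := e) ltac:(lra).
  apply: filterS => n; apply: le_lt_trans; apply: le_po => x /= nz /(distl_lt a1)[z zzs zx].
  by apply: nz; exists z => // f; exact: dist1_lt zx.
Qed.

End donsker_approx.

Section L2dist2_theory.
Context d (T : measurableType d) (R : realType) (P : probability T R).
Local Open Scope ereal_scope.

Lemma L2dist2C f g : L2dist2 P f g = L2dist2 P g f.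
Proof. by apply: eq_integral => a _; congr EFin; ring. Qed.

Lemma L2dist2_triangle f g h : measurable_fun setT f -> measurable_fun setT g ->
  measurable_fun setT h ->
  L2dist2 P f h <= 2%:E * L2dist2 P f g + 2%:E * L2dist2 P g h.
Proof.
move=> mf mg mh; rewrite /L2dist2.
have m (u v : T -> R) : measurable_fun setT u -> measurable_fun setT v ->
    measurable_fun setT (fun a => ((u a - v a) ^+ 2)%:E).
  by move=> mu mv; apply/measurable_EFinP/measurable_funX/measurable_funB.
have s (u v : T -> R) : forall a, setT a -> 0 <= ((u a - v a) ^+ 2)%:E.
  by move=> a _; rewrite lee_fin sqr_ge0.
have Z (u v : T -> R) : measurable_fun setT u -> measurable_fun setT v ->
    2%:E * \int[P]_a ((u a - v a) ^+ 2)%:E = \int[P]_a (2%:E * ((u a - v a) ^+ 2)%:E).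
  by move=> mu mv; rewrite ge0_integralZl//; [exact: m|exact: s].
rewrite !Z//.
rewrite -ge0_integralD//; last 4 first.
- by move=> a _; rewrite -EFinM lee_fin mulr_ge0// sqr_ge0.
- by apply: measurable_funeM; exact: m.
- by move=> a _; rewrite -EFinM lee_fin mulr_ge0// sqr_ge0.
- by apply: measurable_funeM; exact: m.
apply: ge0_le_integral => //.
- by move=> a _; rewrite lee_fin sqr_ge0.
- exact: m.
- by apply: emeasurable_funD; apply: measurable_funeM; exact: m.
- move=> a _; rewrite -!EFinM -EFinD lee_fin.
  by have := sqr_ge0 (f a - g a - (g a - h a))%R; rewrite !expr2; lra.
Qed.

Lemma po_chebyshev n (f g : T -> R) (c t : R) : (0 < n)%N -> (0 < t)%R ->
  P.-integrable setT (EFin \o f) -> P.-integrable setT (EFin \o g) ->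
  L2dist2 P f g <= c%:E ->
  (po P [set x : n.-tuple T |
    t * Num.sqrt n%:R <= `|csum (mean P) x f - csum (mean P) x g|] <= c / t ^+ 2)%R.
Proof.
move=> n0 t0 fi gi fg.
have [] := csum_sq_moment n fi gi (le_lt_trans fg (ltry _)).
set D := (fun x : n.-tuple T => ((csum (mean P) x f - csum (mean P) x g) ^+ 2)%:E) => Di Dle.
have nR : (0 < n%:R :> R)%R by rewrite ltr0n.
have tn : (0 < t ^+ 2 * n%:R)%R by rewrite mulr_gt0// exprn_gt0.
have := le_integral_abse (power_measure P n) measurableT (measurable_int _ Di) tn.
rewrite setTI (eq_integral D) => [h|x _]; last by rewrite gee0_abs// lee_fin sqr_ge0.
rewrite ler_pdivlMr ?exprn_gt0// -(ler_pM2r nR) -lee_fin -mulrA EFinM -poE.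
apply: (@le_trans _ _ ((t ^+ 2 * n%:R)%:E * power_measure P n [set x | (t ^+ 2 * n%:R)%:E <= `|D x|])).
  rewrite muleC lee_pmul2l// ?lte_fin//; apply: mu_ext_le_measure.
    rewrite -[X in measurable X]setTI; apply: emeasurable_fun_c_infty => //.
    by apply: measurableT_comp => //; exact: measurable_int Di.
  move=> x /= hx; rewrite lee_fin ger0_norm ?sqr_ge0// -[X in (_ <= X)%R]real_normK ?num_real//.
  have -> : (t ^+ 2 * n%:R = (t * Num.sqrt n%:R) ^+ 2)%R by rewrite exprMn sqr_sqrtr.
  by rewrite lerXn2r// ?nnegrE// mulr_ge0 ?sqrtr_ge0// ltW.
apply: le_trans h _; apply: le_trans Dle _.
by rewrite muleC EFinM lee_wpmul2r// lee_fin.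
Qed.

End L2dist2_theory.

Section donsker_extension.
Context (R : realType) (d : nat) (X : set (Rd R d)).
Context (P0 : probability (Rd R d) R) (F : set (Rd R d -> R)) (g0 : Rd R d -> R).
Hypotheses (hF : Donsker X P0 F) (g0i : P0.-integrable setT (EFin \o g0))
  (g02 : (\int[P0]_a (g0 a ^+ 2)%:E < +oo)%E).

Let Fint f : F f -> P0.-integrable setT (EFin \o f).
Proof. by case: hF => h _; exact: h. Qed.

Let Fmeas f : F f -> measurable_fun setT f.
Proof. by move=> /Fint /measurable_int /measurable_EFinP. Qed.

Let mg0 : measurable_fun setT g0.
Proof. by move/measurable_int/measurable_EFinP : g0i. Qed.

Let g0z : L2dist2 P0 g0 (fun=> 0) = (\int[P0]_a (g0 a ^+ 2)%:E)%E.
Proof. by apply: eq_integral => a _; rewrite subr0. Qed.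

(** Finitely many bounded centers have a common bound. Replacing a center by the process costs less
    than 2 a at each function: hence [C + 1], as 2 a <= 1, and 8 a = 4 a + 2 a + 2 a. *)
Lemma donsker_close (a e : R) : 0 < a -> 2 * a <= 1 -> 0 < e ->
  exists (C p : R) N, [/\ 0 < C, 0 < p & forall n, (N <= n)%N ->
    po P0 [set x : n.-tuple (Rd R d) |
     ~ ((forall f, F f -> `|csum (mean P0) x f| <= C * Num.sqrt n%:R) /\
        (forall f g, F f -> F g -> (L2dist2 P0 f g < p%:E)%E ->
          `|csum (mean P0) x f - csum (mean P0) x g| <= 8 * a * Num.sqrt n%:R))] < e].
Proof.
move=> a0 a1 e0; have [zs [p [p0 zsl zsp [N _ hN]]]] := donsker_approx hF a0 a1 e0.
have [C [C0 hC]] : exists C, 0 < C /\ forall z, z \in zs -> forall f : F, `|(z : F -> R) f| <= C.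
  elim: zs zsl {zsp hN} => [|z zs ih] zsl; first by exists 1.
  have [|C [C0 hC]] := ih; first by move=> z' z'zs; apply: zsl; rewrite inE z'zs orbT.
  have [C' hC'] := zsl z (mem_head _ _).
  exists (Num.max C C'); split; first by rewrite lt_max C0.
  move=> z'; rewrite inE => /predU1P[-> f|/hC h f].
    by apply: le_trans (hC' f) _; rewrite le_max lexx orbT.
  by apply: le_trans (h f) _; rewrite le_max lexx.
exists (C + 1), p, (maxn N 1); split => //; first by rewrite addr_gt0.
move=> n; rewrite geq_max => /andP[Nn n0]; apply: le_lt_trans (hN n Nn); apply: le_po => x /=.
apply: contra_not => -[z zzs xz].
have s0 : 0 < Num.sqrt n%:R :> R by rewrite sqrtr_gt0 ltr0n.
have xz' f (Ff : F f) : `|csum (mean P0) x f / Num.sqrt n%:R - (z : F -> R) (exist _ f (mem_set Ff))| < 2 * a.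
  by have := xz (exist _ f (mem_set Ff)); rewrite emp_processE//; exact: Fmeas.
split => [f Ff|f g Ff Fg fg].
  rewrite -ler_pdivrMr// -[X in _ / X]gtr0_norm// -normf_div.
  have := xz' f Ff; have := hC z zzs (exist _ f (mem_set Ff)).
  have := ler_distD (csum (mean P0) x f / Num.sqrt n%:R) 0 ((z : F -> R) (exist _ f (mem_set Ff))).
  set u := _ / _; set v := (z : F -> R) _ => _ h1 h2.
  have := ler_normD (u - v) v; rewrite subrK; lra.
rewrite -ler_pdivrMr// -[X in _ / X]gtr0_norm// -normf_div mulrBl.
have := zsp z (exist _ f (mem_set Ff)) (exist _ g (mem_set Fg)) zzs fg.
have := xz' f Ff; have := xz' g Fg.
set u := _ / _; set v := (z : F -> R) _; set u' := _ / _; set v' := (z : F -> R) _ => h1 h2 h3.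
have := ler_distD v' u' u; have := ler_distD v v' u; rewrite [`|v - u|]distrC.
lra.
Qed.

Lemma donsker_tight : asymp_tight P0 (mean P0) (F `|` [set g0]).
Proof.
move=> e e0; have e2 : 0 < e / 2 by rewrite divr_gt0.
have [C [p [N [C0 p0 hN]]]] := donsker_close (a := 2^-1) ltac:(lra) ltac:(lra) e2.
have zi : P0.-integrable setT (EFin \o (fun=> 0 : R)) by exact: integrable0.
pose c := fine (\int[P0]_a (g0 a ^+ 2)%:E).
have cE : L2dist2 P0 g0 (fun=> 0) = c%:E.
  rewrite g0z /c fineK// ge0_fin_numE//.
  by apply: integral_ge0 => a _; rewrite lee_fin sqr_ge0.
have c0 : 0 <= c.
  by rewrite -lee_fin -cE; apply: integral_ge0 => a _; rewrite lee_fin sqr_ge0.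
(* Then t >= 1 and c <= t e / 2, so c / t^2 <= e / 2. *)
pose t := 1 + 2 * c / e.
have t1 : 1 <= t by rewrite lerDl divr_ge0 ?mulr_ge0// ltW.
have t0 : 0 < t by lra.
have ct : c / t ^+ 2 <= e / 2.
  rewrite ler_pdivrMr ?exprn_gt0//.
  apply: (@le_trans _ _ (e / 2 * t)).
    have -> : e / 2 * t = e / 2 + c by rewrite /t; field; rewrite gt_eqF.
    by lra.
  by rewrite ler_pM2l// expr2 ler_peMr// ltW.
exists (Num.max C t), (maxn N 1) => n; rewrite geq_max => /andP[Nn n0].
have s0 : 0 <= Num.sqrt n%:R :> R by exact: sqrtr_ge0.
rewrite [e]splitr; apply: le_trans (lerD (ltW (hN n Nn)) (le_trans (po_chebyshev n0 t0 g0i zi _) ct));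
  last by rewrite cE.
apply: le_trans (poU _ _ _); apply: le_po => x [f [Ff|->] hx].
  left=> -[/(_ f Ff) h _]; move: hx; rewrite ltNge => /negP; apply.
  by apply: le_trans h _; rewrite ler_wpM2r// le_max lexx.
right; rewrite /= [X in _ - X](_ : _ = 0) ?subr0; last first.
  by rewrite /csum big1// => k _; rewrite /mean Rintegral_cst//= mul0r subr0.
apply: le_trans (ltW hx); by rewrite ler_wpM2r// le_max lexx orbT.
Qed.

(** The function [g0] may lie outside [F]. If some [f1] in [F] is close to it, then all members
    close to [g0] are close to [f1], and Chebyshev's inequality is applied to the single pair [f1],
    [g0]. If none is close, [g0] enters no pair except with itself. *)
Lemma donsker_equicont :
  asymp_equicont P0 (mean P0) (L2dist2 P0) (F `|` [set g0]).
Proof.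
move=> delta e d0 e0; have e2 : 0 < e / 2 by rewrite divr_gt0.
pose a := Num.min (2^-1) (delta / 16).
have a0 : 0 < a by rewrite lt_min invr_gt0 ltr0n divr_gt0.
have a1 : 2 * a <= 1.
  have : a <= 2^-1 by rewrite ge_min lexx.
  lra.
have a8 : 8 * a <= delta / 2.
  have : a <= delta / 16 by rewrite ge_min lexx orbT.
  lra.
have [C [p [N [C0 p0 hN]]]] := donsker_close a0 a1 e2.
(* With p / 4 the squared triangle inequality through [g0] gives 2 q + 2 q <= p; the other term
   makes Chebyshev's bound at most e / 2. *)
pose q := Num.min (p / 4) ((delta / 2) ^+ 2 * (e / 2)).
have q0 : 0 < q by rewrite lt_min divr_gt0//= mulr_gt0// exprn_gt0// divr_gt0.
have qp : q <= p / 4 by rewrite ge_min lexx.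
have qe : q <= (delta / 2) ^+ 2 * (e / 2) by rewrite ge_min lexx orbT.
have dd : 0 < delta / 2 by rewrite divr_gt0.
have s0 n : 0 <= Num.sqrt n%:R :> R by exact: sqrtr_ge0.
exists q, (maxn N 1); split => // n; rewrite geq_max => /andP[Nn n0].
have cheb f1 : F f1 -> (L2dist2 P0 f1 g0 < q%:E)%E ->
    po P0 [set x : n.-tuple (Rd R d) |
      delta / 2 * Num.sqrt n%:R <= `|csum (mean P0) x f1 - csum (mean P0) x g0|] <= e / 2.
  move=> Ff1 h; apply: le_trans (po_chebyshev n0 dd (Fint Ff1) g0i (ltW h)) _.
  by rewrite ler_pdivrMr ?exprn_gt0// mulrC.
have [[f1 [Ff1 h1]]|nf1] := pselect (exists f1, F f1 /\ (L2dist2 P0 f1 g0 < q%:E)%E).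
  rewrite [e]splitr; apply: le_trans (lerD (ltW (hN n Nn)) (cheb f1 Ff1 h1)).
  apply: le_trans (poU _ _ _); apply: le_po => x osc.
  apply: contrapT => /not_orP[/= /contrapT[_ hp] /negP]; rewrite -ltNge => hg.
  have near_g0 f : F f -> (L2dist2 P0 f g0 < q%:E)%E ->
      `|csum (mean P0) x f - csum (mean P0) x g0| <= delta * Num.sqrt n%:R.
    move=> Ff fg; have h : (L2dist2 P0 f f1 < p%:E)%E.
      apply: le_lt_trans (L2dist2_triangle P0 (Fmeas Ff) mg0 (Fmeas Ff1)) _.
      rewrite [X in (_ + _ * X)%E]L2dist2C.
      apply: (@lt_le_trans _ _ (2%:E * q%:E + 2%:E * q%:E)%E).
        by apply: lteD; rewrite lte_pmul2l.
      by rewrite -!EFinM -EFinD lee_fin; lra.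
    have := hp f f1 Ff Ff1 h.
    have := ler_distD (csum (mean P0) x f1) (csum (mean P0) x f) (csum (mean P0) x g0).
    have := ler_wpM2r (s0 n) a8; lra.
  case: osc => f [g [Ff Gg fg]]; rewrite ltNge => /negP; apply.
  case: Ff Gg fg => [Ff|->] [Fg|->] fg.
  - have h : (L2dist2 P0 f g < p%:E)%E by apply: lt_le_trans fg _; rewrite lee_fin; lra.
    have := hp f g Ff Fg h; have := ler_wpM2r (s0 n) a8; have := s0 n; nra.
  - exact: near_g0.
  - by rewrite distrC; apply: near_g0 => //; rewrite L2dist2C.
  - by rewrite subrr normr0 mulr_ge0// ltW.
apply: le_trans (le_po _ _) (le_trans (ltW (hN n Nn)) _); last by lra.
move=> x [f [g [Ff Gg fg]]] hx [_ hp]; move: hx; rewrite ltNge => /negP; apply.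
case: Ff Gg fg => [Ff|->] [Fg|->] fg.
- have h : (L2dist2 P0 f g < p%:E)%E by apply: lt_le_trans fg _; rewrite lee_fin; lra.
  have := hp f g Ff Fg h; have := ler_wpM2r (s0 n) a8; have := s0 n; nra.
- by case: nf1; exists f.
- by case: nf1; exists g; rewrite L2dist2C.
- by rewrite subrr normr0 mulr_ge0// ltW.
Qed.

End donsker_extension.

(** * The bootstrap as a finite average *)

Definition resample T n (x : n.-tuple T) (i : {ffun 'I_n -> 'I_n}) : n.-tuple T :=
  subt (fun l => i l) x.

(** The conditional probability given [x] under the empirical bootstrap, where the n^n index
    functions are equally likely. It makes sense for every set and is finitely additive. *)
Definition avg_resample (T : Type) (R : realType) n (x : n.-tuple T)
    (B : set (n.-tuple T)) : R :=
  (\sum_(i : {ffun 'I_n -> 'I_n}) (`[< B (resample x i) >] : nat)%:R) / n%:R ^+ n.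

Section empirical_resampling.
Context (R : realType) (d : nat).

Lemma measurable_set1_Rd (y : Rd R d) : measurable [set y].
Proof.
rewrite (_ : [set y] = box (fun j => [set tnth y j])).
  by apply: measurable_box => j; exact: measurable_set1.
apply/seteqP; split => [_ -> j //|z zy]; apply: eq_from_tnth => j; exact: zy.
Qed.

Lemma measurable_set1_sample n (t : n.-tuple (Rd R d)) : measurable [set t].
Proof.
rewrite (_ : [set t] = box (fun j => [set tnth t j])).
  by apply: measurable_box => j; exact: measurable_set1_Rd.
apply/seteqP; split => [_ -> j //|z zy]; apply: eq_from_tnth => j; exact: zy.
Qed.

Lemma emp_measure n (x : n.-tuple (Rd R d)) (A : set (Rd R d)) :
  emp x A = (n%:R^-1 * \sum_(k < n) (`[< A (tnth x k) >] : nat)%:R)%:E.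
Proof.
rewrite /emp /= /mscale/= /msum/= EFinM -sumEFin; congr (_ * _)%E.
by apply: eq_bigr => k _; rewrite diracE (tnth_nth point).
Qed.

Lemma prod_asbool (T : Type) n (A : 'I_n -> set T) (t : 'I_n -> T) :
  ((`[< forall l, A l (t l) >] : nat)%:R : R) = \prod_(l < n) (`[< A l (t l) >] : nat)%:R.
Proof.
case: asboolP => [h|/existsNP[l nAl]].
  by rewrite big1// => l _; rewrite asboolT.
by rewrite (bigD1 l)//= asboolF// mul0r.
Qed.

Variables (dW : measure_display) (W : measurableType dW) (Q : probability W R).
Variables (n : nat) (x : n.-tuple (Rd R d)) (gam : W -> Rd R d).
Hypothesis mgam : measurable_fun setT gam.
Hypothesis gamE : forall A, measurable A -> pushforward Q gam A = emp x A.

Let resamples : seq (n.-tuple (Rd R d)) :=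
  [seq resample x i | i : {ffun 'I_n -> 'I_n}].

Let nu : {measure set (n.-tuple (Rd R d)) -> \bar R} :=
  mscale ((n ^ n)%N%:R^-1)%:nng (msum (fun k => \d_(nth x resamples k)) (size resamples)).

Let nuE B : nu B = (avg_resample R x B)%:E.
Proof.
rewrite /nu /= /mscale/= /msum/= /avg_resample mulrC EFinM natrX; congr (_ * _)%E.
rewrite -sumEFin.
transitivity (\sum_(t <- resamples) (\d_t B : \bar R))%E.
  by rewrite (big_nth x) big_mkord.
rewrite /resamples big_image/=; apply: eq_bigr => i _; by rewrite diracE.
Qed.

Let boot1 (w : n.-tuple W) : n.-tuple (Rd R d) := [tuple gam (tnth w i) | i < n].

Let mboot : measurable_fun setT boot1.
Proof.
apply/measurable_fun_tnthP => i.
rewrite (_ : _ \o _ = gam \o (fun w : n.-tuple W => tnth w i)).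
  by apply: measurableT_comp => //; exact: measurable_tnth.
by apply/funext => w /=; rewrite tnth_mktuple.
Qed.

(** Both sides are product measures with marginal [emp x]: on a box, the average over index
    functions factorises over the coordinates. *)
Lemma power_measure_boot U : measurable U ->
  power_measure Q n (boot1 @^-1` U) = (avg_resample R x U)%:E.
Proof.
move=> mU; rewrite -nuE.
pose g : {mfun W >-> Rd R d} := mfun_Sub (mem_set mgam).
pose mu : probability (Rd R d) R := distribution Q g.
have muE A : measurable A -> mu A = (n%:R^-1 * \sum_(k < n) (`[< A (tnth x k) >] : nat)%:R)%:E.
  by move=> mA; rewrite -emp_measure -gamE.
rewrite (@box_unique _ _ _ mu n nu)//.
  rewrite -(@box_unique _ _ _ mu n (pushforward (power_measure Q n) boot1))// => A mA.
  transitivity (power_measure Q n (box (fun i => gam @^-1` A i))).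
    congr (power_measure _ _ _); apply/seteqP; split => w /= h i.
      by have := h i; rewrite tnth_mktuple.
    by rewrite tnth_mktuple; exact: h.
  rewrite power_measureE// => i.
  by rewrite -[X in measurable X]setTI; exact: mgam.
move=> A mA; rewrite nuE.
rewrite (eq_bigr (fun l => (n%:R^-1 * \sum_(k < n) (`[< A l (tnth x k) >] : nat)%:R)%:E)) => [|l _]; last exact: muE.
rewrite prodEFin; congr EFin; rewrite /avg_resample.
transitivity ((\sum_(i : {ffun 'I_n -> 'I_n})
    \prod_(l < n) (`[< A l (tnth x (i l)) >] : nat)%:R) / n%:R ^+ n : R).
  congr (_ / _); apply: eq_bigr => i _.
  rewrite -(prod_asbool A (fun l => tnth x (i l))).
  congr ((nat_of_bool _)%:R); apply/asbool_equiv_eq.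
  by split => h l; have := h l; rewrite tnth_subt.
rewrite -(bigA_distr_bigA (fun l k => (`[< A l (tnth x k) >] : nat)%:R))/=.
by rewrite big_split/= prodr_const card_ord exprVn mulrC.
Qed.

(** Almost surely the bootstrap sample lies in the finite set [S] of resamples, and every subset of
    [S] is measurable. Hence the conditional outer probability of an arbitrary set is exactly the
    finite average. *)
Lemma po_boot (B : set (n.-tuple (Rd R d))) :
  po Q [set w | B (boot1 w)] = avg_resample R x B.
Proof.
pose S : set (n.-tuple (Rd R d)) := [set t | t \in resamples].
have mS A : measurable (A `&` S).
  rewrite (_ : A `&` S = \bigcup_(t in [set t | t \in [seq t <- resamples | `[< A t >]]]) [set t]).
    by apply: fin_bigcup_measurable => // t _; exact: measurable_set1_sample.
  apply/seteqP; split => [t [At St]|t [t' /= + ->]].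
    by exists t => //=; rewrite mem_filter; apply/andP; split => //; exact/asboolP.
  by rewrite mem_filter => /andP[/asboolP].
have BS : avg_resample R x (B `&` S) = avg_resample R x B.
  rewrite /avg_resample; congr (_ / _); apply: eq_bigr => i _.
  congr ((nat_of_bool _)%:R); apply/asbool_equiv_eq; split => [[]//|Bi]; split => //.
  by apply/fintype.imageP; exists i.
have nS : avg_resample R x (~` S) = 0.
  rewrite /avg_resample big1 ?mul0r// => i _.
  rewrite asboolF//; apply; by apply/fintype.imageP; exists i.
have mS1 : measurable S by rewrite -[S]setTI.
have mb A : measurable A -> measurable (boot1 @^-1` A).
  by move=> mA; rewrite -[X in measurable X]setTI; exact: mboot.
apply/le_anti/andP; split.
  rewrite -[leRHS]addr0 -nS -BS.
  apply: (@le_trans _ _ (po Q (boot1 @^-1` (B `&` S) `|` boot1 @^-1` (~` S)))).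
    by apply: le_po => w /= Bw; have [Sw|nSw] := pselect (S (boot1 w)); [left|right].
  apply: le_trans (poU _ _ _) _; rewrite -lee_fin !EFinD -!power_measure_boot//;
    last exact: measurableC.
  by rewrite -!measurable_po//; apply: mb => //; exact: measurableC.
rewrite -BS -lee_fin -power_measure_boot// measurable_po; last exact: mb.
by rewrite lee_fin; apply: le_po => w [].
Qed.

End empirical_resampling.

(** * Square integrability and the density *)

Section restriction.
Context d (T : measurableType d) (R : realType).
Variables (mu : {measure set T -> \bar R}) (D : set T) (mD : measurable D).
Local Open Scope ereal_scope.

Lemma ge0_integral_mrestr (f : T -> \bar R) : measurable_fun setT f ->
  (forall x, 0 <= f x) -> \int[mrestr mu mD]_x f x = \int[mu]_(x in D) f x.
Proof.
move=> mf f0; transitivity (\int[mrestr mu mD]_(x in setT `\` ~` D) f x).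
  apply: ge0_negligible_integral => //; first exact: measurableC.
  by rewrite /= /mrestr setICl measure0.
rewrite setTD setCK; apply: eq_measure_integral => A mA AD.
by rewrite /= /mrestr setIidl.
Qed.

Lemma integral_mrestr (f : T -> \bar R) : measurable_fun setT f ->
  \int[mrestr mu mD]_x f x = \int[mu]_(x in D) f x.
Proof.
move=> mf; rewrite [LHS]integralE [RHS]integralE.
by rewrite !ge0_integral_mrestr//; do ?[exact: measurable_funepos|exact: measurable_funeneg].
Qed.

End restriction.

Section square_integrable.
Context d (T : measurableType d) (R : realType) (mu : {measure set T -> \bar R}).

Definition sqint (f : T -> R) :=
  measurable_fun setT f /\ (\int[mu]_x (f x ^+ 2)%:E < +oo)%E.

Lemma sqintP f : sqint f -> mu.-integrable setT (fun x => (f x ^+ 2)%:E).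
Proof.
move=> [mf f2]; apply/integrableP; split.
  by apply/measurable_EFinP/measurable_funX.
rewrite (eq_integral (fun a => (f a ^+ 2)%:E))// => a _.
by rewrite gee0_abs// lee_fin sqr_ge0.
Qed.

Lemma sqint_integrableM f g : sqint f -> sqint g ->
  mu.-integrable setT (fun x => (f x * g x)%:E).
Proof.
move=> sf sg; have := integrableD measurableT (sqintP sf) (sqintP sg).
apply: le_integrable => //.
  by apply/measurable_EFinP/measurable_funM; [case: sf|case: sg].
move=> x _; rewrite /= lee_fin [X in _ <= X]ger0_norm ?addr_ge0 ?sqr_ge0//.
have := sqr_ge0 (f x - g x); have := sqr_ge0 (f x + g x).
by rewrite ler_norml !expr2; lra.
Qed.

Lemma sqintD f g : sqint f -> sqint g -> sqint (fun x => f x + g x).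
Proof.
move=> sf sg; split; first by apply: measurable_funD; [case: sf|case: sg].
have h : mu.-integrable setT (fun x => (f x ^+ 2)%:E + ((2%:E * (f x * g x)%:E) + (g x ^+ 2)%:E))%E.
  apply: integrableD => //; first exact: sqintP.
  apply: integrableD => //; last exact: sqintP.
  by apply: integrableZl => //; exact: sqint_integrableM.
have := integrable_lty measurableT h.
by congr (_ < _)%E; apply: eq_integral => x _; rewrite -!EFinM -!EFinD; congr EFin; ring.
Qed.

Lemma sqintN f : sqint f -> sqint (fun x => - f x).
Proof.
move=> [mf f2]; split; first exact: measurableT_comp.
by under eq_integral do rewrite sqrrN.
Qed.

Local Notation I f := (\int[mu]_x f x)%R.

Lemma Rintegral_sqD f g : sqint f -> sqint g ->
  I (fun x => (f x + g x) ^+ 2) =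
  I (fun x => f x ^+ 2) + 2 * I (fun x => f x * g x) + I (fun x => g x ^+ 2).
Proof.
move=> sf sg; have fg := sqint_integrableM sf sg.
have f2 := sqintP sf; have g2 := sqintP sg.
have fgi : mu.-integrable setT (fun x => (2 * (f x * g x))%:E).
  by under eq_fun do rewrite EFinM; exact: integrableZl.
rewrite -RintegralZl// -RintegralD// -RintegralD//.
  by apply: eq_Rintegral => x _; ring.
by apply: (integrableD measurableT f2 fgi).
Qed.

(** From (f + g)^2 >= 0 and (f - g)^2 >= 0. This additive form of Cauchy-Schwarz suffices, since
    both squared norms will be o(1 / r(n)). *)
Lemma Rintegral_prod_le f g : sqint f -> sqint g ->
  2 * `|I (fun x => f x * g x)| <= I (fun x => f x ^+ 2) + I (fun x => g x ^+ 2).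
Proof.
move=> sf sg.
have h1 := Rintegral_sqD sf sg; have h2 := Rintegral_sqD sf (sqintN sg).
have p1 : 0 <= I (fun x => (f x + g x) ^+ 2) by apply: Rintegral_ge0 => x _; exact: sqr_ge0.
have p2 : 0 <= I (fun x => (f x - g x) ^+ 2) by apply: Rintegral_ge0 => x _; exact: sqr_ge0.
have e1 : I (fun x => f x * - g x) = - I (fun x => f x * g x).
  rewrite -[RHS]mulN1r -RintegralZl//; last exact: sqint_integrableM.
  by apply: eq_Rintegral => x _; ring.
have e2 : I (fun x => (- g x) ^+ 2) = I (fun x => g x ^+ 2).
  by apply: eq_Rintegral => x _; ring.
by rewrite e1 e2 in h2; case: (ler0P (I (fun x => f x * g x))); lra.
Qed.

End square_integrable.

Section density_theory.
Context (R : realType) (d : nat) (X : set (Rd R d)) (mX : measurable X).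
Context (P0 : probability (Rd R d) R) (hP0 : model X P0).
Local Open Scope ereal_scope.

Local Notation lam := (leb R d).
Local Notation RN := (Radon_Nikodym (charge_of_finite_measure P0) lam).
Local Notation eta0 := (density P0).

Let P0lam : P0 `<< lam.
Proof. by case: hP0. Qed.

Let chlam : charge_of_finite_measure P0 `<< lam.
Proof. exact: P0lam. Qed.

Lemma densityE x : (eta0 x)%:E = RN x.
Proof. by rewrite /density fineK//; exact: Radon_Nikodym_fin_num. Qed.

Lemma measurable_density : measurable_fun setT eta0.
Proof.
apply/measurable_EFinP; rewrite (_ : EFin \o _ = RN).
  exact: measurable_int (Radon_Nikodym_integrable chlam).
by apply/funext => x /=; exact: densityE.
Qed.

Let PXC : P0 (~` X) = 0.
Proof. by case: hP0 => PX _; rewrite probability_setC// PX subee. Qed.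

Lemma P0_setIX A : measurable A -> P0 A = P0 (A `&` X).
Proof.
move=> mA; rewrite -[in LHS](setIT A) -(setUv X) setIUr measureU//.
- rewrite [X in _ + X](_ : _ = 0) ?adde0//.
  apply/eqP; rewrite eq_le measure_ge0 andbT -PXC; apply: le_measure; rewrite ?inE.
  + by apply: measurableI => //; exact: measurableC.
  + exact: measurableC.
  + by move=> ? [].
- exact: measurableI.
- by apply: measurableI => //; exact: measurableC.
- by rewrite setIACA setICr setI0.
Qed.

(** Turns P0 (f - g) into an inner product with the density, the link between the linear and the
    quadratic parts of the one-step functional. *)
Lemma mean_lebX (g : Rd R d -> R) : P0.-integrable setT (EFin \o g) ->
  (mean P0 g = \int[lebX mX]_x (eta0 x * g x))%R.
Proof.
move=> gi; have mg : measurable_fun setT g by move/measurable_int/measurable_EFinP : gi.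
rewrite /mean /Rintegral; congr fine.
rewrite integral_mrestr; last first.
  by apply/measurable_EFinP/measurable_funM => //; exact: measurable_density.
transitivity (\int[lam]_(x in X) ((EFin \o g) x * RN x)); last first.
  by apply: eq_integral => x _; rewrite -densityE -EFinM mulrC.
rewrite (@Radon_Nikodym_change_of_variables _ _ _ P0 lam)//; last first.
  exact: integrableS gi.
rewrite (@negligible_integral _ _ _ P0 setT (~` X))//; last exact: measurableC.
by rewrite setTD setCK.
Qed.

Variable M : R.
Hypotheses (M0 : (0 < M)%R) (hM : Linfnorm mX eta0 < M%:E).

Lemma density_bound : \forall x \ae lebX mX, (`|eta0 x| <= M)%R.
Proof.
move: hM; rewrite /Linfnorm unlock /Lnorm; case: ifPn => [_ h|].
  have := ess_sup_ge (lebX mX) (abse \o (EFin \o eta0)).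
  apply: filterS => x /= /le_trans/(_ (ltW h)).
  by rewrite lee_fin.
(* If [X] is Lebesgue-null, the norm is 0 by convention and the whole space is an exceptional
   set. *)
rewrite -leNgt => h _; exists setT; split => //.
by apply/eqP; rewrite eq_le h measure_ge0.
Qed.

Lemma P0_le_lebX A : measurable A -> P0 A <= M%:E * lebX mX A.
Proof.
move=> mA; rewrite P0_setIX//; have mAX : measurable (A `&` X) by exact: measurableI.
rewrite [leLHS](Radon_Nikodym_integral chlam mAX).
have mRN : measurable_fun setT RN by exact: measurable_int (Radon_Nikodym_integrable chlam).
have RNX : lam.-integrable (A `&` X) RN.
  exact: integrableS (Radon_Nikodym_integrable chlam).
apply: le_trans (lee_abs _) _; apply: le_trans (le_abse_integral _ _ _) _ => //.
  exact: measurable_funTS.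
rewrite [leRHS](_ : _ = \int[lam]_(x in A `&` X) (cst M%:E) x); last by rewrite integral_cst.
apply: ae_ge0_le_integral => //.
- by apply: measurableT_comp => //; exact: measurable_funTS.
- by move=> x _; rewrite lee_fin ltW.
have [N [mN N0 hN]] := density_bound; exists (N `&` X); split => //.
  exact: measurableI.
move=> x /= /not_implyP[[Ax Xx] nle]; split => //; apply: hN => /= le; apply: nle.
by rewrite -densityE lee_fin.
Qed.

(** Through this bound the L2(lambda) rates of the estimators become closeness in L2(P0), the gauge
    of the equicontinuity statements. *)
Lemma ge0_integral_P0_le (g : Rd R d -> \bar R) : measurable_fun setT g ->
  (forall x, 0 <= g x) -> \int[P0]_x g x <= M%:E * \int[lebX mX]_x g x.
Proof.
move=> mg g0.
have M0' : (0 <= M)%R by exact: ltW.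
pose m2 : {measure set (Rd R d) -> \bar R} := mscale (NngNum M0') (lebX mX).
apply: le_trans (ge0_le_measure_integral (m2 := m2) _ measurableT g0 mg) _.
  by move=> A mA; exact: P0_le_lebX.
by rewrite ge0_integral_mscale.
Qed.

Lemma density_sqint : sqint (lebX mX) eta0.
Proof.
split; first exact: measurable_density.
have mRN : measurable_fun setT (fun x => `|eta0 x|%:E).
  by apply/measurable_EFinP; apply: measurableT_comp => //; exact: measurable_density.
(* The square of the density is at most M times its absolute value, which is integrable. *)
apply: (@le_lt_trans _ _ (\int[lebX mX]_x (M%:E * `|eta0 x|%:E))).
  apply: ae_ge0_le_integral => //.
  - by move=> x _; rewrite lee_fin sqr_ge0.
  - by apply/measurable_EFinP/measurable_funX; exact: measurable_density.
  - by move=> x _; rewrite -EFinM lee_fin mulr_ge0// ltW.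
  - exact: measurable_funeM.
  apply: filterS density_bound => x h _; rewrite -EFinM lee_fin.
  by rewrite -real_normK ?num_real// expr2 ler_wpM2r.
rewrite ge0_integralZl//; last by rewrite lee_fin ltW.
rewrite lte_mul_pinfty ?lee_fin ?(ltW M0)//.
rewrite integral_mrestr//.
have := integrableS measurableT mX (@subsetT _ X) (Radon_Nikodym_integrable chlam).
move=> /integrableP[_]; apply: le_lt_trans.
by rewrite le_eqVlt; apply/orP; left; apply/eqP; apply: eq_integral => x _; rewrite -densityE.
Qed.

Lemma density_L2P0 : \int[P0]_x (eta0 x ^+ 2)%:E < +oo.
Proof.
have [mf f2] := density_sqint.
apply: le_lt_trans (ge0_integral_P0_le _ _) _.
- by apply/measurable_EFinP/measurable_funX.
- by move=> x; rewrite lee_fin sqr_ge0.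
by rewrite lte_mul_pinfty// lee_fin ltW.
Qed.

Lemma density_integrable : P0.-integrable setT (EFin \o eta0).
Proof.
have one : P0.-integrable setT (fun=> 1%:E : \bar R) by exact: finite_measure_integrable_cst.
have sq : P0.-integrable setT (fun x => (eta0 x ^+ 2)%:E).
  by apply: sqintP; split; [exact: measurable_density|exact: density_L2P0].
apply: le_integrable (integrableD measurableT one sq) => //.
  by apply/measurable_EFinP; exact: measurable_density.
move=> x _; rewrite /= lee_fin [X in (_ <= X)%R]ger0_norm ?addr_ge0 ?sqr_ge0//.
by case: (ler0P (eta0 x)) => _; have := sqr_ge0 (eta0 x - 1)%R;
  have := sqr_ge0 (eta0 x + 1)%R; rewrite !expr2; lra.
Qed.

End density_theory.

Section L2norm_theory.
Context (R : realType) (d : nat) (X : set (Rd R d)) (mX : measurable X).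
Local Open Scope ereal_scope.

Lemma L2normE (y : Rd R d -> R) :
  L2norm mX y = (\int[lebX mX]_x (y x ^+ 2)%:E) `^ (2^-1).
Proof.
rewrite /L2norm unlock /Lnorm; congr (_ `^ _); apply: eq_integral => x _.
by rewrite /= powR_mulrn// real_normK ?num_real.
Qed.

Lemma L2norm_lt (y : Rd R d -> R) (c : R) : (0 < c)%R ->
  (L2norm mX y < c%:E) = (\int[lebX mX]_x (y x ^+ 2)%:E < (c ^+ 2)%:E).
Proof.
move=> c0; rewrite L2normE.
have : 0 <= \int[lebX mX]_x (y x ^+ 2)%:E.
  by apply: integral_ge0 => x _; rewrite lee_fin sqr_ge0.
case: (\int[lebX mX]_x (y x ^+ 2)%:E) => [r||]//=; last by rewrite invr_eq0 pnatr_eq0.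
rewrite lee_fin => r0; rewrite !lte_fin.
rewrite powR12_sqrt//; rewrite -[c in LHS]gtr0_norm// -sqrtr_sqr ltr_sqrt// exprn_gt0//.
Qed.

End L2norm_theory.

(** * Events of small conditional probability *)

Section average.
Context (R : realType) (T : Type) (n : nat) (x : n.-tuple T).
Implicit Types A B : set (n.-tuple T).

Lemma avg_resample_ge0 A : 0 <= avg_resample R x A.
Proof. by rewrite divr_ge0 ?exprn_ge0// sumr_ge0. Qed.

Lemma le_avg_resample A B : A `<=` B -> avg_resample R x A <= avg_resample R x B.
Proof.
move=> AB; rewrite ler_wpM2r ?invr_ge0 ?exprn_ge0//; apply: ler_sum => i _.
by case: asboolP => // /AB ?; rewrite asboolT.
Qed.

Lemma avg_resampleU A B :
  avg_resample R x (A `|` B) <= avg_resample R x A + avg_resample R x B.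
Proof.
rewrite -mulrDl ler_wpM2r ?invr_ge0 ?exprn_ge0// -big_split/=.
apply: ler_sum => i _; case: asboolP => [[h|h]|_]; rewrite ?(asboolT h) -?natrD ?ler_nat//.
by rewrite leq_addl.
Qed.

Lemma avg_resample_setC A : (0 < n)%N -> avg_resample R x (~` A) = 1 - avg_resample R x A.
Proof.
move=> n0; have nR : n%:R ^+ n != 0 :> R by rewrite expf_neq0// pnatr_eq0 -lt0n.
apply/eqP; rewrite -subr_eq opprK addrC -mulrDl -big_split/=.
apply/eqP; rewrite (eq_bigr (fun=> 1)) => [|i _].
  by rewrite sumr_const card_ffun card_ord natrX mulfV.
by case: (asboolP (A (resample x i))) => h; case: asboolP => //; rewrite ?addr0 ?add0r.
Qed.

Lemma avg_resample_cst (P : Prop) (e : R) : 0 < e ->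
  e <= avg_resample R x [set _ | P] -> P.
Proof.
move=> e0 h; apply: contrapT => nP; move: h; rewrite leNgt => /negP; apply.
by rewrite /avg_resample big1 ?mul0r// => i _; rewrite asboolF.
Qed.

End average.

Section small_events.
Context (R : realType) (d : nat) (X : set (Rd R d)) (mX : measurable X).
Context (P0 : probability (Rd R d) R) (P0X : P0 X = 1%E).
Context (dW : nat -> measure_display) (W : forall n, measurableType (dW n)).
Context (Q : forall n, probability (W n) R).
Context (gamma : forall n, n.-tuple (Rd R d) -> W n -> Rd R d).
Hypothesis hgamma : empirical_bootstrap X Q gamma.

Definition smallP0 (A : forall n, set (n.-tuple (Rd R d))) :=
  forall e, 0 < e -> \forall n \near \oo, po P0 (A n) < e.

Definition smallPW (A : forall n, n.-tuple (Rd R d) -> set (n.-tuple (Rd R d))) :=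
  forall delta e, 0 < delta -> 0 < e ->
    \forall n \near \oo, po P0 [set x | delta <= avg_resample R x (A n x)] < e.

Lemma le_smallP0 (A B : forall n, set (n.-tuple (Rd R d))) :
  (forall n, (0 < n)%N -> A n `<=` B n) -> smallP0 B -> smallP0 A.
Proof.
move=> AB hB e e0; have [N _ hN] := hB e e0; exists (maxn N 1) => // n /=.
rewrite geq_max => /andP[Nn n0]; apply: le_lt_trans (hN n Nn).
by apply: le_po; exact: AB.
Qed.

Lemma le_smallPW (A B : forall n, n.-tuple (Rd R d) -> set (n.-tuple (Rd R d))) :
  (forall n x, (0 < n)%N -> A n x `<=` B n x) -> smallPW B -> smallPW A.
Proof.
move=> AB hB delta e d0 e0; have [N _ hN] := hB delta e d0 e0; exists (maxn N 1) => // n /=.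
rewrite geq_max => /andP[Nn n0]; apply: le_lt_trans (hN n Nn).
by apply: le_po => x /= /le_trans; apply; apply: le_avg_resample; exact: AB.
Qed.

Lemma smallPWU (A B : forall n, n.-tuple (Rd R d) -> set (n.-tuple (Rd R d))) :
  smallPW A -> smallPW B -> smallPW (fun n x => A n x `|` B n x).
Proof.
move=> hA hB delta e d0 e0.
have d2 : 0 < delta / 2 by rewrite divr_gt0.
have e2 : 0 < e / 2 by rewrite divr_gt0.
have [N1 _ h1] := hA _ _ d2 e2; have [N2 _ h2] := hB _ _ d2 e2.
exists (maxn N1 N2) => // n /=; rewrite geq_max => /andP[/h1 {}h1 /h2 {}h2].
rewrite [e]splitr; apply: le_lt_trans (ltrD h1 h2).
apply: le_trans (poU _ _ _); apply: le_po => x /= h.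
have := le_trans h (avg_resampleU R x (A n x) (B n x)).
have [|lt] := leP (delta / 2) (avg_resample R x (A n x)); first by left.
by right; rewrite /=; lra.
Qed.

Lemma smallPW_cst (A : forall n, set (n.-tuple (Rd R d))) :
  smallP0 A -> smallPW (fun n x => [set _ | A n x]).
Proof.
move=> hA delta e d0 e0; have [N _ hN] := hA e e0; exists N => // n Nn.
apply: le_lt_trans (hN n Nn); apply: le_po => x /=; exact: avg_resample_cst.
Qed.

Lemma PWouter_boot n (x : n.-tuple (Rd R d)) (B : set (n.-tuple (Rd R d))) :
  (0 < n)%N -> sample_in X x ->
  PWouter Q [set w | B (boot gamma x w)] = (avg_resample R x B)%:E.
Proof.
move=> n0 xX; have [mg gE] := hgamma n0 xX.
by rewrite /PWouter poE -(po_boot mg gE).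
Qed.

(** The bootstrap is specified only for n > 0 and samples in [X]. The size 0 is lost in the limit,
    and samples leaving [X] form a null set. *)
Lemma cvg_P0outerP (Z : forall n, n.-tuple (Rd R d) -> \bar R)
    (z : forall n, n.-tuple (Rd R d) -> R) l :
  (forall n x, (0 < n)%N -> sample_in X x -> Z n x = (z n x)%:E) ->
  cvg_P0outer P0 Z l <->
  (forall delta, 0 < delta -> smallP0 (fun n => [set x | delta <= `|z n x - l|])).
Proof.
move=> Zz; split=> h delta d0.
  have /po_cvg0P hd := h delta d0; move=> e /hd[N _ hN].
  exists (maxn N 1) => // n /=; rewrite geq_max => /andP[/hN /= {}hN n0].
  apply: le_lt_trans hN; rewrite -[leRHS]addr0 -(po_null n mX P0X).
  apply: le_trans (poU _ _ _); apply: le_po => x /= hx.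
  have [xX|] := pselect (sample_in X x); last by right.
  by left; rewrite /= Zz// -EFinB lee_fin.
apply/po_cvg0P => e /(h delta d0)[N _ hN].
exists (maxn N 1) => // n /=; rewrite geq_max => /andP[/hN /= {}hN n0].
apply: le_lt_trans hN; rewrite -[leRHS]addr0 -(po_null n mX P0X).
apply: le_trans (poU _ _ _); apply: le_po => x /= hx.
have [xX|] := pselect (sample_in X x); last by right.
by left; move: hx; rewrite /= Zz// -EFinB lee_fin.
Qed.

Lemma cvg_PWouterP (A : forall n, n.-tuple (Rd R d) -> set (n.-tuple (Rd R d))) l :
  cvg_P0outer P0 (fun n x => PWouter Q [set w | A n x (boot gamma x w)]) l <->
  (forall delta, 0 < delta -> smallP0 (fun n =>
     [set x | delta <= `|avg_resample R x (A n x) - l|])).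
Proof. by apply: cvg_P0outerP => n x n0 xX; exact: PWouter_boot. Qed.

Lemma cvg_PWouter0P (A : forall n, n.-tuple (Rd R d) -> set (n.-tuple (Rd R d))) :
  cvg_P0outer P0 (fun n x => PWouter Q [set w | A n x (boot gamma x w)]) 0 <-> smallPW A.
Proof.
rewrite cvg_PWouterP; split=> [h delta e d0 e0|h delta d0 e e0].
  have := h delta d0 e e0; apply: filterS => n; apply: le_lt_trans; apply: le_po => x /=.
  by rewrite subr0 ger0_norm// avg_resample_ge0.
have := h delta e d0 e0; apply: filterS => n; apply: le_lt_trans; apply: le_po => x /=.
by rewrite subr0 ger0_norm// avg_resample_ge0.
Qed.

(** An outer probability near 1 does not in general make the complement small. Here it is a finite
    average, additive on all sets. *)
Lemma cvg_PWouter1 (A : forall n, n.-tuple (Rd R d) -> set (n.-tuple (Rd R d))) :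
  cvg_P0outer P0 (fun n x => PWouter Q [set w | A n x (boot gamma x w)]) 1 ->
  smallPW (fun n x => ~` A n x).
Proof.
move=> /cvg_PWouterP h delta e d0 e0; have [N _ hN] := h delta d0 e e0.
exists (maxn N 1) => // n /=; rewrite geq_max => /andP[/hN {}hN n0].
apply: le_lt_trans hN; apply: le_po => x /=; rewrite avg_resample_setC// => hx.
by rewrite distrC (le_trans hx)// ler_norm.
Qed.

(** The exchange of indices and data: the outer probability over the data with fixed indices,
    averaged over the indices, controls the conditional probability given the data. *)
Lemma po_avg_resample n (A : n.-tuple (Rd R d) -> set (n.-tuple (Rd R d))) delta c :
  0 < delta -> (0 < n)%N ->
  \sum_(i : {ffun 'I_n -> 'I_n}) po P0 [set x | A x (resample x i)] <= c * n%:R ^+ n ->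
  po P0 [set x | delta <= avg_resample R x (A x)] <= c / delta.
Proof.
move=> d0 n0 h; have nR : 0 < n%:R ^+ n :> R by rewrite exprn_gt0// ltr0n.
have I0 : (0 < #|{: {ffun 'I_n -> 'I_n}}|)%N by rewrite card_ffun card_ord expn_gt0 n0.
have := po_markov_avg P0 (fun i : {ffun 'I_n -> 'I_n} => [set x | A x (resample x i)]) d0 I0.
rewrite card_ffun card_ord natrX => /(le_trans _) h2.
apply: (@le_trans _ _ (po P0 [set x | delta * n%:R ^+ n <=
    \sum_(i : {ffun 'I_n -> 'I_n}) (`[< A x (resample x i) >] : nat)%:R])).
  by apply: le_po => x /=; rewrite ler_pdivlMr.
apply: le_trans (h2 _ (lexx _)) _.
by rewrite ler_pdivrMr ?mulr_gt0// mulrA divfK ?gt_eqF.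
Qed.

End small_events.

(** * The one-step remainder *)

Section remainder.
Context (R : realType) (d : nat) (X : set (Rd R d)) (mX : measurable X).
Context (P0 : probability (Rd R d) R) (hP0 : model X P0).
Variables (M : R) (M0 : 0 < M) (hM : (Linfnorm mX (density P0) < M%:E)%E).

Local Notation eta0 := (density P0).
Local Notation I f := (\int[lebX mX]_y f y).
Local Notation tsum x f := (\sum_(k < _) f (tnth x k)).

Definition remainder (T : (Rd R d -> R) -> {measure set (Rd R d) -> \bar R} -> R)
    (f g : Rd R d -> R) n (xs x : n.-tuple (Rd R d)) : R :=
  T f (emp xs) - (T g (emp x)
    + (\int[emp xs]_y phi mX P0 y - \int[emp x]_y phi mX P0 y)).

Lemma remainder_T2 f g n (xs x : n.-tuple (Rd R d)) :
  remainder (T2 mX) f g xs x = remainder (T1 mX) f g xs x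
    + 2 * (I (fun y => f y ^+ 2) - \int[emp xs]_y f y)
    - 2 * (I (fun y => g y ^+ 2) - \int[emp x]_y g y).
Proof. by rewrite /remainder /T1 /T2; ring. Qed.

Lemma remainder_T3 f g n (xs x : n.-tuple (Rd R d)) :
  remainder (@T3 R d) f g xs x = remainder (T1 mX) f g xs x
    + (I (fun y => f y ^+ 2) - \int[emp xs]_y f y)
    - (I (fun y => g y ^+ 2) - \int[emp x]_y g y).
Proof. by rewrite /remainder /T1 /T3; ring. Qed.

Section expansion.
Variables (f g : Rd R d -> R) (n : nat) (xs x : n.-tuple (Rd R d)).
Hypotheses (n0 : (0 < n)%N).
Hypotheses (fi : P0.-integrable setT (EFin \o f)) (gi : P0.-integrable setT (EFin \o g)).
Hypotheses (sfg : sqint (lebX mX) (f \- g)) (sg : sqint (lebX mX) (g \- eta0)).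

Lemma remainder_T1 :
  remainder (T1 mX) f g xs x =
  2 / n%:R * ((tsum xs f - tsum x f) - (tsum xs eta0 - tsum x eta0))
  + 2 / n%:R * (csum (mean P0) x f - csum (mean P0) x g)
  - I (fun y => (f \- g) y ^+ 2) - 2 * I (fun y => (g \- eta0) y * (f \- g) y).
Proof.
have nR : n%:R != 0 :> R by rewrite pnatr_eq0 -lt0n.
have mf : measurable_fun setT f by move/measurable_int/measurable_EFinP : fi.
have mg : measurable_fun setT g by move/measurable_int/measurable_EFinP : gi.
have me := measurable_density hP0.
have s0 := density_sqint hP0 M0 hM.
have mphi : measurable_fun setT (phi mX P0).
  by apply: measurable_funB => //; exact: measurable_funM.
have ephi (t : n.-tuple (Rd R d)) : \int[emp t]_y phi mX P0 y =
    2 / n%:R * tsum t eta0 - 2 * psi mX P0.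
  rewrite Rintegral_emp// /phi sumrB -mulr_sumr sumr_const card_ord -(mulr_natr (2 * psi mX P0)).
  by field.
have sgi : sqint (lebX mX) g.
  have := sqintD sg s0; congr (sqint _ _); apply/funext => y /=; by rewrite subrK.
have F2 : I (fun y => f y ^+ 2) = I (fun y => g y ^+ 2)
    + 2 * I (fun y => g y * (f \- g) y) + I (fun y => (f \- g) y ^+ 2).
  rewrite -Rintegral_sqD//; congr fine; apply: eq_integral => y _ /=.
  by congr EFin; congr (_ ^+ _); rewrite /=; ring.
(* Splitting g into g - eta0 and eta0 turns the linear term into a cross integral and a mean under
   P0; the latter centers the sum over the data. *)
have gD : I (fun y => g y * (f \- g) y) =
    I (fun y => (g \- eta0) y * (f \- g) y) + (mean P0 f - mean P0 g).
  have -> : mean P0 f - mean P0 g = I (fun y => eta0 y * (f \- g) y).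
    rewrite -mean_lebX//; first by rewrite /mean -RintegralB.
    exact: integrableB fi gi.
  rewrite -RintegralD//; last 2 first.
    exact: sqint_integrableM.
    exact: sqint_integrableM.
  by congr fine; apply: eq_integral => y _; congr EFin; rewrite /=; ring.
rewrite /remainder /T1 !ephi !Rintegral_emp// F2 gD /csum !sumrB !sumr_const !card_ord.
rewrite -(mulr_natr (mean P0 f)) -(mulr_natr (mean P0 g)).
by field.
Qed.

(** Each of the two sums contributes 2 delta. Of the 3 k, one is the integral of (f - g)^2, and two
    bound twice the cross integral by [Rintegral_prod_le]. *)
Lemma remainder_T1_le delta k : 
  `|(tsum xs f - tsum x f) - (tsum xs eta0 - tsum x eta0)| <= delta * Num.sqrt n%:R ->
  `|csum (mean P0) x f - csum (mean P0) x g| <= delta * Num.sqrt n%:R ->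
  I (fun y => (f \- g) y ^+ 2) <= k / Num.sqrt n%:R ->
  I (fun y => (g \- eta0) y ^+ 2) <= k / Num.sqrt n%:R ->
  `|remainder (T1 mX) f g xs x| * Num.sqrt n%:R <= 4 * delta + 3 * k.
Proof.
move=> h1 h2 h3 h4; rewrite remainder_T1.
have := Rintegral_prod_le sg sfg.
have : 0 <= I (fun y => (f \- g) y ^+ 2) by apply: Rintegral_ge0 => y _; exact: sqr_ge0.
set A := (X in `|X| <= _) in h1; set B := (X in `|X| <= _) in h2.
move: h3 h4; set C := I (fun y => (f \- g) y ^+ 2); set D := I (fun y => (g \- eta0) y ^+ 2).
set E := I (fun y => (g \- eta0) y * (f \- g) y).
move: h1 h2; set s := Num.sqrt n%:R => h1 h2 h3 h4 C0 hE.
have s0 : 0 < s by rewrite sqrtr_gt0 ltr0n.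
have nE : n%:R = s ^+ 2 by rewrite sqr_sqrtr.
rewrite nE -ler_pdivlMr//.
apply: (@le_trans _ _ (2 / s ^+ 2 * `|A| + 2 / s ^+ 2 * `|B| + C + 2 * `|E|)).
  have p : 0 <= 2 / s ^+ 2 by rewrite divr_ge0// sqr_ge0.
  apply: le_trans (ler_normB _ _) _; rewrite normrM (ger0_norm (x := 2))// lerD2r.
  apply: le_trans (ler_normB _ _) _; rewrite (ger0_norm C0) lerD2r.
  by apply: le_trans (ler_normD _ _) _; rewrite (normrM _ A) (normrM _ B) (ger0_norm p).
have q (a : R) : `|a| <= delta * s -> 2 / s ^+ 2 * `|a| <= 2 * delta / s.
  move=> ha; apply: (@le_trans _ _ (2 / s ^+ 2 * (delta * s))).
    by rewrite ler_wpM2l// divr_ge0// sqr_ge0.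
  by rewrite le_eqVlt; apply/orP; left; apply/eqP; field; rewrite gt_eqF.
have := q _ h1; have := q _ h2.
have -> : (4 * delta + 3 * k) / s = 2 * delta / s + 2 * delta / s + 3 * (k / s).
  by field; rewrite gt_eqF.
move: hE h3 h4; set u := k / s; set v := 2 * delta / s.
set a := _ * `|A|; set b := _ * `|B|.
lra.
Qed.

End expansion.

End remainder.

Section bootstrap_one_step.
Context (R : realType) (d : nat) (X : set (Rd R d)) (mX : measurable X).
Context (P0 : probability (Rd R d) R) (hP0 : model X P0).
Variables (M : R) (M0 : 0 < M) (hM : (Linfnorm mX (density P0) < M%:E)%E).
Variables (F : set (Rd R d -> R)) (hF : Donsker X P0 F).

Local Notation eta0 := (density P0).
Local Notation I f := (\int[lebX mX]_y f y).
Local Notation tsum x f := (\sum_(k < _) f (tnth x k)).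
Local Notation rate n := (n%:R `^ (- 4^-1)).
Local Notation F0 := (F `|` [set eta0]).

Lemma rate_gt0 n : (0 < n)%N -> 0 < rate n :> R.
Proof. by move=> n0; rewrite powR_gt0// ltr0n. Qed.


Lemma powRN2V n : (n%:R `^ (- 2^-1))^-1 = Num.sqrt n%:R :> R.
Proof. by rewrite powRN invrK powR12_sqrt. Qed.

Lemma rate_sq n : rate n ^+ 2 = (Num.sqrt n%:R)^-1 :> R.
Proof.
rewrite -powR_mulrn ?powR_ge0// -powRrM -powR12_sqrt// -powRN; congr (_ `^ _); lra.
Qed.

Let density_int := density_integrable hP0 M0 hM.
Let density_L2 := density_L2P0 hP0 M0 hM.

Lemma L2norm_lt_rate (y : Rd R d -> R) kappa n : (0 < n)%N -> 0 < kappa ->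
  measurable_fun setT y -> (L2norm mX y < (kappa * rate n)%:E)%E ->
  [/\ sqint (lebX mX) y, I (fun a => y a ^+ 2) <= kappa ^+ 2 / Num.sqrt n%:R &
    (\int[P0]_a (y a ^+ 2)%:E <= (M * kappa ^+ 2)%:E)%E].
Proof.
move=> n0 k0 my; have r0 := rate_gt0 n0.
rewrite L2norm_lt ?mulr_gt0// exprMn rate_sq => h.
have h0 : (0 <= \int[lebX mX]_a (y a ^+ 2)%:E)%E.
  by apply: integral_ge0 => a _; rewrite lee_fin sqr_ge0.
have s : sqint (lebX mX) y by split=> //; exact: lt_trans h (ltry _).
split=> //.
  by rewrite -lee_fin /Rintegral fineK ?ge0_fin_numE// ?ltW//; case: s.
apply: le_trans (ge0_integral_P0_le hP0 M0 hM _ _) _.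
- exact/measurable_EFinP/measurable_funX.
- by move=> a; rewrite lee_fin sqr_ge0.
rewrite EFinM lee_wpmul2l ?lee_fin ?(ltW M0)//.
(* In L2(P0) the rate is given up, as 1 / r(n) <= 1: equicontinuity only asks for a fixed radius. *)
apply: le_trans (ltW h) _; rewrite lee_fin ler_piMr ?sqr_ge0//.
rewrite invf_le1 ?sqrtr_gt0 ?ltr0n// -[leLHS]sqrtr1 ler_sqrt ?ler1n//.
Qed.

Definition resample_osc osc t n (x : n.-tuple (Rd R d)) : set (n.-tuple (Rd R d)) :=
  [set xs | exists f g, [/\ F0 f, F0 g, (L2dist2 P0 f g < osc%:E)%E &
    t < `|(tsum xs f - tsum x f) - (tsum xs g - tsum x g)|]].

(** The same event from two sides: with the data fixed and the resample varying, and with the index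
    function fixed and the data varying. *)
Lemma resample_oscE osc t n (i : {ffun 'I_n -> 'I_n}) :
  [set x | resample_osc osc t x (resample x i)] = bootosc (L2dist2 P0) F0 osc i t.
Proof.
have E (x : n.-tuple (Rd R d)) f :
    tsum (resample x i) f - tsum x f = resample_diff x i f.
  by rewrite /resample_diff; congr (_ - _); apply: eq_bigr => l _; rewrite tnth_subt.
apply/seteqP; split=> x /= -[f [g [Ff Fg fg h]]]; exists f, g; split=> //.
  by rewrite -!E.
by rewrite !E.
Qed.

(** The resampled sum compares f with the density, not with g, which is why the density joins the
    class. Their squared distance, taken through g, is at most 2 M kappa^2 + 2 M kappa^2. *)
Lemma remainder_T1_lt f g n (xs x : n.-tuple (Rd R d)) delta kappa osc :
  (0 < n)%N -> 0 < kappa -> 4 * M * kappa ^+ 2 < osc -> F f -> F g ->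
  (L2norm mX (f \- g)%R < (kappa * rate n)%:E)%E ->
  (L2norm mX (g \- eta0)%R < (kappa * rate n)%:E)%E ->
  ~ bigosc (mean P0) (L2dist2 P0) F0 osc (delta * Num.sqrt n%:R) x ->
  ~ resample_osc osc (delta * Num.sqrt n%:R) x xs ->
  `|remainder mX P0 (T1 mX) f g xs x| * Num.sqrt n%:R <= 4 * delta + 3 * kappa ^+ 2.
Proof.
move=> n0 k0 hosc Ff Fg nfg ng hx hxs.
have Fi u : F u -> P0.-integrable setT (EFin \o u) by case: hF => + _; exact.
have Fm u : F u -> measurable_fun setT u by move=> /Fi /measurable_int /measurable_EFinP.
have me := measurable_density hP0.
have [|sfg lfg pfg] := L2norm_lt_rate n0 k0 _ nfg.
  by apply: measurable_funB; exact: Fm.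
have [|sg lg pg] := L2norm_lt_rate n0 k0 _ ng.
  by apply: measurable_funB => //; exact: Fm.
have Mk : 0 <= M * kappa ^+ 2 by rewrite mulr_ge0 ?sqr_ge0// ltW.
apply: (remainder_T1_le hP0 M0 hM n0 (Fi _ Ff) (Fi _ Fg) sfg sg) => //.
  rewrite leNgt; apply/negP => h; apply: hxs; exists f, eta0; split=> //.
  - by left.
  - by right.
  apply: le_lt_trans (L2dist2_triangle P0 (Fm _ Ff) (Fm _ Fg) me) _.
  apply: le_lt_trans (leeD (lee_wpmul2l _ pfg) (lee_wpmul2l _ pg)) _; rewrite ?lee_fin//.
  rewrite -!EFinM -EFinD lte_fin.
  by apply: le_lt_trans hosc; rewrite le_eqVlt; apply/orP; left; apply/eqP; ring.
rewrite leNgt; apply/negP => h; apply: hx; exists f, g; split=> //.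
- by left.
- by left.
apply: le_lt_trans pfg _; rewrite lte_fin.
by apply: le_lt_trans hosc; move: Mk; set u := M * _; rewrite -mulrA -/u; lra.
Qed.

Variables (eta : forall n, n.-tuple (Rd R d) -> Rd R d -> R)
  (etas : forall n, n.-tuple (Rd R d) -> n.-tuple (Rd R d) -> Rd R d -> R).
Hypotheses (hFeta : smallP0 P0 (fun n => [set x | ~ F (eta x)]))
  (hFetas : smallPW P0 (fun n x => ~` [set xs | F (etas x xs)])).
Hypotheses
  (heta : forall kappa, 0 < kappa -> smallP0 P0 (fun n =>
     [set x | ~ (L2norm mX (eta x \- eta0)%R < (kappa * rate n)%:E)%E]))
  (hetas : forall kappa, 0 < kappa -> smallPW P0 (fun n x =>
     [set xs | ~ (L2norm mX (etas x xs \- eta x)%R < (kappa * rate n)%:E)%E])).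

Lemma smallPW_remainder_T1 eps : 0 < eps ->
  smallPW P0 (fun n x => [set xs |
    eps <= `|remainder mX P0 (T1 mX) (etas x xs) (eta x) xs x| * Num.sqrt n%:R]).
Proof.
move=> eps0 delta e delta0 e0.
have ep : 0 < eps / 16 by lra.
have e8 : 0 < e / 8 by lra.
(* Markov's inequality at the conditional level delta / 2 turns this constant into e / 8. *)
have c0 : 0 < delta * e / 16 by rewrite divr_gt0// mulr_gt0.
have tF := donsker_tight hF density_int density_L2.
have eF := donsker_equicont hF density_int.
have [u1 [N1 [u10 h1]]] := eF _ _ ep e8.
have [u2 [N2 [u20 h2]]] := bootstrap_equicont tF eF ep c0.
pose osc := Num.min u1 u2; have o0 : 0 < osc by rewrite lt_min u10.
(* Chosen so that kappa^2 <= kappa <= eps / 16, whence 4 (eps / 16) + 3 kappa^2 < eps, and so that 4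
   M kappa^2 <= osc / 2. *)
pose kappa := Num.min 1 (Num.min (eps / 16) (osc / (8 * M))).
have k0 : 0 < kappa by rewrite !lt_min ltr01 ep divr_gt0 ?mulr_gt0.
have [k1 k2 k3] : [/\ kappa <= 1, kappa <= eps / 16 & kappa <= osc / (8 * M)].
  by split; rewrite !ge_min lexx ?orbT.
have ksq : kappa ^+ 2 <= kappa by rewrite expr2 ler_piMl// ltW.
have hosc : 4 * M * kappa ^+ 2 < osc.
  apply: (@le_lt_trans _ _ (4 * M * kappa)).
    by rewrite ler_wpM2l// mulr_ge0// ltW.
  apply: (@le_lt_trans _ _ (4 * M * (osc / (8 * M)))).
    by rewrite ler_wpM2l// mulr_ge0// ltW.
  have -> : 4 * M * (osc / (8 * M)) = osc / 2 by field; rewrite gt_eqF.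
  lra.
have bad := smallPWU (smallPWU hFetas (smallPW_cst hFeta))
  (smallPWU (hetas k0) (smallPW_cst (heta k0))).
have d2 : 0 < delta / 2 by rewrite divr_gt0.
have e2 : 0 < e / 2 by rewrite divr_gt0.
have [N3 _ h3] := bad _ _ d2 e2.
exists (maxn 1 (maxn N1 (maxn N2 N3))) => // n /=.
rewrite !geq_max => /and4P[n0 /h1{}h1 /h2{}h2 /h3/={}h3].
pose BAD (x : n.-tuple (Rd R d)) : set (n.-tuple (Rd R d)) :=
  (~` [set xs | F (etas x xs)] `|` [set _ | ~ F (eta x)]) `|`
  ([set xs | ~ (L2norm mX (etas x xs \- eta x)%R < (kappa * rate n)%:E)%E] `|`
   [set _ | ~ (L2norm mX (eta x \- eta0)%R < (kappa * rate n)%:E)%E]).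
set t := eps / 16 * Num.sqrt n%:R in h1 h2.
have h4 : po P0 [set x : n.-tuple (Rd R d) | delta / 2 <= avg_resample R x (resample_osc osc t x)] <= e / 8.
  have -> : e / 8 = (delta * e / 16) / (delta / 2) by field; rewrite gt_eqF.
  apply: (po_avg_resample (A := @resample_osc osc t n) d2 n0); apply: le_trans h2.
  apply: ler_sum => i _; rewrite resample_oscE; apply: le_po => x [f [g [Ff Fg fg h]]].
  exists f, g; split=> //; apply: lt_le_trans fg _.
  by rewrite lee_fin ge_min lexx orbT.
have h5 : po P0 (bigosc (mean P0) (L2dist2 P0) F0 osc (m := n) t) <= e / 8.
  apply: le_trans h1; apply: le_po => x [f [g [Ff Fg fg h]]].
  exists f, g; split=> //; apply: lt_le_trans fg _.
  by rewrite lee_fin ge_min lexx.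
apply: (@le_lt_trans _ _ (po P0 [set x : n.-tuple (Rd R d) | delta / 2 <= avg_resample R x (BAD x)] +
  (e / 8 + e / 8))); last by move: h3; rewrite -/BAD; lra.
apply: le_trans (lerD (lexx _) (lerD h5 h4)).
apply: le_trans (lerD (lexx _) (poU _ _ _)).
apply: le_trans (poU _ _ _); apply: le_po => x /= hx.
have [hb|/negP hb] := boolP (delta / 2 <= avg_resample R x (BAD x)); first by left.
have [ho|ho] := pselect (bigosc (mean P0) (L2dist2 P0) F0 osc t x); first by right; left.
right; right => /=.
suff : avg_resample R x [set xs |
    eps <= `|remainder mX P0 (T1 mX) (etas x xs) (eta x) xs x| * Num.sqrt n%:R] <=
    avg_resample R x (BAD x) + avg_resample R x (resample_osc osc t x).
  move=> /(le_trans hx); move: hb => /negP; rewrite -ltNge; lra.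
apply: le_trans (avg_resampleU _ _ _ _); apply: le_avg_resample => xs /= hxs.
have [hr|hr] := pselect (resample_osc osc t x xs); first by right.
left; apply: contrapT => /not_orP[/not_orP[/contrapT /= A1 /contrapT /= A2]].
move=> /not_orP[/contrapT /= A3 /contrapT /= A4].
have := remainder_T1_lt n0 k0 hosc A1 A2 A3 A4 ho hr.
lra.
Qed.

End bootstrap_one_step.

(** * Stochastic orders in terms of resampling averages *)

Section stochastic_order_real.
Context (R : realType) (d : nat) (X : set (Rd R d)) (mX : measurable X).
Context (P0 : probability (Rd R d) R) (P0X : P0 X = 1%E).
Context (dW : nat -> measure_display) (W : forall n, measurableType (dW n)).
Context (Q : forall n, probability (W n) R).
Context (gamma : forall n, n.-tuple (Rd R d) -> W n -> Rd R d).
Hypothesis hgamma : empirical_bootstrap X Q gamma.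

Local Notation rate n := (n%:R `^ (- 4^-1)).

Lemma oPW_sqrtP (y : forall n, n.-tuple (Rd R d) -> n.-tuple (Rd R d) -> R) :
  oPW P0 Q (fun n x w => (y n x (boot gamma x w))%:E) (fun n => n%:R `^ (- 2^-1)) <->
  (forall eps, 0 < eps ->
    smallPW P0 (fun n x => [set xs | eps <= `|y n x xs| * Num.sqrt n%:R])).
Proof.
have E n (x : n.-tuple (Rd R d)) eps : [set xs | eps%:E <=
    `|(y n x xs)%:E| * ((n%:R `^ (- 2^-1))^-1)%:E]%E =
    [set xs | eps <= `|y n x xs| * Num.sqrt n%:R].
  by apply/seteqP; split=> xs /=; rewrite powRN2V -abse_EFin -EFinM lee_fin.
split=> h eps /h.
  move=> /(cvg_PWouter0P mX P0X hgamma (fun n x =>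
    [set xs | eps%:E <= `|(y n x xs)%:E| * ((n%:R `^ (- 2^-1))^-1)%:E]%E)).
  by apply: le_smallPW => n x _; rewrite E.
move=> {}h; apply/(cvg_PWouter0P mX P0X hgamma (fun n x =>
    [set xs | eps%:E <= `|(y n x xs)%:E| * ((n%:R `^ (- 2^-1))^-1)%:E]%E)).
by apply: le_smallPW h => n x _; rewrite E.
Qed.

Lemma oP0_sqrtP (y : forall n, n.-tuple (Rd R d) -> R) :
  oP0 P0 (fun n x => (y n x)%:E) (fun n => n%:R `^ (- 2^-1)) ->
  forall eps, 0 < eps ->
    smallP0 P0 (fun n => [set x | eps <= `|y n x| * Num.sqrt n%:R]).
Proof.
move=> h eps eps0.
have E n (x : n.-tuple (Rd R d)) : (0 < n)%N -> sample_in X x ->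
    ((y n x)%:E * ((n%:R `^ (- 2^-1))^-1)%:E)%E = (y n x * Num.sqrt n%:R)%:E.
  by rewrite powRN2V EFinM.
have /(_ _ eps0) := (iffLR (cvg_P0outerP mX P0X 0 E)) h.
apply: le_smallP0 => n _ x /=.
by rewrite subr0 normrM (ger0_norm (sqrtr_ge0 _)).
Qed.

Let not_lt_rate n (l : \bar R) kappa : (0 < n)%N -> (0 <= l)%E ->
  ~ (l < (kappa * rate n)%:E)%E -> (kappa%:E <= `|l| * ((rate n)^-1)%:E)%E.
Proof.
move=> n0 l0 /negP; rewrite -leNgt => h; have r0 := @rate_gt0 R n n0.
rewrite gee0_abs//; have -> : kappa%:E = ((kappa * rate n)%:E * ((rate n)^-1)%:E)%E.
  by rewrite -EFinM mulfK ?gt_eqF.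
by rewrite lee_wpmul2r// lee_fin invr_ge0 ltW.
Qed.

Lemma oPW_rate (Y : forall n, n.-tuple (Rd R d) -> n.-tuple (Rd R d) -> \bar R) :
  (forall n x xs, 0 <= Y n x xs)%E ->
  oPW P0 Q (fun n x w => Y n x (boot gamma x w)) (fun n => rate n) ->
  forall kappa, 0 < kappa ->
    smallPW P0 (fun n x => [set xs | ~ (Y n x xs < (kappa * rate n)%:E)%E]).
Proof.
move=> Y0 h kappa /h /(cvg_PWouter0P mX P0X hgamma (fun n x =>
    [set xs | kappa%:E <= `|Y n x xs| * ((rate n)^-1)%:E]%E)).
by apply: le_smallPW => n x n0 xs /=; exact: not_lt_rate.
Qed.

Lemma rate_oPW (Y : forall n, n.-tuple (Rd R d) -> n.-tuple (Rd R d) -> \bar R) :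
  (forall n x xs, 0 <= Y n x xs)%E ->
  (forall kappa, 0 < kappa ->
    smallPW P0 (fun n x => [set xs | ~ (Y n x xs < (kappa * rate n)%:E)%E])) ->
  oPW P0 Q (fun n x w => Y n x (boot gamma x w)) (fun n => rate n).
Proof.
move=> Y0 h kappa kappa0; apply/(cvg_PWouter0P mX P0X hgamma (fun n x =>
    [set xs | kappa%:E <= `|Y n x xs| * ((rate n)^-1)%:E]%E)).
apply: le_smallPW (h _ kappa0) => n x n0 xs /=; rewrite gee0_abs// => hk; apply/negP.
have r0 := @rate_gt0 R n n0; rewrite -leNgt.
have -> : Y n x xs = (Y n x xs * ((rate n)^-1)%:E * (rate n)%:E)%E.
  by rewrite -muleA -EFinM mulVf ?mule1// gt_eqF.
by rewrite EFinM lee_wpmul2r// lee_fin ltW.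
Qed.

Lemma oP0_rate (Y : forall n, n.-tuple (Rd R d) -> \bar R) :
  (forall n x, 0 <= Y n x)%E -> oP0 P0 Y (fun n => rate n) ->
  forall kappa, 0 < kappa ->
    smallP0 P0 (fun n => [set x | ~ (Y n x < (kappa * rate n)%:E)%E]).
Proof.
move=> Y0 h kappa kappa0; have /po_cvg0P := h kappa kappa0.
apply: le_smallP0 => n n0 x /=; rewrite sube0 abseM.
move=> /(not_lt_rate n0 (Y0 _ _)) /le_trans; apply.
by rewrite lee_wpmul2l// lee_abs.
Qed.

(** Transfers the one-step expansion to the other two estimators: c = 2 for the plug-in, c = 1 for
    the empirical mean plug-in. *)
Lemma smallPW_perturb (y ys : forall n, n.-tuple (Rd R d) -> n.-tuple (Rd R d) -> R)
    (z : forall n, n.-tuple (Rd R d) -> R) c :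
  (forall eps, 0 < eps ->
    smallPW P0 (fun n x => [set xs | eps <= `|y n x xs| * Num.sqrt n%:R])) ->
  (forall eps, 0 < eps ->
    smallPW P0 (fun n x => [set xs | eps <= `|ys n x xs| * Num.sqrt n%:R])) ->
  (forall eps, 0 < eps ->
    smallP0 P0 (fun n => [set x | eps <= `|z n x| * Num.sqrt n%:R])) ->
  0 < c ->
  forall eps, 0 < eps -> smallPW P0 (fun n x => [set xs |
    eps <= `|y n x xs + c * ys n x xs - c * z n x| * Num.sqrt n%:R]).
Proof.
move=> hy hys hz c0 eps eps0; have e3 : 0 < eps / 3 by rewrite divr_gt0.
have ec : 0 < eps / 3 / c by rewrite divr_gt0.
have := smallPWU (hy _ e3) (smallPWU (hys _ ec) (smallPW_cst (hz _ ec))).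
apply: le_smallPW => n x n0 xs /= h; apply: contrapT => /not_orP[/negP].
rewrite -ltNge => h1 /not_orP[/negP + /negP]; rewrite -!ltNge !ltr_pdivlMr// => h2 h3.
move: h; apply/negP; rewrite -ltNge.
apply: (@le_lt_trans _ _ (`|y n x xs| * Num.sqrt n%:R + `|ys n x xs| * Num.sqrt n%:R * c
  + `|z n x| * Num.sqrt n%:R * c)); last by lra.
rewrite ![_ * Num.sqrt _ * c]mulrAC -!mulrDl ler_wpM2r ?sqrtr_ge0//.
apply: le_trans (ler_normB _ _) _; rewrite [`|c * z n x|]normrM (gtr0_norm c0) [c * `|_|]mulrC lerD2r.
by apply: le_trans (ler_normD _ _) _; rewrite [`|c * _|]normrM (gtr0_norm c0) [c * `|_|]mulrC.
Qed.

End stochastic_order_real.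

Lemma L2norm_ge0 (R : realType) d (X : set (Rd R d)) (mX : measurable X) f :
  (0 <= L2norm mX f)%E.
Proof. exact: Lnorm_ge0. Qed.

(** * Kernel density estimators *)

Section affine.
Context (R : realType).

Definition affine_inv (a h : R) : measurableTypeR R -> measurableTypeR R :=
  fun y => (y - a) / h.

Lemma measurable_affine_inv a h : measurable_fun setT (affine_inv a h).
Proof. by apply: measurable_funM => //; exact: measurable_funB. Qed.

HB.instance Definition _ a h :=
  isMeasurableFun.Build _ _ _ _ (affine_inv a h) (measurable_affine_inv a h).

Lemma lebesgue_measure_affine_inv a h (A : set (measurableTypeR R)) : 0 < h -> measurable A ->
  ((h^-1)%:E * lebesgue_measure (affine_inv a h @^-1` A) = lebesgue_measure A)%E.
Proof.
move=> h0 mA; have hV : 0 <= h^-1 by rewrite invr_ge0 ltW.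
have := @lebesgue_measure_unique R (mscale (NngNum hV) (pushforward lebesgue_measure (affine_inv a h))).
move=> /(_ (measurable_affine_inv a h)) mE; apply/esym/mE => //= _ [[b c]] _ <- /=; rewrite /mscale/= /pushforward.
have -> : affine_inv a h @^-1` `]b, c]%classic = `](h * b + a), (h * c + a)]%classic.
  apply/seteqP; split=> y; rewrite /affine_inv/= !in_itv/= ltr_pdivlMr// ler_pdivrMr//.
    by move=> /andP[? ?]; apply/andP; split; lra.
  by move=> /andP[? ?]; apply/andP; split; lra.
rewrite !lebesgue_measure_itv/= !lte_fin ltrD2r ltr_pM2l//.
case: ifP => _; last by rewrite mule0.
by rewrite -!EFinB -EFinM; congr EFin; field; rewrite gt_eqF.
Qed.

Variable d : nat.

Definition affine_invd (a : Rd R d) (h : R) (y : Rd R d) : Rd R d :=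
  [tuple affine_inv (tnth a j) h (tnth y j) | j < d].

Lemma measurable_affine_invd a h : measurable_fun setT (affine_invd a h).
Proof.
apply/measurable_fun_tnthP => j.
rewrite (_ : _ \o _ = affine_inv (tnth a j) h \o (fun y : Rd R d => tnth y j)).
  apply: measurableT_comp; [exact: measurable_affine_inv|exact: measurable_tnth].
by apply/funext => y /=; rewrite tnth_mktuple.
Qed.

HB.instance Definition _ a h :=
  isMeasurableFun.Build _ _ _ _ (affine_invd a h) (measurable_affine_invd a h).

(** The map acts coordinatewise, so boxes pull back to boxes, and each of the d factors contributes
    one h^-1. *)
Lemma leb_affine_invd a h (A : set (Rd R d)) : 0 < h -> measurable A ->
  ((h ^- d)%:E * leb R d (affine_invd a h @^-1` A) = leb R d A)%E.
Proof.
move=> h0 mA; have hV : 0 <= h ^- d by rewrite invr_ge0 exprn_ge0// ltW.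
have := @box_unique _ _ _ (@lebesgue_measure R) d
  (mscale (NngNum hV) (pushforward (leb R d) (affine_invd a h))).
move=> /(_ (measurable_affine_invd a h)) mE; apply/mE => //= B mB; rewrite /mscale/= /pushforward.
have -> : affine_invd a h @^-1` box B = box (fun j => affine_inv (tnth a j) h @^-1` B j).
  by apply/seteqP; split=> y /= yB j; have := yB j; rewrite /= ?tnth_mktuple.
have mC j : measurable (affine_inv (tnth a j) h @^-1` B j).
  by rewrite -[X in measurable X]setTI; apply: measurable_affine_inv.
rewrite power_measureE// [RHS](eq_bigr (fun j => (h^-1)%:E * 
   lebesgue_measure (affine_inv (tnth a j) h @^-1` B j))%E); last first.
  by move=> j _; rewrite lebesgue_measure_affine_inv.
rewrite big_split/=; congr (_ * _)%E.
by rewrite prodEFin prodr_const card_ord exprVn.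
Qed.

Lemma ge0_integral_affine_invd a h (f : Rd R d -> \bar R) : 0 < h ->
  measurable_fun setT f -> (forall y, 0 <= f y)%E ->
  ((h ^- d)%:E * \int[leb R d]_y f (affine_invd a h y) = \int[leb R d]_y f y)%E.
Proof.
move=> h0 mf f0; have hV : 0 <= h ^- d by rewrite invr_ge0 exprn_ge0// ltW.
have mE A : measurable A -> mscale (NngNum hV) (leb R d) (affine_invd a h @^-1` A) = leb R d A.
  by move=> mA; rewrite -(leb_affine_invd a h0 mA).
rewrite -(ge0_integral_map (measurable_affine_invd a h) mE mf f0) ge0_integral_mscale//.
by apply: measurableT_comp => //; exact: measurable_affine_invd.
Qed.

End affine.

Section kde_resample.
Context (R : realType) (d : nat) (X : set (Rd R d)) (mX : measurable X).
Variables (K : Rd R d -> R) (hK : is_kernel K).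

Local Notation S := (\int[leb R d]_x K x ^+ 2).
Local Notation bump h a y := (h ^- d * K (affine_invd a h y)).

Let mK : measurable_fun setT K.
Proof. by case: hK => _ /measurable_int /measurable_EFinP. Qed.

Let mbump h a : measurable_fun setT (fun y => bump h a y).
Proof.
by apply: measurable_funM => //; exact: measurableT_comp.
Qed.

Lemma kdeE h n (x : n.-tuple (Rd R d)) y :
  kde K h x y = n%:R^-1 * \sum_(k < n) bump h (tnth x k) y.
Proof. by []. Qed.

Lemma measurable_kde h n (x : n.-tuple (Rd R d)) : measurable_fun setT (kde K h x).
Proof. by apply: measurable_funM => //; apply: measurable_sum => k; exact: mbump. Qed.

Lemma sq_kernelE : (\int[leb R d]_y (K y ^+ 2)%:E = S%:E)%E.
Proof.
by case: hK => _ _ _ h; rewrite /Rintegral fineK//; exact: integrable_fin_num.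
Qed.

Lemma kernel_sq_ge0 : 0 <= S.
Proof. by apply: Rintegral_ge0 => y _; exact: sqr_ge0. Qed.

Lemma integral_bump_sq h a : 0 < h ->
  (\int[leb R d]_y (bump h a y ^+ 2)%:E = (h ^- d * S)%:E)%E.
Proof.
move=> h0; have hV : 0 <= h ^- d by rewrite invr_ge0 exprn_ge0// ltW.
have mK2 : measurable_fun setT (fun y => (K y ^+ 2)%:E) by exact/measurable_EFinP/measurable_funX.
rewrite EFinM -sq_kernelE -(ge0_integral_affine_invd a h0 mK2); last first.
  by move=> y; rewrite lee_fin sqr_ge0.
have mKa : measurable_fun setT (fun y => (K (affine_invd a h y) ^+ 2)%:E).
  by apply/measurable_EFinP/measurable_funX; exact: measurableT_comp.
rewrite muleA -EFinM -(ge0_integralZl _ measurableT mKa)//; last 2 first.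
- by move=> y _; rewrite lee_fin sqr_ge0.
- by rewrite lee_fin mulr_ge0.
by apply: eq_integral => y _; rewrite -EFinM exprMn expr2.
Qed.

(** At a fixed point y the difference is a centered resampled sum, whose mean square is known
    exactly; the bound drops the square of the mean of the bumps. *)
Lemma sum_kde_resample_sq h n (x : n.-tuple (Rd R d)) y : (0 < n)%N ->
  \sum_(i : {ffun 'I_n -> 'I_n}) (kde K h (resample x i) y - kde K h x y) ^+ 2 <=
  n%:R ^+ n / n%:R ^+ 2 * \sum_(k < n) bump h (tnth x k) y ^+ 2.
Proof.
move=> n0; have nR : n%:R != 0 :> R by rewrite pnatr_eq0 -lt0n.
pose u k := bump h (tnth x k) y; pose m := n%:R^-1 * \sum_k u k.
have m0 : \sum_k (u k - m) = 0.
  by rewrite sumrB sumr_const card_ord -(mulr_natr m) /m; field.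
have E i : kde K h (resample x i) y - kde K h x y = n%:R^-1 * \sum_l (u (i l) - m).
  rewrite !kdeE -/m sumrB mulrBr sumr_const card_ord -(mulr_natr m).
  have -> : n%:R^-1 * (m * n%:R) = m by field.
  by congr (_ * _ - _); apply: eq_bigr => l _; rewrite tnth_subt.
under eq_bigr do rewrite E exprMn.
rewrite -mulr_sumr (sum_centered_resample_sq m0) -[(_ * _) *+ n]mulr_natr.
have -> : n%:R^-1 ^+ 2 * (n%:R ^+ n.-1 * (\sum_k (u k - m) ^+ 2) * n%:R) =
    n%:R ^+ n / n%:R ^+ 2 * \sum_k (u k - m) ^+ 2.
  have -> : n%:R ^+ n = n%:R * n%:R ^+ n.-1 :> R by rewrite -exprS prednK.
  by field.
rewrite ler_wpM2l ?divr_ge0 ?exprn_ge0//.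
have -> : \sum_k (u k - m) ^+ 2 = \sum_k u k ^+ 2 - n%:R * m ^+ 2.
  transitivity (\sum_k (u k ^+ 2 - 2 * m * u k + m ^+ 2)).
    by apply: eq_bigr => k _; ring.
  rewrite big_split sumrB -mulr_sumr sumr_const card_ord -(mulr_natr (m ^+ 2))/=.
  have -> : \sum_k u k = n%:R * m by rewrite /m mulrA mulfV// mul1r.
  by ring.
by rewrite gerDl oppr_le0 mulr_ge0 ?sqr_ge0.
Qed.

Lemma integral_kde_resample_sq h n (x : n.-tuple (Rd R d)) : 0 < h -> (0 < n)%N ->
  (\sum_(i : {ffun 'I_n -> 'I_n})
    \int[lebX mX]_y ((kde K h (resample x i) y - kde K h x y) ^+ 2)%:E <=
   (n%:R ^+ n * (S / (n%:R * h ^+ d)))%:E)%E.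
Proof.
move=> h0 n0; have nR : n%:R != 0 :> R by rewrite pnatr_eq0 -lt0n.
have mD i : measurable_fun setT (fun y => ((kde K h (resample x i) y - kde K h x y) ^+ 2)%:E).
  by apply/measurable_EFinP/measurable_funX/measurable_funB; exact: measurable_kde.
rewrite -ge0_integral_sum//; last by move=> i y _; rewrite lee_fin sqr_ge0.
set c := n%:R ^+ n / n%:R ^+ 2 : R; have c0 : 0 <= c by rewrite divr_ge0 ?exprn_ge0.
have mb k : measurable_fun setT (fun y => (bump h (tnth x k) y ^+ 2)%:E).
  exact/measurable_EFinP/measurable_funX.
have mB : measurable_fun setT (fun y => (c%:E * \sum_(k < n) (bump h (tnth x k) y ^+ 2)%:E)%E).
  by apply: emeasurable_funM => //; exact: emeasurable_sum.
have B0 y : (0 <= c%:E * \sum_(k < n) (bump h (tnth x k) y ^+ 2)%:E)%E.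
  by rewrite mule_ge0 ?lee_fin// sume_ge0// => k _; rewrite lee_fin sqr_ge0.
apply: (@le_trans _ _ (\int[lebX mX]_y (c%:E * \sum_(k < n) (bump h (tnth x k) y ^+ 2)%:E)%E)%E).
  apply: ge0_le_integral => //.
  - by move=> y _; rewrite sume_ge0// => i _; rewrite lee_fin sqr_ge0.
  - exact: emeasurable_sum.
  - by move=> y _; rewrite !sumEFin -EFinM lee_fin; exact: sum_kde_resample_sq.
rewrite ge0_integral_mrestr//.
(* Enlarging [X] to the whole space makes the integral of each squared bump independent of its
   center. *)
apply: (@le_trans _ _ (\int[leb R d]_y (c%:E * \sum_(k < n) (bump h (tnth x k) y ^+ 2)%:E)%E)%E).
  exact: ge0_subset_integral.
rewrite ge0_integralZl//; last 2 first.
- exact: emeasurable_sum.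
- by move=> y _; rewrite sume_ge0// => k _; rewrite lee_fin sqr_ge0.
rewrite ge0_integral_sum//; last by move=> k y _; rewrite lee_fin sqr_ge0.
rewrite (eq_bigr (fun=> (h ^- d * S)%:E)); last by move=> k _; rewrite integral_bump_sq.
rewrite sumEFin sumr_const card_ord -[(_ * S) *+ n]mulr_natr -EFinM lee_fin /c.
rewrite le_eqVlt; apply/orP; left; apply/eqP; field.
by rewrite nR expf_neq0// gt_eqF.
Qed.

(** Markov's inequality for the squared norm. The bound is the same for every sample [x]. *)
Lemma avg_resample_kde h n (x : n.-tuple (Rd R d)) r : 0 < h -> (0 < n)%N -> 0 < r ->
  avg_resample R x [set xs | ~ (L2norm mX (kde K h xs \- kde K h x)%R < r%:E)%E] <=
  S / (n%:R * h ^+ d * r ^+ 2).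
Proof.
move=> h0 n0 r0; have nR : 0 < n%:R ^+ n :> R by rewrite exprn_gt0// ltr0n.
have r2 : 0 < r ^+ 2 by rewrite exprn_gt0.
have hd : 0 < n%:R * h ^+ d by rewrite mulr_gt0 ?exprn_gt0// ltr0n.
rewrite ler_pdivrMr// -(ler_pM2r r2).
have -> : S / (n%:R * h ^+ d * r ^+ 2) * n%:R ^+ n * r ^+ 2 = n%:R ^+ n * (S / (n%:R * h ^+ d)).
  by field; rewrite ?gt_eqF ?exprn_gt0// ltr0n.
rewrite -lee_fin; apply: le_trans (integral_kde_resample_sq x h0 n0).
rewrite mulr_suml -sumEFin; apply: lee_sum => i _.
case: asboolP => [/= /negP|_]; last first.
  by rewrite mul0r integral_ge0// => y _; rewrite lee_fin sqr_ge0.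
by rewrite L2norm_lt// -leNgt mul1r.
Qed.

End kde_resample.

Section kde_small.
Context (R : realType) (d : nat) (d0 : (0 < d)%N) (X : set (Rd R d)) (mX : measurable X).
Variables (P0 : probability (Rd R d) R).
Variables (K : Rd R d -> R) (hK : is_kernel K) (h : nat -> R).
Hypotheses (h0 : forall n, 0 < h n) (hh : prec (fun n => n%:R `^ (- (2 * d%:R)^-1)) h).

Local Notation rate n := (n%:R `^ (- 4^-1)).
Local Notation S := (\int[leb R d]_x K x ^+ 2).

(** With u the ratio of n^(-1 / (2 d)) to the bandwidth, the quantity is u^d, and u^d <= u once u <=
    1 because d > 0. *)
Lemma bandwidth_eventually e : 0 < e ->
  \forall n \near \oo, (Num.sqrt n%:R * h n ^+ d)^-1 < e.
Proof.
move=> e0; pose e' := Num.min 1 e; have e'0 : 0 < e' by rewrite lt_min ltr01.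
have := hh; rewrite /prec => /cvgrPdist_lt/(_ _ e'0)[N _ hN].
exists N => // n /hN /=; rewrite sub0r normrN; set u := _ / h n.
have u0 : 0 <= u by rewrite divr_ge0 ?powR_ge0// ltW.
rewrite (ger0_norm u0) lt_min => /andP[u1 ue].
have dR : d%:R != 0 :> R by rewrite pnatr_eq0 -lt0n.
have -> : (Num.sqrt n%:R * h n ^+ d)^-1 = u ^+ d.
  rewrite exprMn exprVn -[in RHS]powR_mulrn ?powR_ge0// -powRrM.
  rewrite (_ : - _ * _ = - 2^-1); last by field.
  by rewrite powRN powR12_sqrt// invfM.
apply: le_lt_trans ue; rewrite -(prednK d0) exprS ler_piMr// exprn_ile1// ltW//.
Qed.

Lemma smallPW_kde kappa : 0 < kappa -> smallPW P0 (fun n x =>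
  [set xs | ~ (L2norm mX (kde K (h n) xs \- kde K (h n) x)%R < (kappa * rate n)%:E)%E]).
Proof.
move=> k0 delta e delta0 e0.
have S0 : 0 <= S by exact: kernel_sq_ge0.
have S1 : 0 < S + 1 by rewrite ltr_wpDl.
have c0 : 0 < delta * kappa ^+ 2 / (S + 1) by rewrite divr_gt0// mulr_gt0// exprn_gt0.
have [N _ hN] := bandwidth_eventually c0.
exists (maxn 1 N) => // n /=; rewrite geq_max => /andP[n0 /hN /= {}hN].
(* As the bound is uniform in the data, the event is empty for large n. *)
rewrite [X in po _ X](_ : _ = set0) ?po0// -subset0 => x /=; apply/negP; rewrite -ltNge.
have r0 := @rate_gt0 R n n0; have kr : 0 < kappa * rate n by rewrite mulr_gt0.
apply: le_lt_trans (avg_resample_kde mX hK x (h0 n) n0 kr) _.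
have s0 : 0 < Num.sqrt n%:R :> R by rewrite sqrtr_gt0 ltr0n.
have q0 : 0 < h n ^+ d by rewrite exprn_gt0.
have k2 : 0 < kappa ^+ 2 by rewrite exprn_gt0.
rewrite exprMn rate_sq.
have -> : S / (n%:R * h n ^+ d * (kappa ^+ 2 / Num.sqrt n%:R)) =
    S * (Num.sqrt n%:R * h n ^+ d)^-1 / kappa ^+ 2.
  rewrite -{1}(sqr_sqrtr (ler0n R n)); field; rewrite !gt_eqF//.
rewrite ltr_pdivrMr//.
apply: (@le_lt_trans _ _ ((S + 1) * (Num.sqrt n%:R * h n ^+ d)^-1)).
  by rewrite ler_wpM2r ?lerDl// invr_ge0 mulr_ge0// ltW.
by rewrite mulrC -ltr_pdivlMr.
Qed.

End kde_small.

Theorem proposition5p2 (R : realType) (d : nat) (hd : (0 < d)%N)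
  (X : set (Rd R d)) (mX : measurable X)
  (P0 : probability (Rd R d) R) (hP0 : model X P0)
  (dW : nat -> measure_display) (W : forall n, measurableType (dW n))
  (Q : forall n, probability (W n) R)
  (gamma : forall n, n.-tuple (Rd R d) -> W n -> Rd R d)
  (hgamma : empirical_bootstrap X Q gamma)
  (eta : forall n, n.-tuple (Rd R d) -> Rd R d -> R)
  (etas : forall n, n.-tuple (Rd R d) -> n.-tuple (Rd R d) -> Rd R d -> R) :
  (* eta n x is the estimator from the data x; etas n x (boot gamma x w) the
     one from the data and the bootstrap sample *)
  (forall (F : set (Rd R d -> R)) (M : R),
     Donsker X P0 F ->
     P0outer P0 [set x | ~ F (eta n x)] @[n --> \oo] --> 0%E ->
     0 < M ->
     (Linfnorm mX (density P0) < M%:E)%E ->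
     P0outer P0 [set x | ~ (Linfnorm mX (eta n x) < M%:E)%E]
       @[n --> \oo] --> 0%E ->
     oP0 P0 (fun n x => L2norm mX (eta n x \- density P0))
       (fun n => n%:R `^ (- 4^-1)) ->
     cvg_P0outer P0
       (fun n x => PWouter Q [set w | F (etas n x (boot gamma x w))]) 1 ->
     oP0 P0
       (fun n x => PWouter Q
          [set w | (M%:E <= Linfnorm mX (etas n x (boot gamma x w)))%E])
       (fun=> 1) ->
     oPW P0 Q
       (fun n x w => L2norm mX (etas n x (boot gamma x w) \- eta n x))
       (fun n => n%:R `^ (- 4^-1)) ->
     let remainder T n (x : n.-tuple (Rd R d)) (w : n.-tuple (W n)) :=
       (T (etas n x (boot gamma x w)) (emp (boot gamma x w))
        - (T (eta n x) (emp x)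
           + (\int[emp (boot gamma x w)]_y phi mX P0 y
              - \int[emp x]_y phi mX P0 y)))%:E in
     oPW P0 Q (remainder (T1 mX)) (fun n => n%:R `^ (- 2^-1)) /\
     (oP0 P0
        (fun n x => ((\int[lebX mX]_y eta n x y ^+ 2)
                     - \int[emp x]_y eta n x y)%:E)
        (fun n => n%:R `^ (- 2^-1)) ->
      oPW P0 Q
        (fun n x w =>
           ((\int[lebX mX]_y etas n x (boot gamma x w) y ^+ 2)
            - \int[emp (boot gamma x w)]_y etas n x (boot gamma x w) y)%:E)
        (fun n => n%:R `^ (- 2^-1)) ->
      oPW P0 Q (remainder (T2 mX)) (fun n => n%:R `^ (- 2^-1)) /\
      oPW P0 Q (remainder (@T3 R d)) (fun n => n%:R `^ (- 2^-1)))) /\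
  (forall (K : Rd R d -> R) (h : nat -> R),
     is_kernel K ->
     (forall n, 0 < h n) ->
     prec (fun n => n%:R `^ (- (2 * d%:R)^-1)) h ->
     (forall n x, eta n x = kde K (h n) x) ->
     (forall n x xs, etas n x xs = kde K (h n) xs) ->
     oPW P0 Q
       (fun n x w => L2norm mX (etas n x (boot gamma x w) \- eta n x))
       (fun n => n%:R `^ (- 4^-1))).
Proof.
have P0X : P0 X = 1%E by case: hP0.
split; last first.
  move=> K h hK h0 hh Eeta Eetas; apply: (rate_oPW mX P0X hgamma
      (Y := fun n x xs => L2norm mX (etas n x xs \- eta n x))) => [n x xs|kappa k0].
    exact: L2norm_ge0.
  have hk := smallPW_kde hd mX P0 hK h0 hh k0.
  by apply: le_smallPW hk => n x n0 xs /=; rewrite Eeta Eetas.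
move=> F M hF hFeta M0 hM _ heta hFetas _ hetas remainder'.
have {}hFeta : smallP0 P0 (fun n => [set x | ~ F (eta n x)]) by apply/po_cvg0P.
have {}hFetas := cvg_PWouter1 mX P0X hgamma (A := fun n x => [set xs | F (etas n x xs)]) hFetas.
have {}heta := oP0_rate (Y := fun n x => L2norm mX (eta n x \- density P0))
  (fun n x => L2norm_ge0 mX _) heta.
have {}hetas := oPW_rate mX P0X hgamma (Y := fun n x xs => L2norm mX (etas n x xs \- eta n x))
  (fun n x xs => L2norm_ge0 mX _) hetas.
have h1 := smallPW_remainder_T1 hP0 M0 hM hF hFeta hFetas heta hetas.
split; first by apply/(oPW_sqrtP mX P0X hgamma
  (fun n x xs => remainder mX P0 (T1 mX) (etas n x xs) (eta n x) xs x)).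
move=> /(oP0_sqrtP mX P0X) hr /(oPW_sqrtP mX P0X hgamma (fun n x xs =>
  (\int[lebX mX]_y etas n x xs y ^+ 2) - \int[emp xs]_y etas n x xs y)) hrs.
split.
  apply/(oPW_sqrtP mX P0X hgamma
    (fun n x xs => remainder mX P0 (T2 mX) (etas n x xs) (eta n x) xs x)) => eps eps0.
  apply: le_smallPW (smallPW_perturb h1 hrs hr (c := 2) _ eps0) => // n x n0 xs /=.
  by rewrite remainder_T2.
apply/(oPW_sqrtP mX P0X hgamma
  (fun n x xs => remainder mX P0 (@T3 R d) (etas n x xs) (eta n x) xs x)) => eps eps0.
apply: le_smallPW (smallPW_perturb h1 hrs hr (c := 1) _ eps0) => // n x n0 xs /=.
by rewrite remainder_T3 !mul1r.
Qed.
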